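(* In the white noise model, fix $0<\gamma<1$ and set $$r_n(s):=(n/\log n)^{-s/(2s+1)},\qquad \mathcal F:=\bigcup_{s\in(0,s_{\max}],\,M>0}C^s_0(M).$$ Then there exist confidence bands $C_n=\{g\in C([0,1]):\|g-\hat f_n\|_\infty\le R_n\}$, whose centre $\hat f_n$ and radius $R_n$ depend only on the data and on $\gamma,s_{\max},\varepsilon,\rho$ (and the fixed wavelet basis), such that: (i) $\limsup_n\sup_{f\in\mathcal F}\mathbb P_f(f\notin C_n)\le\gamma$; and (ii) for a fixed constant $L>0$ (not depending on $s$ or $M$), and any $s\in(0,s_{\max}]$, $M>0$, $$\sup_{f\in C^s_0(M)}\mathbb P_f\left(R_n>\frac{L\,M^{1/(2s+1)}}{2^s-1}\,r_n(s)\right)\to0\quad\text{as }n\to\infty.$$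
   Context: White noise model: for an unknown $f:[0,1]\to\mathbb R$ one observes the process $Y_t=\int_0^t f(u)\,du+n^{-1/2}B_t$, $t\in[0,1]$, with $B$ a standard Brownian motion; $\mathbb P_f$ is the law of the data. $\|\cdot\|_\infty$ is the supremum norm on $[0,1]$. The radius $R_n$ may take the value $+\infty$. Wavelet basis: $\varphi,\psi$ are the scaling function and wavelet of an orthonormal multiresolution analysis of $L^2(\mathbb R)$ such that, for some $K,N\in\mathbb N$: $\varphi,\psi$ are supported in $[1-K,K]$; $\int x^i\psi(x)\,dx=0$ for $i=0,\dots,N-1$; $\varphi$ is twice continuously differentiable. Moreover the 1-periodic function $\sigma_\varphi^2(t):=\sum_{k\in\mathbb Z}\varphi(t-k)^2$ attains its maximum at a unique point $t_0\in[0,1)$, and $(\sigma_\varphi^2)''(t_0)<0$. From these, the Cohen–Daubechies–Vial boundary-corrected construction gives an orthonormal basis of $L^2([0,1])$ consisting of $\varphi_{j_0,k}$, $0\le k<2^{j_0}$, and $\psi_{j,k}$, $j\ge j_0$, $0\le k<2^j$, for a suitable fixed coarsest level $j_0>0$. For $k\in[N,2^j-N)$ the functions are $\varphi_{j_0,k}(x)=2^{j_0/2}\varphi(2^{j_0}x-k)$ and $\psi_{j,k}(x)=2^{j/2}\psi(2^jx-k)$; for the other $k$ they are the boundary functions of that construction. For $f=\sum_k\alpha_k\varphi_{j_0,k}+\sum_{j\ge j_0}\sum_k\beta_{j,k}\psi_{j,k}\in L^2([0,1])$ and $s\in(0,N)$ put $\|f\|_{C^s}:=\max\big(\sup_k|\alpha_k|,\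 \sup_{j,k}2^{j(s+1/2)}|\beta_{j,k}|\big)$ and $C^s(M):=\{f\in L^2([0,1]):\|f\|_{C^s}\le M\}$. Such $f$ are continuous (after modification on a null set). Set $f_{i,j}:=\sum_{l=i}^j\sum_k\beta_{l,k}\psi_{l,k}$ for $i>j_0$, and $f_{j_0,j}:=\sum_k\alpha_k\varphi_{j_0,k}+\sum_{l=j_0}^j\sum_k\beta_{l,k}\psi_{l,k}$. Self-similar functions: fix $s_{\max}\in(0,N)$, $\varepsilon\in(0,1)$, $\rho\in\mathbb N$. For $s\in(0,s_{\max})$, $M>0$, $C^s_0(M)=C^s_0(M,\varepsilon,\rho)$ is the set of $f\in C^s(M)$ with $\|f_{j,\rho j}\|_{C^s}\ge\varepsilon M$ for all $j\ge j_0$. For $s=s_{\max}$, $C^{s_{\max}}_0(M)$ is the set of $f\in C^{s_{\max}}(M)$ for which this inequality holds for $j=j_0$ only. *)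

(* Defs.v *)
From HB Require Import structures.
From mathcomp Require Export all_boot all_order all_algebra.
From mathcomp Require Export all_classical all_reals all_analysis measurable_realfun.
Export Order.TTheory GRing.Theory Num.Theory numFieldNormedType.Exports.

Set Implicit Arguments.
Unset Strict Implicit.
Unset Printing Implicit Defensive.

Global Open Scope classical_set_scope.
Global Open Scope ring_scope.

Section L2.
Context {R : realType}.
Implicit Types (D : set R) (f g : R -> R).

Local Notation mu := (@lebesgue_measure R).

(* Square-integrable functions, not quotiented by a.e. equality. *)
Definition L2 D : set (R -> R) := [set f | f \_ D \in Lfun mu 2%:E].

Definition inner D f g : R := \int[mu]_(x in D) (f x * g x).

Definition orthonormal D (I : eqType) (e : I -> R -> R) : Prop :=
  (forall i, L2 D (e i)) /\ forall i j, inner D (e i) (e j) = (i == j)%:R.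

Definition closed_span D (I : eqType) (e : I -> R -> R) : set (R -> R) :=
  [set f | L2 D f /\ forall eta : R, 0 < eta ->
    exists (s : seq I) (c : I -> R),
      \int[mu]_(x in D) (f x - \sum_(i <- s) c i * e i x) ^+ 2 < eta].

Definition orthonormal_basis D (I : eqType) (e : I -> R -> R)
    (H : set (R -> R)) : Prop :=
  orthonormal D e /\ closed_span D e = H.

End L2.

Section Wavelets.
Context {R : realType}.
Implicit Types (phi psi g : R -> R).

Local Notation mu := (@lebesgue_measure R).

Definition dilate (j : int) g (x : R) : R := Num.sqrt (2 ^ j) * g (2 ^ j * x).

Definition translate (k : int) g (x : R) : R := g (x - k%:~R).

(* The scale-j space of a multiresolution analysis; defined this way, f is in
   V_j iff f(2 .) is in V_(j+1), and each V_j is a closed subspace. *)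
Definition mraV phi (j : int) : set (R -> R) :=
  closed_span setT (fun k : int => dilate j (translate k phi)).

Definition scaling_function phi : Prop :=
  [/\ orthonormal setT (fun k : int => translate k phi),
      forall j, mraV phi j `<=` mraV phi (j + 1),
      forall f, L2 setT f -> forall eta : R, 0 < eta ->
        exists (j : int) (g : R -> R), mraV phi j g /\
          \int[mu]_x (f x - g x) ^+ 2 < eta
    & forall f, (forall j, mraV phi j f) -> {ae mu, forall x, f x = 0}].

Definition mraW0 phi : set (R -> R) :=
  [set f | mraV phi 1 f /\ forall g, mraV phi 0 g -> inner setT f g = 0].

Definition wavelet_of phi psi : Prop :=
  orthonormal_basis setT (fun k : int => translate k psi) (mraW0 phi).

Definition sigma2 phi (t : R) : R :=
  fine (\esum_(k in [set: int]) ((phi (t - k%:~R)) ^+ 2)%:E).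

Definition unique_nondegenerate_max (h : R -> R) : Prop :=
  exists t0 : R, [/\ 0 <= t0 < 1,
    forall t, 0 <= t < 1 -> t != t0 -> h t < h t0 & derive1n 2 h t0 < 0].

(* Cohen-Daubechies-Vial boundary functions at 0, on the half-line and at scale
   one. The functions edge_scaling phi k, k < N, are the restrictions to
   [0, +oo) of the combinations \sum_(m < N) p(m) phi(. - m), with
   p(m) = 'C(N - 1 - m, k); together with the phi(. - m), m >= N, they
   reproduce all polynomials of degree less than N. *)
Definition halfline : set R := `[0, +oo[.

Definition edge_scaling (K N : nat) phi (k : nat) (x : R) : R :=
  \sum_(k <= n < (N + K).-1) 'C(n, k)%:R * phi (x + n%:R - N%:R + 1).

(* Any orthonormalisation of the family g is allowed, Gram-Schmidt in either
   order in particular. *)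
Definition orthonormalisation (N : nat) (D : set R) (g e : nat -> R -> R) :
    Prop :=
  orthonormal D (fun i : 'I_N => e i) /\
  exists A : 'M[R]_N, forall (i : 'I_N) x, D x ->
    e i x = \sum_(l < N) A i l * g l x.

(* The scale-1 edge function minus its projection onto the scale-0 space of the
   half-line. The last sum is finite because dilate 1 (phiL k) vanishes to the
   right of (K + N - 1) / 2, and phi(. - m) to the left of m + 1 - K. *)
Definition edge_wavelet (K N : nat) phi (phiL : nat -> R -> R) (k : nat)
    (x : R) : R :=
  let g := dilate 1 (phiL k) in
  g x - \sum_(l < N) inner halfline g (phiL l) * phiL l x
      - \sum_(N <= m < N + K.*2)
          inner halfline g (translate m phi) * translate m phi x.

Definition cdv_edge (K N : nat) phi (phiL psiL : nat -> R -> R) : Prop :=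
  orthonormalisation N halfline (edge_scaling K N phi) phiL /\
  orthonormalisation N halfline (edge_wavelet K N phi phiL) psiL.

(* The reflection x |-> 1 - x preserves supports in [1 - K, K], and exchanges
   the index k at scale j with 2 ^ j - 1 - k, and the endpoint 1 with 0. *)
Definition mirror g (x : R) : R := g (1 - x).

End Wavelets.

Record wavelet_data (R : realType) := WaveletData {
  suppK : nat;
  momN : nat;
  coarse : nat;
  phi : R -> R;
  psi : R -> R;
  phiL : nat -> R -> R;
  psiL : nat -> R -> R;
  phiR : nat -> R -> R;
  psiR : nat -> R -> R
}.

Section CDV.
Context {R : realType} (W : wavelet_data R).

Local Notation mu := (@lebesgue_measure R).
Local Notation K := (suppK W).
Local Notation N := (momN W).
Local Notation j0 := (coarse W).

Definition unitI : set R := `[0, 1].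

Definition interval_fun (g : R -> R) (gL gR : nat -> R -> R) (j k : nat)
    (x : R) : R :=
  if (k < N)%N then dilate j (gL k) x
  else if (k < 2 ^ j - N)%N then dilate j (translate k g) x
  else dilate j (gR (2 ^ j - k.+1)%N) (1 - x).

Definition phi_jk := interval_fun (phi W) (phiL W) (phiR W).
Definition psi_jk := interval_fun (psi W) (psiL W) (psiR W).

Definition basis_index := ('I_(2 ^ j0) + {i : nat & 'I_(2 ^ (j0 + i))})%type.

Definition basis_fun (u : basis_index) : R -> R :=
  match u with
  | inl k => phi_jk j0 k
  | inr (existT i k) => psi_jk (j0 + i) k
  end.

Record cdv_basis : Prop := CdvBasis {
  phi_scaling : scaling_function (phi W);
  psi_wavelet : wavelet_of (phi W) (psi W);
  phi_supp : forall x, phi W x != 0 -> 1 - K%:R <= x <= K%:R;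
  psi_supp : forall x, psi W x != 0 -> 1 - K%:R <= x <= K%:R;
  psi_moments : forall i, (i < N)%N -> \int[mu]_x (x ^+ i * psi W x) = 0;
  phi_C2 : [/\ forall x, derivable (phi W) x 1,
               forall x, derivable (derive1 (phi W)) x 1
             & continuous (derive1n 2 (phi W))];
  sigma2_max : unique_nondegenerate_max (sigma2 (phi W));
  left_edge : cdv_edge K N (phi W) (phiL W) (psiL W);
  right_edge : cdv_edge K N (mirror (phi W)) (phiR W) (psiR W);
  (* The coarsest level is suitable: the edge functions are indexed
     consistently and the construction yields an orthonormal basis. *)
  coarse_gt0 : (0 < j0)%N;
  coarse_ge : (N.*2 <= 2 ^ j0)%N;
  interval_basis : orthonormal_basis unitI basis_fun (L2 unitI)
}.

Section Classes.
Implicit Types (f : R -> R) (s M : R).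

Definition alpha f (k : nat) : R := inner unitI f (phi_jk j0 k).
Definition beta f (j k : nat) : R := inner unitI f (psi_jk j k).

Definition Cs_norm s f : \bar R :=
  maxe (ereal_sup [set `|alpha f k|%:E | k in [set k | (k < 2 ^ j0)%N]])
       (ereal_sup [set (2 `^ (jk.1%:R * (s + 2^-1)) * `|beta f jk.1 jk.2|)%:E
                  | jk in [set jk : nat * nat |
                           (j0 <= jk.1)%N && (jk.2 < 2 ^ jk.1)%N]]).

Definition Cs_ball s M : set (R -> R) :=
  [set f | L2 unitI f /\ (Cs_norm s f <= M%:E)%E].

(* The scaling-function part belongs to f_{i,j} exactly when i = j0. *)
Definition detail (i j : nat) f (x : R) : R :=
  (if i == j0 then \sum_(k < 2 ^ j0) alpha f k * phi_jk j0 k x else 0)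
  + \sum_(i <= l < j.+1) \sum_(k < 2 ^ l) beta f l k * psi_jk l k x.

Definition self_similar (smax eps : R) (rho : nat) s M : set (R -> R) :=
  [set f | Cs_ball s M f /\
    forall j, (j0 <= j)%N -> (s < smax \/ j = j0) ->
      ((eps * M)%:E <= Cs_norm s (detail j (rho * j) f))%E].

Definition self_similar_union (smax eps : R) (rho : nat) : set (R -> R) :=
  [set f | exists s M, [/\ 0 < s <= smax, 0 < M &
                           self_similar smax eps rho s M f]].

End Classes.

End CDV.

Section WhiteNoise.
Context {R : realType}.

Local Notation mu := (@lebesgue_measure R).

(* Paths, with the sigma-algebra generated by the evaluations at the points of
   [0, 1]: a measurable function of a path only depends on its restriction to
   [0, 1]. *)
Definition cylinders : set (set (R -> R)) :=
  [set C | exists (t : R) (A : set R),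
     [/\ unitI t, measurable A & C = [set y | A (y t)]]].

Definition data_path := g_sigma_algebraType cylinders.

Section Model.
Context {d : measure_display} {T : measurableType d} (P : probability T R).

Definition increment_event (B : R -> {RV P >-> R}) (s t : R) (A : set R) :
    set T :=
  [set w | A (B t w - B s w)].

(* Standard Brownian motion on [0, 1]; the increments over successive intervals
   are independent centred Gaussian variables, the second argument of
   normal_prob being the standard deviation. *)
Definition brownian_motion (B : R -> {RV P >-> R}) : Prop :=
  [/\ forall w, B 0 w = 0,
      forall w, {within unitI, continuous (fun t => B t w)},
      forall (s t : R) (A : set R), 0 <= s -> s < t -> t <= 1 ->
        measurable A ->
        P (increment_event B s t A) = normal_prob 0 (Num.sqrt (t - s)) A
    & forall (m : nat) (t : nat -> R) (A : nat -> set R),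
        (forall i, (i <= m)%N -> unitI (t i)) ->
        (forall i, (i < m)%N -> t i < t i.+1) ->
        (forall i, (i < m)%N -> measurable (A i)) ->
        P (\bigcap_(i in [set i | (i < m)%N])
             increment_event B (t i) (t i.+1) (A i)) =
        (\prod_(i < m) P (increment_event B (t i) (t i.+1) (A i)))%E].

Definition white_noise (B : R -> {RV P >-> R}) (n : nat) (f : R -> R) (w : T) :
    data_path :=
  fun t => \int[mu]_(u in `[0, t]) f u + (Num.sqrt n%:R)^-1 * B t w.

End Model.

Definition sup_norm (g : R -> R) : \bar R :=
  ereal_sup [set `|g x|%:E | x in unitI].

Definition band (c : R -> R) (r : \bar R) : set (R -> R) :=
  [set g | {within unitI, continuous g} /\
           (sup_norm (fun x => g x - c x)%R <= r)%E].

(* Membership of an element of L^2([0, 1]) in a set of continuous functions,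
   through its continuous version. *)
Definition in_band (f : R -> R) (C : set (R -> R)) : Prop :=
  exists g, C g /\ {ae mu, forall x, unitI x -> g x = f x}.

(* The continuity of the centre and the measurability of its evaluations make
   the non-coverage events measurable. *)
Definition band_statistic (c : data_path -> R -> R) (r : data_path -> \bar R) : Prop :=
  [/\ forall y, {within unitI, continuous (c y)},
      forall x, unitI x -> measurable_fun [set: data_path] (fun y => c y x),
      forall y, (0 <= r y)%E
    & measurable_fun [set: data_path] r].

Definition rate (n : nat) (s : R) : R :=
  (n%:R / ln n%:R) `^ (- s / (2 * s + 1)).

End WhiteNoise.

Arguments data_path : clear implicits.

(* Main.v *)
(* Empirical coefficients are Wiener integrals of the basis functions against the
   data, hence are exact coefficients plus Gaussian noise. By the union bound,
   outside an event of probability O(1/n) all those of the levels l <= J, where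
   2^J <= n < 2^(J+1), have error at most 2 (log n / n)^(1/2). Everything else is
   deterministic on that event. The centre is the hard-thresholding estimator,
   whose error for f in C^s(M) is bounded, at each resolution j, by a noise term
   over the levels up to j plus a tail term M 2^(-j s) / (2^s - 1). The radius is
   the supremum, over the pairs (s', M') in a countable grid that the empirical
   coefficients do not rule out, of the best such bound over j. A pair close to
   the true one is never ruled out, which gives coverage. Conversely, upper bounds
   and self-similarity of both the true and a consistent pair force, at the optimal
   resolution j of the true pair, M' 2^(-j s') to be at most a constant times
   M 2^(-j s), and s' to be at least s / 2, which bounds the radius. No limit law
   of the maximum of the noise is involved. *)

Require Import Defs.
From mathcomp Require Import ring lra zify.

Set Implicit Arguments.
Unset Strict Implicit.
Unset Printing Implicit Defensive.

(** * Square-integrable functions *)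

(** The pathwise Wiener integral used here asks for continuously differentiable integrands, while
    [psi] is known only as an element of L^2. Lying in V_1 with compact support, it agrees almost
    everywhere with a finite combination of dilates of [phi]; this version replaces it throughout,
    which changes no coefficient of f. A true pair (s, M) and a consistent pair (s', M') are
    compared through the ratio of their envelopes at level l, (M' / M) 2^(l (s - s')), which is
    monotone in l. If s' >= s, a bound at a coarse level carries over to all finer ones. If s' < s,
    then s' < smax, so the consistent pair must look self-similar at all observed levels; the
    comparison relies on the self-similarity of the true function at the coarsest level only, which
    is what is available when s = smax. Two distant levels then control s - s'. The bound s' >= s /
    2 serves to trade 1 / (2^s' - 1) for a fixed multiple of 1 / (2^s - 1). The margin eps becomes
    eps / 2 in passing from norms to single coefficients, and eps / 8 in passing to a grid pair. *)

Section SquareIntegrable.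
Context {R : realType}.
Local Notation mu := (@lebesgue_measure R).
Variables (D : set (measurableTypeR R)) (mD : measurable D).
Implicit Types (f g : R -> R).

Lemma L2P f : L2 D f <->
  measurable_fun D f /\ mu.-integrable D (fun x => (f x ^+ 2)%:E).
Proof.
have sqr_restrict : (fun x => ((f \_ D) x ^+ 2)%:E) =
    ((fun x => (f x ^+ 2)%:E) \_ D).
  by apply/funext => x; rewrite /patch; case: ifP => // _; rewrite expr0n.
rewrite /L2 /=; split=> [fL2|[mf intf]].
  have /andP[] := fL2; rewrite !inE/= => /(measurable_restrictT _ mD) mf _.
  split => //; apply/integrable_mkcond => //.
  by rewrite -sqr_restrict; exact: Lfun2_integrable_sqr fL2.
apply/andP; split; first by rewrite inE/=; exact/(measurable_restrictT _ mD).
rewrite inE/= /finite_norm unlock poweR_lty//.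
under eq_integral do rewrite /= powR_mulrn// -normrX ger0_norm ?sqr_ge0//=.
move: intf => /integrable_mkcond - /(_ mD).
rewrite -sqr_restrict => /integrableP[_].
by under eq_integral do rewrite /= ger0_norm ?sqr_ge0//=.
Qed.

Lemma L2_measurable f : L2 D f -> measurable_fun D f.
Proof. by case/L2P. Qed.

Lemma L2_integrableM f g : L2 D f -> L2 D g ->
  mu.-integrable D (fun x => (f x * g x)%:E).
Proof.
move=> /L2P[mf f2] /L2P[mg g2].
apply: (le_integrable mD _ _ (integrableD mD f2 g2)) => /=.
  by apply/measurable_EFinP; exact: measurable_funM.
move=> x _ /=; rewrite lee_fin.
rewrite [leRHS]ger0_norm ?addr_ge0 ?sqr_ge0// normrM.
have := sqr_ge0 (`|f x| - `|g x|).
rewrite -[f x ^+ 2]real_normK ?num_real// -[g x ^+ 2]real_normK ?num_real//.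
have := normr_ge0 (f x); have := normr_ge0 (g x); nra.
Qed.

Lemma L2D f g : L2 D f -> L2 D g -> L2 D (fun x => f x + g x).
Proof.
move=> fL gL; have /L2P[mf f2] := fL; have /L2P[mg g2] := gL.
apply/L2P; split; first exact: measurable_funD.
have -> : (fun x => ((f x + g x) ^+ 2)%:E) =
    (fun x => (f x ^+ 2)%:E + (f x * g x)%:E + ((f x * g x)%:E + (g x ^+ 2)%:E))%E.
  by apply/funext => x; rewrite -!EFinD; congr EFin; ring.
have fg := L2_integrableM fL gL.
by apply: (@integrableD _ _ _ mu D mD (fun x => _ + _)%E (fun x => _ + _)%E);
  apply: integrableD.
Qed.

Lemma L2Z c f : L2 D f -> L2 D (fun x => c * f x).
Proof.
move=> /L2P[mf f2]; apply/L2P; split; first exact: measurable_funM.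
have -> : (fun x => ((c * f x) ^+ 2)%:E) = (fun x => (c ^+ 2)%:E * (f x ^+ 2)%:E)%E.
  by apply/funext => x; rewrite -EFinM exprMn.
exact: integrableZl.
Qed.

Lemma L2B f g : L2 D f -> L2 D g -> L2 D (fun x => f x - g x).
Proof.
move=> fL gL; have := L2D fL (L2Z (-1) gL).
by congr L2; apply/funext => x; rewrite mulN1r.
Qed.

Lemma L2_0 : L2 D (fun=> 0).
Proof.
apply/L2P; split; first exact: measurable_cst.
have -> : (fun=> ((0 : R) ^+ 2)%:E) = @cst R _ (0%:E : \bar R).
  by apply/funext => x; rewrite expr0n.
exact: integrable0.
Qed.

Lemma L2_sum (I : Type) (s : seq I) (F : I -> R -> R) :
  (forall i, L2 D (F i)) -> L2 D (fun x => \sum_(i <- s) F i x).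
Proof.
move=> FL; elim: s => [|i s IHs].
  by have := L2_0; congr L2; apply/funext => x; rewrite big_nil.
by have := L2D (FL i) IHs; congr L2; apply/funext => x; rewrite big_cons.
Qed.

Lemma innerC f g : inner D f g = inner D g f.
Proof. by apply: eq_Rintegral => x _; rewrite mulrC. Qed.

Lemma innerDl f g h : L2 D f -> L2 D g -> L2 D h ->
  inner D (fun x => f x + g x) h = inner D f h + inner D g h.
Proof.
move=> fL gL hL; rewrite -[RHS](RintegralD mD (L2_integrableM fL hL) (L2_integrableM gL hL)).
by apply: eq_Rintegral => x _; rewrite mulrDl.
Qed.

Lemma innerZl c f h : L2 D f -> L2 D h ->
  inner D (fun x => c * f x) h = c * inner D f h.
Proof.
move=> fL hL; rewrite -[RHS](RintegralZl _ mD (L2_integrableM fL hL)).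
by apply: eq_Rintegral => x _; rewrite mulrA.
Qed.

Lemma inner_suml (I : Type) (s : seq I) (F : I -> R -> R) h :
  (forall i, L2 D (F i)) -> L2 D h ->
  inner D (fun x => \sum_(i <- s) F i x) h = \sum_(i <- s) inner D (F i) h.
Proof.
move=> FL hL; elim: s => [|i s IHs].
  rewrite big_nil -[RHS](Rintegral_set0 mu (fun=> 0)) /inner.
  under eq_Rintegral do rewrite big_nil mul0r.
  by rewrite Rintegral_cst// mul0r Rintegral_set0.
rewrite big_cons -IHs -innerDl//; last exact: L2_sum.
by apply: eq_Rintegral => x _; rewrite big_cons.
Qed.

End SquareIntegrable.

(** * Best approximation in the closed span of an orthonormal family *)

Section Projection.
Context {R : realType}.
Local Notation mu := (@lebesgue_measure R).
Variables (D : set (measurableTypeR R)) (mD : measurable D) (I : eqType) (e : I -> R -> R).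
Hypothesis e_orth : orthonormal D e.
Implicit Types (f : R -> R) (s : seq I) (c : I -> R).

Let eL i : L2 D (e i) := e_orth.1 i.

Let L2comb s c : L2 D (fun x => \sum_(i <- s) c i * e i x).
Proof. by apply: L2_sum => // i; exact: L2Z. Qed.

Lemma inner_comb s c i : uniq s ->
  inner D (fun x => \sum_(l <- s) c l * e l x) (e i) = if i \in s then c i else 0.
Proof.
move=> us; rewrite inner_suml//; last by move=> j; exact: L2Z.
under eq_bigr => l _ do rewrite innerZl// e_orth.2.
case: ifPn => [si|si].
  rewrite (bigD1_seq i)//= eqxx mulr1 big1 ?addr0// => l li.
  by rewrite (negbTE li) mulr0.
rewrite big_seq big1// => l ls; have /negbTE -> : l != i; last by rewrite mulr0.
by apply: contraNneq si => <-.
Qed.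

(** Pythagoras for arbitrary coefficients: only the last sum depends on [c], and it vanishes when
    [c] consists of the inner products. *)
Lemma sqr_distance_comb f s c : uniq s -> L2 D f ->
  \int[mu]_(x in D) (f x - \sum_(i <- s) c i * e i x) ^+ 2 =
  inner D f f - \sum_(i <- s) inner D f (e i) ^+ 2
  + \sum_(i <- s) (inner D f (e i) - c i) ^+ 2.
Proof.
move=> us fL; set h := fun x => \sum_(i <- s) c i * e i x.
have hL : L2 D h by exact: L2comb.
have -> : \int[mu]_(x in D) (f x - \sum_(i <- s) c i * e i x) ^+ 2 =
    inner D f f + (inner D h h - 2 * inner D h f).
  rewrite -(RintegralZl _ mD (L2_integrableM mD hL fL)).
  rewrite -RintegralB//; last 2 first.
  - exact: L2_integrableM.
  - exact: (integrableZl mD 2 (L2_integrableM mD hL fL)).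
  rewrite -RintegralD//; last 2 first.
  - exact: L2_integrableM.
  - exact: (integrableB mD (L2_integrableM mD hL hL)
                           (integrableZl mD 2 (L2_integrableM mD hL fL))).
  by apply: eq_Rintegral => x _; rewrite -/(h x); ring.
have hh : inner D h h = \sum_(i <- s) c i ^+ 2.
  rewrite [LHS]inner_suml//; last by move=> i; exact: L2Z.
  rewrite big_seq [RHS]big_seq; apply: eq_bigr => i si.
  by rewrite innerZl// innerC inner_comb// si expr2.
have hf : inner D h f = \sum_(i <- s) c i * inner D f (e i).
  rewrite [LHS]inner_suml//; last by move=> i; exact: L2Z.
  by apply: eq_bigr => i _; rewrite innerZl// innerC.
rewrite hh hf mulr_sumr -addrA; congr (_ + _).
rewrite -sumrB addrC -sumrB; apply: eq_bigr => i _; ring.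
Qed.

(* Best approximation: enlarging the index set and replacing the coefficients
   by inner products can only decrease the distance. *)
Lemma closed_span_approx f eta : closed_span D e f -> 0 < eta ->
  exists s0 : seq I, forall s, uniq s -> {subset s0 <= s} ->
    \int[mu]_(x in D) (f x - \sum_(i <- s) inner D f (e i) * e i x) ^+ 2 < eta.
Proof.
move=> [fL fspan] /fspan[s0 [c s0c]]; exists s0 => s us s0s.
apply: le_lt_trans s0c.
(* The list [s0] may contain repetitions; a repeated index contributes its coefficient times its
   multiplicity. *)
have s0s_comb x : \sum_(i <- s0) c i * e i x =
    \sum_(i <- s) (c i *+ count_mem i s0) * e i x.
  rewrite -big_undup_iterop_count/=.
  rewrite [RHS](bigID [in s0])/= [X in _ = _ + X]big1 ?addr0; last first.
    by move=> i /count_memPn ->; rewrite mulr0n mul0r.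
  rewrite -[RHS]big_filter; rewrite (perm_big [seq i <- s | i \in s0]).
    by apply: eq_bigr => i _; rewrite mulrnAl Monoid.iteropE iter_addr_0.
  apply: uniq_perm; rewrite ?undup_uniq ?filter_uniq//.
  by move=> i; rewrite mem_undup mem_filter andb_idr//; exact: s0s.
under [leRHS]eq_Rintegral do rewrite s0s_comb.
rewrite !sqr_distance_comb// lerD2l ler_sum// => i _.
by rewrite subrr expr0n sqr_ge0.
Qed.

End Projection.

(** * Parameters consistent with noisy coefficients *)

Section PowersOfTwo.
Context {R : realType}.
Implicit Types x y : R.

Lemma pow2_gt0 x : 0 < 2 `^ x :> R.
Proof. exact: powR_gt0. Qed.

Lemma pow2_ge0 x : 0 <= 2 `^ x :> R.
Proof. exact: powR_ge0. Qed.

Lemma pow2D x y : 2 `^ (x + y) = 2 `^ x * 2 `^ y :> R.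
Proof. by rewrite powRD// (_ : 2 == 0 = false) ?implybT//; apply/negbTE. Qed.

Lemma ler_pow2 x y : (2 `^ x <= 2 `^ y :> R) = (x <= y).
Proof.
apply/idP/idP => [|xy]; last by apply: ler_powR => //; rewrite ler1n.
rewrite -ler_ln ?posrE ?pow2_gt0// !ln_powR ler_pM2r// ln_gt0// ltr1n//.
Qed.

Lemma pow2_natr n : 2 `^ n%:R = 2 ^+ n :> R.
Proof. by rewrite powR_mulrn. Qed.

Lemma pow2_gt1 x : 0 < x -> 1 < 2 `^ x :> R.
Proof.
by move=> x0; rewrite -[ltLHS](powRr0 2) ltNge ler_pow2 -ltNge.
Qed.

End PowersOfTwo.

(** Serves to extrapolate: a factor 2^((l - l0) d) <= Q, with d > 0, gives 2^((j - l) d) <= Q^(2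
    rho). As [l >= 1 + 2 * rho * j0], the part of 2 rho l beyond rho l pays for both rho and 2 rho
    l0. *)
Lemma sub_leq_mul2 (rho j0 j l0 l : nat) : (j <= rho * l.+1)%N ->
  (l0 <= rho * j0)%N -> (1 + 2 * rho * j0 <= l)%N -> (j - l <= 2 * rho * (l - l0))%N.
Proof.
move=> jl l0j j0l.
have A : (rho * (1 + 2 * rho * j0) <= rho * l)%N by rewrite leq_mul2l j0l orbT.
have B : (rho * l0 <= rho * (rho * j0))%N by rewrite leq_mul2l l0j orbT.
have E : (rho * (1 + 2 * rho * j0) = rho + 2 * (rho * (rho * j0)))%N.
  by rewrite mulnDr muln1 -mulnA mulnCA.
rewrite -mulnA mulnBr; move: jl A B; rewrite mulnS E.
move: (rho * (rho * j0))%N (rho * l)%N (rho * l0)%N => x y z; lia.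
Qed.

Section Envelope.
Context {R : realType}.

(* The bound on the wavelet coefficients at level l of a function in C^s(M);
   level 0 stands for the scaling coefficients. *)
Definition envelope (s M : R) (l : nat) : R := M * 2 `^ (- (l%:R * (s + 2^-1))).

Lemma envelope_gt0 s M l : 0 < M -> 0 < envelope s M l.
Proof. by move=> M0; rewrite mulr_gt0// pow2_gt0. Qed.

Lemma envelope_anti s M l l' : 0 < M -> 0 < s -> (l <= l')%N ->
  envelope s M l' <= envelope s M l.
Proof.
move=> M0 s0 ll'; rewrite ler_pM2l// ler_pow2 lerN2 ler_wpM2r ?ler_nat//.
by rewrite addr_ge0// ltW.
Qed.

Lemma envelope_ratio s M s' M' l : 0 < M ->
  envelope s' M' l = 2 `^ (l%:R * (s - s')) * (M' / M) * envelope s M l.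
Proof.
move=> M0; rewrite /envelope.
have -> : - (l%:R * (s' + 2^-1)) = l%:R * (s - s') + - (l%:R * (s + 2^-1)) by ring.
rewrite pow2D; field; lra.
Qed.

Variables (cnt : nat -> nat) (smax : R) (rho j0 : nat).

(** With [tau = 0] this is a property of exact coefficients; the slack [tau] keeps it true of
    coefficients observed with error at most [tau]. *)
Definition large_coefficient (a : nat -> nat -> R) (tau eps s M : R) (p q : nat) :=
  exists l k, [/\ (p <= l <= q)%N, (k < cnt l)%N &
                  eps * envelope s M l <= `|a l k| + tau].

(* The pairs (s, M) for which coefficients at distance at most tau from a could
   be those of a self-similar function. *)
Definition consistent (a : nat -> nat -> R) (tau eps : R) (J : nat) (s M : R) :=
  [/\ forall l k, (l <= J)%N -> (k < cnt l)%N -> `|a l k| <= envelope s M l + tau,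
      large_coefficient a tau eps s M 0 (rho * j0)
    & s < smax -> forall j, (j0 < j)%N -> (rho * j <= J)%N ->
        large_coefficient a tau eps s M j (rho * j)].

Section Comparison.
Variables (c a : nat -> nat -> R) (tau eps s M : R) (J : nat).
Hypotheses (s_gt0 : 0 < s) (s_smax : s <= smax) (M_gt0 : 0 < M).
Hypotheses (eps01 : 0 < eps < 1) (rho_gt0 : (0 < rho)%N).
Hypothesis c_le : forall l k, (k < cnt l)%N -> `|c l k| <= envelope s M l.
Hypothesis c_large0 : large_coefficient c 0 (eps / 2) s M 0 (rho * j0).
Hypothesis a_near : forall l k, (l <= J)%N -> (k < cnt l)%N -> `|a l k - c l k| <= tau.

Let eps_gt0 : 0 < eps. Proof. by case/andP: eps01. Qed.

(** Up to level [J] the envelope of (s', M') lies between that of (s, M) and four times it. Upper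
    bounds therefore persist, and lower bounds persist once eps / 2 is divided by 4. The last
    condition ensures that the pair is asked for self-similarity at all levels only if the true
    class provides it. *)
Lemma consistent_near s' M' : (rho * j0 <= J)%N ->
  (s < smax -> forall j, (j0 < j)%N -> large_coefficient c 0 (eps / 2) s M j (rho * j)) ->
  s' <= s -> 2 `^ (J%:R * (s - s')) <= 2 -> M <= M' <= 2 * M ->
  (s' < smax -> s < smax) ->
  consistent a tau (eps / 8) J s' M'.
Proof.
move=> rj0J c_large s's Jss' /andP[MM' M'M] s'smax.
have Mr : 1 <= M' / M <= 2 by rewrite ler_pdivlMr// ler_pdivrMr// mul1r MM'.
have up l : envelope s M l <= envelope s' M' l.
  rewrite (envelope_ratio s s' M' l M_gt0).
  apply: ler_peMl; first exact/ltW/envelope_gt0.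
  apply: mulr_ege1; last by case/andP: Mr.
  by rewrite -[leLHS](powRr0 2) ler_pow2 mulr_ge0// subr_ge0.
have large p q : (q <= J)%N -> large_coefficient c 0 (eps / 2) s M p q ->
    large_coefficient a tau (eps / 8) s' M' p q.
  move=> qJ [l [k [/andP[pl lq] lk]]]; rewrite addr0 => clk; exists l, k; split => //.
    by rewrite pl.
  have lJ := leq_trans lq qJ.
  have le4 : envelope s' M' l <= 4 * envelope s M l.
    rewrite (envelope_ratio s s' M' l M_gt0) ler_pM2r ?envelope_gt0//.
    rewrite (_ : 4 = 2 * 2 :> R); last by ring.
    rewrite ler_pM ?pow2_ge0//; first by rewrite divr_ge0 ?ltW// (lt_le_trans M_gt0).
      apply: le_trans Jss'; rewrite ler_pow2 ler_wpM2r ?ler_nat//.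
      by rewrite subr_ge0.
    by case/andP: Mr.
  have : eps / 8 * envelope s' M' l <= `|c l k|.
    apply: le_trans clk; have := eps_gt0; nra.
  move=> /le_trans; apply.
  have := a_near lJ lk; have := ler_normB (a l k) (a l k - c l k).
  rewrite opprB addrCA subrr addr0; lra.
split.
- move=> l k lJ lk; have := a_near lJ lk; have := ler_normD (a l k - c l k) (c l k).
  rewrite subrK; have := c_le lk; have := up l; lra.
- exact: large.
- by move=> /s'smax /c_large{}c_large j j0j rjJ; exact/large/c_large.
Qed.

Variables (eps' s' M' : R) (js : nat).
Hypotheses (M'_gt0 : 0 < M') (eps'01 : 0 < eps' < 1).
Hypothesis cons : consistent a tau eps' J s' M'.
Hypotheses (jsJ : (js <= J)%N) (tau_js : tau <= envelope s M js).
Hypothesis tau_j0 : tau <= eps / 8 * envelope s M (rho * j0).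
Hypothesis js_large : (rho * (1 + 2 * rho * j0) <= js)%N.
Hypothesis js_s : 12 / (eps * eps') < 2 `^ ((js %/ rho - rho * j0)%:R * (s / 2)).

Let eps'_gt0 : 0 < eps'. Proof. by case/andP: eps'01. Qed.
Let d := s - s'.
Let Q := 12 / (eps * eps').

Let jsrho : (1 + 2 * rho * j0 <= js %/ rho)%N.
Proof. by rewrite leq_divRL// mulnC. Qed.

Let rj0js : (rho * j0 <= js)%N.
Proof.
apply: leq_trans js_large; rewrite leq_pmul2l// add1n; apply: leqW.
by rewrite leq_pmull// muln_gt0.
Qed.

(** A coefficient large for (s', M') is at most |c| + tau in the observations, and both |c| and
    [tau] are below the true envelope up to level [js]; hence the constant 3. *)
Let upper p q : (q <= js)%N -> large_coefficient a tau eps' s' M' p q ->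
  exists2 l, (p <= l <= q)%N & eps' * (M' * 2 `^ (l%:R * d)) <= 3 * M.
Proof.
move=> qjs [l [k [/andP[pl lq] lk alk]]]; exists l; first by rewrite pl.
have lJ : (l <= J)%N by apply: leq_trans lq (leq_trans qjs jsJ).
have tl : tau <= envelope s M l.
  by apply: le_trans tau_js _; apply: envelope_anti => //; exact: leq_trans lq qjs.
have : eps' * envelope s' M' l <= 3 * envelope s M l.
  apply: le_trans alk _.
  have := a_near lJ lk; have := ler_normD (a l k - c l k) (c l k).
  rewrite subrK; have := c_le lk; lra.
rewrite (envelope_ratio s s' M' l M_gt0) mulrA ler_pM2r ?envelope_gt0// -/d.
rewrite (_ : eps' * (_ * _) = eps' * (M' * 2 `^ (l%:R * d)) / M); last by ring.
by rewrite ler_pdivrMr.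
Qed.

(** A true coefficient of size eps / 2 times the envelope is seen up to [tau], and the observation
    is bounded by the envelope of (s', M') plus [tau]. As 2 tau is at most eps / 4 times the true
    envelope, eps / 4 remains. *)
Let lower : exists2 l, (l <= rho * j0)%N & eps / 4 * M <= M' * 2 `^ (l%:R * d).
Proof.
have [l [k [/andP[_ lq] lk]]] := c_large0; rewrite addr0 => clk.
exists l => //.
have lJ : (l <= J)%N by apply: leq_trans lq (leq_trans rj0js jsJ).
have tl : tau <= eps / 8 * envelope s M l.
  apply: le_trans tau_j0 _; apply: ler_wpM2l; last exact: envelope_anti.
  by rewrite divr_ge0// ltW.
have : eps / 4 * envelope s M l <= envelope s' M' l.
  have [/(_ _ _ lJ lk) + _ _] := cons.
  have := a_near lJ lk; have := ler_normB (a l k) (a l k - c l k).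
  rewrite opprB addrCA subrr addr0; lra.
rewrite (envelope_ratio s s' M' l M_gt0) ler_pM2r ?envelope_gt0//.
by rewrite mulrA ler_pdivlMr// -/d [M' * _]mulrC.
Qed.

(** With d = s - s', the envelope ratio at level l is (M' / M) 2^(l d). For d > 0, [upper] at a
    level l2 between js / rho and js and [lower] at a level l0 <= rho j0 give, after division,
    2^((l2 - l0) d) <= 3 * 4 / (eps eps') = Q. If d exceeded s / 2 this would contradict [js_s]; and
    raising it to the power 2 rho carries the bound on the ratio from l2 to js. *)
Lemma consistent_compare :
  s / 2 <= s' /\
  M' * 2 `^ (- (js%:R * s')) <=
    3 / eps' * Q ^+ (2 * rho) * (M * 2 `^ (- (js%:R * s))).
Proof.
have Q1 : 1 <= Q.
  rewrite /Q ler_pdivlMr ?mulr_gt0// mul1r.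
  by case/andP: eps01 => *; case/andP: eps'01 => *; nra.
have QX1 : 1 <= Q ^+ (2 * rho) by exact: exprn_ege1.
suff [s2 main] : s / 2 <= s' /\
    M' * 2 `^ (js%:R * d) <= 3 / eps' * Q ^+ (2 * rho) * M.
  split => //.
  have -> : - (js%:R * s') = js%:R * d + - (js%:R * s) by rewrite /d; ring.
  by rewrite pow2D !mulrA ler_pM2r ?pow2_gt0//; move: main; rewrite !mulrA.
have [_ /(upper rj0js)[l1 /andP[_ l1j] H1] cons'] := cons.
have {}H1 : M' * 2 `^ (l1%:R * d) <= 3 / eps' * M.
  by rewrite mulrAC ler_pdivlMr// mulrC.
(* When s' >= s the ratio decreases with the level, so the bound at the coarse level [l1] is
   enough. *)
have [d0|d0] := leP d 0.
  split; first by move: d0 s_gt0; rewrite /d; lra.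
  apply: (@le_trans _ _ (M' * 2 `^ (l1%:R * d))).
    rewrite ler_pM2l// ler_pow2 ler_wnM2r// ler_nat.
    exact: leq_trans l1j rj0js.
  apply: le_trans H1 _; rewrite ler_pM2r// ler_peMr//.
  by rewrite divr_ge0// ltW.
(* This strict inequality opens the condition on all levels in [consistent], even when s = smax. *)
have s'smax : s' < smax by apply: lt_le_trans s_smax; rewrite -subr_gt0.
have j0rho : (j0 < js %/ rho)%N.
  apply: leq_trans jsrho; rewrite add1n ltnS.
  by rewrite leq_pmull// muln_gt0.
have rrjs : (rho * (js %/ rho) <= js)%N by rewrite mulnC leq_trunc_div.
have [l2 /andP[jl2 l2r] H2] :=
  upper rrjs (cons' s'smax _ j0rho (leq_trans rrjs jsJ)).
have [l0 l0j H0] := lower.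
have l20 : (l0 <= l2)%N.
  apply: leq_trans l0j (leq_trans _ jl2); apply: leq_trans jsrho.
  by rewrite -mulnA mul2n -addnn addnA leq_addl.
have HQ : 2 `^ ((l2 - l0)%:R * d) <= Q.
  rewrite /Q ler_pdivlMr ?mulr_gt0//.
  have E : 2 `^ (l2%:R * d) = 2 `^ ((l2 - l0)%:R * d) * 2 `^ (l0%:R * d).
    by rewrite -pow2D natrB//; congr (_ `^ _); ring.
  rewrite -(ler_pM2r M_gt0).
  have A0 := pow2_gt0 (l0%:R * d).
  have A1 := pow2_gt0 ((l2 - l0)%:R * d).
  have step1 : eps' * (eps / 4 * M * 2 `^ ((l2 - l0)%:R * d)) <= 3 * M.
    apply: le_trans H2; rewrite ler_pM2l// E.
    rewrite (_ : M' * _ = M' * 2 `^ (l0%:R * d) * 2 `^ ((l2 - l0)%:R * d)); last by ring.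
    by rewrite ler_pM2r.
  lra.
have js_l2 : (js - l2 <= 2 * rho * (l2 - l0))%N.
  apply: sub_leq_mul2 l0j (leq_trans jsrho jl2).
  apply: (leq_trans (ltnW (ltn_ceil js rho_gt0))).
  by rewrite mulnC leq_pmul2l.
have HQr : 2 `^ ((js - l2)%:R * d) <= Q ^+ (2 * rho).
  apply: (@le_trans _ _ ((2 `^ ((l2 - l0)%:R * d)) ^+ (2 * rho))); last first.
    by rewrite lerXn2r ?nnegrE ?pow2_ge0// (le_trans _ HQ)// pow2_ge0.
  rewrite -powR_mulrn ?pow2_ge0// -powRrM ler_pow2 mulrAC ler_pM2r//.
  by rewrite -natrM ler_nat mulnC.
split.
  rewrite leNgt; apply/negP => s2.
  suff /(lt_le_trans js_s) : 2 `^ ((js %/ rho - rho * j0)%:R * (s / 2)) <= Q.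
    by rewrite ltxx.
  apply: le_trans HQ.
  rewrite ler_pow2 ler_pM//; first by rewrite divr_ge0 ?ltW.
    by rewrite ler_nat leq_sub.
  by rewrite /d; lra.
have -> : js%:R * d = l2%:R * d + (js - l2)%:R * d.
  by rewrite natrB; [ring|exact: leq_trans l2r rrjs].
rewrite pow2D mulrA.
have -> : 3 / eps' * Q ^+ (2 * rho) * M = 3 * M / eps' * Q ^+ (2 * rho) by ring.
apply: ler_pM => //; first by rewrite mulr_ge0 ?pow2_ge0// ltW.
by rewrite ler_pdivlMr// mulrC.
Qed.

End Comparison.
End Envelope.

(** * The optimal resolution and the size of the radius *)

Section Asymptotics.
Context {R : realType}.

(** The factor 2 makes the Gaussian tail at 2 (log n)^(1/2) equal to 2 / n^2, small enough for a
    union over a number of coefficients of order n. *)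
Definition noise_level (n : nat) : R := 2 * Num.sqrt (ln n%:R / n%:R).

(* The error of thresholding at resolution j: noise up to level j, and signal of
   the finer levels. *)
Definition error_bound (D tau s M : R) (j : nat) : R :=
  12 * D * tau * 2 `^ (j%:R / 2) + D * (M * 2 `^ (- (j%:R * s))) / (2 `^ s - 1).

Lemma noise_level_gt0 n : (2 <= n)%N -> 0 < noise_level n.
Proof.
move=> n2; rewrite mulr_gt0// sqrtr_gt0 divr_gt0 ?ltr0n ?(ltn_trans _ n2)//.
by rewrite ln_gt0// ltr1n.
Qed.

Lemma noise_level_sqr n : (2 <= n)%N -> noise_level n ^+ 2 = 4 * (ln n%:R / n%:R).
Proof.
move=> n2; rewrite exprMn sqr_sqrtr -?natrX// divr_ge0// ln_ge0// ler1n.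
exact: ltn_trans n2.
Qed.

Lemma noise_level_small (e : R) : 0 < e ->
  exists n0, forall n, (n0 <= n)%N -> noise_level n <= e.
Proof.
move=> e0; exists (Num.bound (64 / e ^+ 4)).+2 => n n0n.
have n2 : (2 <= n)%N by apply: leq_trans n0n.
have nR : (0 : R) < n%:R by rewrite ltr0n (leq_trans _ n2).
have ne : 64 / e ^+ 4 < n%:R.
  have /archi_boundP/lt_le_trans : 0 <= 64 / e ^+ 4 by rewrite divr_ge0// exprn_ge0// ltW.
  by apply; rewrite ler_nat; do 2 apply: ltnW.
have sn0 : (0 : R) < Num.sqrt n%:R by rewrite sqrtr_gt0.
have snn : Num.sqrt n%:R * Num.sqrt n%:R = n%:R :> R by rewrite -expr2 sqr_sqrtr// ltW.
have lnn : ln n%:R <= 2 * Num.sqrt n%:R :> R.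
  rewrite -{1}snn lnM ?posrE//; have := ln_sublinear sn0; lra.
have e4 : 64 < (e ^+ 2 * Num.sqrt n%:R) ^+ 2.
  rewrite exprMn (sqr_sqrtr (ltW nR)) -exprM.
  by move: ne; rewrite ltr_pdivrMr ?exprn_gt0// mulrC.
have e8 : 8 < e ^+ 2 * Num.sqrt n%:R.
  have : 0 < e ^+ 2 * Num.sqrt n%:R by rewrite mulr_gt0 ?exprn_gt0.
  move: e4; set u := e ^+ 2 * _; nra.
rewrite -(@ler_pXn2r _ 2)// ?nnegrE ?(ltW e0) ?(ltW (noise_level_gt0 n2))//.
rewrite noise_level_sqr// mulrA ler_pdivrMr//.
apply: (@le_trans _ _ (8 * Num.sqrt n%:R)); first by lra.
by rewrite -[in leRHS]snn mulrA ler_pM2r// ltW.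
Qed.

Lemma ln_nat_large (x : R) : exists n0, forall n, (n0 <= n)%N -> x <= ln n%:R.
Proof.
exists (Num.bound (expR x)).+1 => n n0n.
have nR : (0 : R) < n%:R by rewrite ltr0n (leq_trans _ n0n).
rewrite -[x]expRK ler_ln ?posrE ?expR_gt0//.
apply/ltW/(lt_le_trans (archi_boundP (expR_ge0 x))).
by rewrite ler_nat ltnW.
Qed.

Section Resolution.
Variables (s M : R).
Hypotheses (s_gt0 : 0 < s) (M_gt0 : 0 < M).
Let a := 1 / (2 * s + 1).

Let a_gt0 : 0 < a.
Proof. by rewrite divr_gt0// addr_gt0// mulr_gt0. Qed.

Let as2 : 2 * a * (s + 2^-1) = 1.
Proof. by rewrite /a; field; apply: lt0r_neq0; rewrite addr_gt0// mulr_gt0. Qed.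

Let a1s : 1 - a = 2 * (a * s).
Proof. by rewrite /a; field; apply: lt0r_neq0; rewrite addr_gt0// mulr_gt0. Qed.

(** The real scale X = (M / tau)^(2 a) solves M X^(-(s + 1/2)) = tau, and there tau X^(1/2) and M
    X^(-s) are both equal to tau (M / tau)^a. The level [j] is given by 2^j <= X < 2^(j + 1):
    rounding down preserves the first two inequalities and costs 2^s in the third. *)
Lemma optimal_resolution (m : nat) : exists n0, forall n, (n0 <= n)%N ->
  exists j, [/\ (m <= j <= trunc_log 2 n)%N,
    noise_level n <= envelope s M j,
    noise_level n * 2 `^ (j%:R / 2) <= 2 * M `^ a * rate n s &
    M * 2 `^ (- (j%:R * s)) <= 2 `^ s * (2 * M `^ a * rate n s)].
Proof.
have [n1 Hn1] := noise_level_small (envelope_gt0 s m M_gt0).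
(* M^2 / 4 <= ln n means (M / tau)^2 <= n, hence X <= n^a <= n and [j] does not exceed the finest
   level observed. *)
have [n2 Hn2] := ln_nat_large (M ^+ 2 / 4).
exists (maxn 3 (maxn n1 n2)) => n; rewrite !geq_max => /and3P[n3 /Hn1 taum /Hn2 Mn].
have n2' : (2 <= n)%N by apply: ltnW.
have nR : (0 : R) < n%:R by rewrite ltr0n (leq_trans _ n3).
have lnR : (0 : R) < ln n%:R by rewrite ln_gt0// ltr1n.
have tau0 := noise_level_gt0 n2'; set tau := noise_level n in taum tau0 *.
set X := (M / tau) `^ (2 * a).
have Mt : 0 < M / tau by exact: divr_gt0.
have X_gt0 : 0 < X by exact: powR_gt0.
have XS : X `^ (s + 2^-1) = M / tau by rewrite /X -powRrM as2 powRr1// ltW.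
have tauM : M = tau * (M / tau) by rewrite mulrC divfK// gt_eqF.
have Xm : 2 ^+ m <= X.
  have -> : 2 ^+ m = (2 `^ (m%:R * (s + 2^-1))) `^ (2 * a) :> R.
    by rewrite -powRrM -mulrA [_ * (2 * a)]mulrC as2 mulr1 pow2_natr.
  rewrite /X ge0_ler_powR ?nnegrE ?pow2_ge0 ?(ltW Mt)//; first by rewrite mulr_ge0// ltW.
  rewrite ler_pdivlMr// -ler_pdivlMl ?pow2_gt0//.
  by move: taum; rewrite /envelope powRN mulrC.
have s21 : 0 < 2 * s + 1 by rewrite addr_gt0// mulr_gt0.
have a1 : a <= 1.
  rewrite /a ler_pdivrMr// mul1r lerDr.
  by rewrite mulr_ge0// ltW.
have Xn : X <= n%:R.
  have -> : X = ((M / tau) ^+ 2) `^ a.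
    by rewrite /X powRrM powR_mulrn// ltW.
  apply: (@le_trans _ _ (n%:R `^ a)).
    rewrite ge0_ler_powR ?nnegrE ?(ltW a_gt0) ?exprn_ge0 ?(ltW Mt)//.
    rewrite exprMn exprVn /tau noise_level_sqr// invfM invf_div.
    rewrite mulrA mulrA ler_pdivrMr// mulrC ler_pM2l//.
  rewrite -[leRHS]powRr1 ?(ltW nR)//.
  by apply: ler_powR => //; rewrite ler1n (leq_trans _ n3).
have X1 : 1 <= X by apply: le_trans Xm; rewrite exprn_ege1// ler1n.
have /andP[tX Xt] := truncn_itv (ltW X_gt0).
pose j := trunc_log 2 (Num.truncn X).
have t0 : (0 < Num.truncn X)%N by rewrite truncn_gt0.
have /andP[jt tj] := trunc_log_bounds (isT : (1 < 2)%N) t0.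
have jX : 2 ^+ j <= X by apply: le_trans tX; rewrite -natrX ler_nat.
have Xj : X < 2 * 2 ^+ j.
  by apply: (lt_le_trans Xt); rewrite -exprS -natrX ler_nat.
have G : tau * (M / tau) `^ a <= 2 * M `^ a * rate n s.
  have -> : tau * (M / tau) `^ a = M `^ a * (tau ^+ 2) `^ (a * s).
    rewrite powRM ?(ltW M_gt0) ?invr_ge0 ?(ltW tau0)// mulrCA; congr (_ * _).
    rewrite -powR_inv1 ?(ltW tau0)// -powRrM mulN1r.
    rewrite -{1}[tau]powRr1 ?(ltW tau0)// -powRD; last by rewrite (gt_eqF tau0) implybT.
    by rewrite a1s powRrM powR_mulrn// ltW.
  rewrite -[leRHS]mulrA [leRHS]mulrCA ler_pM2l ?powR_gt0//.
  rewrite noise_level_sqr// powRM ?divr_ge0 ?(ltW lnR) ?(ltW nR)//.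
  have -> : (ln n%:R / n%:R) `^ (a * s) = rate n s.
    rewrite /rate -invf_div -[X in X `^ _ = _]powR_inv1 ?divr_ge0 ?ltW// -powRrM.
    by congr (_ `^ _); rewrite /a; ring.
  rewrite ler_pM2r ?powR_gt0 ?divr_gt0//.
  (* 4^(a s) = 2^(1 - a) <= 2, which is the factor 2 in the statement. *)
  rewrite (_ : 4 = 2 `^ 2); last by rewrite (pow2_natr 2); ring.
  rewrite -powRrM -[leRHS](powRr1 (ler0n _ _)) ler_pow2 -a1s.
  by rewrite gerBl ltW.
have jmono : (m <= j)%N.
  by apply: trunc_log_max => //; rewrite truncn_ge_nat ?natrX// ltW.
exists j; split.
- rewrite jmono /=; apply: trunc_log_max => //; rewrite -(ler_nat R) natrX.
  exact: le_trans jX Xn.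
- rewrite /envelope powRN powRrM pow2_natr.
  rewrite ler_pdivlMr ?powR_gt0 ?exprn_gt0// mulrC -ler_pdivlMr//.
  rewrite -XS ge0_ler_powR ?nnegrE ?exprn_ge0 ?(ltW X_gt0)//.
  by rewrite addr_ge0// ltW.
- apply: le_trans G; rewrite ler_pM2l//.
  rewrite powRrM pow2_natr -[leRHS](_ : X `^ 2^-1 = _); last first.
    by rewrite /X -powRrM mulrAC mulfV// mul1r.
  by rewrite ge0_ler_powR ?nnegrE ?exprn_ge0 ?(ltW X_gt0)//.
- rewrite powRN powRrM pow2_natr.
  apply: (@le_trans _ _ (2 `^ s * (tau * (M / tau) `^ a))); last by rewrite ler_pM2l ?pow2_gt0.
  have -> : tau * (M / tau) `^ a = M / X `^ s.
    rewrite /X -powRrM.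
    have -> : 2 * a * s = 1 - a by rewrite a1s mulrA.
    rewrite powRB; last by rewrite (gt_eqF Mt) implybT.
    rewrite powRr1 ?(ltW Mt)// invf_div mulrCA [LHS]mulrC; congr (_ * _).
    rewrite invf_div mulrCA divff ?mulr1 ?gt_eqF//.
  rewrite mulrCA ler_pM2l// ler_pdivlMr ?powR_gt0// mulrC.
  rewrite ler_pdivrMr ?powR_gt0 ?exprn_gt0// -powRM ?exprn_ge0//.
  rewrite ge0_ler_powR ?nnegrE ?(ltW s_gt0) ?(ltW X_gt0) ?(ltW Xj)//.
Qed.

End Resolution.

(** At the optimal resolution the noise level is below the envelope; this turns it into a small
    fraction of the envelope at the fixed level [p]. *)
Lemma envelope_le_frac (s M e : R) (p : nat) : 0 < s -> 0 < M -> 0 < e ->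
  exists m, forall j, (m <= j)%N -> envelope s M j <= e * envelope s M p.
Proof.
move=> s0 M0 e0; exists (p + (Num.bound (e^-1)).*2)%N => j mj.
set q := Num.bound (e^-1).
apply: le_trans (envelope_anti M0 s0 mj) _.
rewrite /envelope natrD mulrDl opprD pow2D mulrA [leRHS]mulrC.
rewrite ler_pM2l ?mulr_gt0 ?pow2_gt0//.
rewrite powRN invf_ple ?posrE ?pow2_gt0//.
apply: (@le_trans _ _ q%:R); first by apply/ltW/archi_boundP; rewrite invr_ge0 ltW.
apply: (@le_trans _ _ (2 `^ q%:R)).
  by rewrite pow2_natr -natrX ler_nat ltnW// ltn_expl.
rewrite ler_pow2 -muln2 natrM -mulrA ler_peMr//.
by rewrite mulrDr divff// lerDr mulr_ge0// ltW.
Qed.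

Lemma pow2_linear_large (Q x : R) (p rho : nat) : 0 < x -> (0 < rho)%N ->
  exists m, forall j, (m <= j)%N -> Q < 2 `^ ((j %/ rho - p)%:R * x).
Proof.
move=> x0 r0; pose q := Num.bound (`|Q|); pose q' := Num.bound (q%:R / x).
exists (rho * (p + q'))%N => j mj.
have qj : (q' <= j %/ rho - p)%N.
  have qp : (p + q' <= j %/ rho)%N by rewrite leq_divRL// mulnC.
  by rewrite leq_subRL// (leq_trans (leq_addr _ _) qp).
apply: (le_lt_trans (ler_norm Q)); apply: (lt_le_trans (archi_boundP (normr_ge0 Q))).
rewrite -/q; apply: (@le_trans _ _ (2 `^ q%:R)).
  by rewrite pow2_natr -natrX ler_nat ltnW// ltn_expl.
rewrite ler_pow2 -ler_pdivrMr//; apply: (@le_trans _ _ q'%:R).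
  by apply/ltW/archi_boundP; rewrite divr_ge0// ltW.
by rewrite ler_nat.
Qed.

Section Adaptation.
Variables (cnt : nat -> nat) (smax eps eps' D : R) (rho j0 : nat).
Hypotheses (eps01 : 0 < eps < 1) (eps'01 : 0 < eps' < 1) (rho_gt0 : (0 < rho)%N).
Hypothesis D_gt0 : 0 < D.

Let C0 : R := 3 / eps' * (12 / (eps * eps')) ^+ (2 * rho).

Let C0_gt0 : 0 < C0.
Proof.
case/andP: eps01 => e0 _; case/andP: eps'01 => e'0 _.
by rewrite mulr_gt0 ?divr_gt0// exprn_gt0// divr_gt0// mulr_gt0.
Qed.

(** Free of s and M. The first term bounds the noise, 12 times the 2 of [optimal_resolution], with 1
    <= 2^smax / (2^s - 1). In the second, C0 compares M' 2^(-j s') with M 2^(-j s), 2^smax is the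
    rounding of the resolution, and 2^smax + 1 replaces 1 / (2^s' - 1) by 1 / (2^s - 1). *)
Definition rate_constant : R :=
  24 * D * 2 `^ smax + 2 * D * C0 * 2 `^ smax * (2 `^ smax + 1).

Lemma rate_constant_gt0 : 0 < rate_constant.
Proof.
have p0 := pow2_gt0 smax.
by apply: addr_gt0; repeat (apply: mulr_gt0 => //); exact: addr_gt0.
Qed.

Lemma error_bound_consistent (s M : R) : 0 < s <= smax -> 0 < M ->
  exists n0, forall n, (n0 <= n)%N -> forall c a : nat -> nat -> R,
  (forall l k, (k < cnt l)%N -> `|c l k| <= envelope s M l) ->
  large_coefficient cnt c 0 (eps / 2) s M 0 (rho * j0) ->
  (forall l k, (l <= trunc_log 2 n)%N -> (k < cnt l)%N ->
    `|a l k - c l k| <= noise_level n) ->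
  forall s' M', 0 < s' -> 0 < M' ->
  consistent cnt smax rho j0 a (noise_level n) eps' (trunc_log 2 n) s' M' ->
  exists2 j, (j <= trunc_log 2 n)%N &
    error_bound D (noise_level n) s' M' j <=
    rate_constant * M `^ (1 / (2 * s + 1)) / (2 `^ s - 1) * rate n s.
Proof.
move=> /andP[s0 ss] M0.
have e80 : 0 < eps / 8 by case/andP: eps01 => e0 _; exact: divr_gt0.
have [m1 H1] := envelope_le_frac (rho * j0) s0 M0 e80.
have s20 : 0 < s / 2 by exact: divr_gt0.
have [m2 H2] := pow2_linear_large (12 / (eps * eps')) (rho * j0) s20 rho_gt0.
(* The optimal resolution grows without bound with n, so it eventually passes the three levels that
   the comparison requires. *)
have [n0 H0] := optimal_resolution s0 M0
  (maxn (rho * (1 + 2 * rho * j0)) (maxn m1 m2)).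
exists n0 => n /H0[j [/andP[mj jJ] tauj varj biasj]] c a cle clarge near s' M' s'0 M'0 cons.
move: mj; rewrite !geq_max => /and3P[mj /H1 mj1 /H2 mj2].
have [s2s' main] := consistent_compare s0 ss M0 eps01 rho_gt0 cle clarge near
  M'0 eps'01 cons jJ tauj (le_trans tauj mj1) mj mj2.
exists j => //; rewrite /error_bound.
set G := 2 * M `^ _ * rate n s in varj biasj.
have G0 : 0 <= G by rewrite !mulr_ge0 ?powR_ge0.
have s1 : 0 < 2 `^ s - 1 by rewrite subr_gt0 pow2_gt1.
have s'1 : 0 < 2 `^ s' - 1 by rewrite subr_gt0 pow2_gt1.
have ssm : 2 `^ s <= 2 `^ smax by rewrite ler_pow2.
have sE : 2 `^ s = 2 `^ (s / 2) * 2 `^ (s / 2) by rewrite -pow2D -splitr.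
have s2m : 2 `^ (s / 2) <= 2 `^ smax.
  by rewrite ler_pow2 (le_trans _ ss)// ler_pdivrMr// ler_peMr// ?ler1n ?ltW.
(* With u = 2^(s / 2), 2^s - 1 = (u + 1) (u - 1), where u - 1 <= 2^s' - 1 because s' >= s / 2, and u
   + 1 <= 2^smax + 1. *)
have inv_s' : (2 `^ s' - 1)^-1 <= (2 `^ smax + 1) / (2 `^ s - 1).
  rewrite -[leLHS]mul1r ler_pdivrMr// mulrAC ler_pdivlMr// mul1r.
  have : 2 `^ (s / 2) <= 2 `^ s' by rewrite ler_pow2.
  have : 1 < 2 `^ (s / 2) by exact: pow2_gt1.
  rewrite sE; move: s2m s'1; set u := 2 `^ (s / 2); set v := 2 `^ smax; set w := 2 `^ s'.
  move=> *; apply: (@le_trans _ _ ((u + 1) * (u - 1))); first by lra.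
  by apply: ler_pM; lra.
have -> : rate_constant * M `^ (1 / (2 * s + 1)) / (2 `^ s - 1) * rate n s =
    12 * D * G * (2 `^ smax / (2 `^ s - 1)) +
    D * (C0 * (2 `^ smax * G)) * ((2 `^ smax + 1) / (2 `^ s - 1)).
  by rewrite /rate_constant /G; ring.
apply: lerD.
  rewrite -mulrA; apply: (@le_trans _ _ (12 * D * G)).
    by rewrite ler_pM2l// mulr_gt0.
  apply: ler_peMr; first by rewrite mulr_ge0// mulr_ge0// ltW.
  by rewrite ler_pdivlMr// mul1r lerBlDr (le_trans ssm)// lerDl.
apply: ler_pM => //.
- by rewrite !mulr_ge0 ?pow2_ge0 ?(ltW D_gt0) ?(ltW M'0).
- by rewrite invr_ge0 ltW.
rewrite ler_pM2l//; apply: le_trans main _; rewrite -/C0 ler_pM2l//.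
apply: le_trans biasj _; exact: ler_wpM2r.
Qed.

End Adaptation.
End Asymptotics.

(** * Riemann sums and the Wiener integral *)

Section RiemannSums.
Context {R : realType}.
Local Notation mu := (@lebesgue_measure R).
Implicit Types (a b f g : R -> R).

Lemma compact_uniform_continuity (A : set R) a : compact A ->
  {within A, continuous a} -> forall e : R, 0 < e ->
  exists2 r : R, 0 < r & forall x y, A x -> A y -> `|x - y| < r -> `|a x - a y| < e.
Proof.
move=> /compact_near_coveringP cA ca e e0.
pose P (r x : R) := A x -> forall y, A y -> `|x - y| < r -> `|a x - a y| < e.
have : \forall r \near 0^'+, A `<=` P r.
  apply: cA => x Ax.
  have /cvgrPdist_lt/(_ (e / 2)) := (subspace_continuousP _ _).1 ca x Ax.
  rewrite divr_gt0// => /(_ isT); rewrite near_withinE near_simpl => /nbhs_ballP[r /= r0 xr].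
  exists (ball x (r / 2), [set d | d < r / 2]) => /=.
    split; first by apply: nbhsx_ballx; rewrite divr_gt0.
    by apply: nbhs_right_lt; rewrite divr_gt0.
  move=> [y d] /= [xy dr] Ay z Az yz.
  have := xr y (le_ball _ xy) Ay; rewrite ler_pdivrMr// ler_peMr ?ler1n ?(ltW r0)// => /(_ isT) H1.
  have /(xr z)/(_ Az) H2 : ball x r z.
    rewrite /ball/= (le_lt_trans (ler_distD y _ _))// [ltRHS](splitr r) ltrD//.
    exact: lt_trans dr.
  rewrite (le_lt_trans (ler_distD (a x) _ _))// [ltRHS](splitr e) ltrD// distrC//.
move=> Ar; near (0 : R)^'+ => r; exists r => //.
by move=> x y Ax Ay xy; exact: (near Ar r _ x).
Unshelve. all: by end_near. Qed.

Definition grid (m i : nat) : R := i%:R / m.+1%:R.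

(** A Riemann-Stieltjes sum against the increments of [b]; the weights form an array so that both
    left and right tags are covered. *)
Definition riemann_sum (a : nat -> nat -> R) (b : R -> R) (m : nat) : R :=
  \sum_(i < m.+1) a m i * (b (grid m i.+1) - b (grid m i)).

Lemma grid0 m : grid m 0 = 0. Proof. by rewrite /grid mul0r. Qed.

Lemma grid1 m : grid m m.+1 = 1. Proof. by rewrite /grid divff. Qed.

Lemma grid_lt m i : grid m i < grid m i.+1.
Proof. by rewrite ltr_pM2r ?ltr_nat// invr_gt0. Qed.

Lemma grid_le m i j : (i <= j)%N -> grid m i <= grid m j.
Proof. by move=> ij; rewrite ler_pM2r ?ler_nat// invr_gt0. Qed.

Lemma grid_ge0 m i : 0 <= grid m i. Proof. by rewrite divr_ge0. Qed.

Lemma grid_le1 m i : (i <= m.+1)%N -> grid m i <= 1.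
Proof. by rewrite -(grid1 m); exact: grid_le. Qed.

Lemma unitI_grid m i : (i <= m.+1)%N -> unitI (grid m i).
Proof. by move=> im; rewrite /unitI/= in_itv/= grid_ge0 grid_le1. Qed.

Lemma gridS m i : grid m i.+1 - grid m i = m.+1%:R^-1.
Proof. by rewrite /grid -mulrBl -natrB ?leqnSn// subSnn mul1r. Qed.

Definition tagging (xi : nat -> nat -> R) :=
  forall m i, (i <= m)%N -> grid m i <= xi m i <= grid m i.+1.

Lemma continuous_unitI_bounded a : {within unitI, continuous a} ->
  exists2 C : R, 0 < C & forall x, unitI x -> `|a x| <= C.
Proof.
move=> ca; have /compact_bounded[C [_ aC]] := continuous_compact ca (@segment_compact R 0 1).
exists (`|C| + 1) => [|x ux]; first by rewrite ltr_wpDl.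
by apply: aC; [rewrite ltr_pwDr// ler_norm|exists x].
Qed.

Lemma measurable_unitI : measurable (unitI : set (measurableTypeR R)).
Proof. exact: measurable_itv. Qed.

Lemma continuous_unitI_measurable a : {within unitI, continuous a} ->
  measurable_fun (unitI : set (measurableTypeR R)) a.
Proof. by apply: subspace_continuous_measurable_fun; exact: measurable_itv. Qed.

Lemma integrable_continuousM a f : {within unitI, continuous a} ->
  mu.-integrable unitI (fun x => (f x)%:E) ->
  mu.-integrable unitI (fun x => (a x * f x)%:E).
Proof.
move=> ca intf; have [C C0 aC] := continuous_unitI_bounded ca.
have bd : [bounded a x | x in unitI].
  exists C; split; first by rewrite gtr0_real.
  by move=> D CD x ux /=; exact: le_trans (aC x ux) (ltW CD).
exact: (integrableMr measurable_unitI (continuous_unitI_measurable ca) bd intf).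
Qed.

(** On each cell [a] differs from its tagged value by less than [eta], so the error there is at most
    [eta] times the integral of |f| over the cell. Summing over cells leaves [eta] times the total
    integral of |f|. *)
Lemma riemann_sum_cvg a f xi : {within unitI, continuous a} ->
  mu.-integrable unitI (fun x => (f x)%:E) -> tagging xi ->
  riemann_sum (fun m i => a (xi m i)) (fun t => \int[mu]_(u in `[0, t]) f u) @ \oo
    --> \int[mu]_(u in unitI) (a u * f u).
Proof.
move=> ca intf txi; apply/cvgrPdist_le => e e0.
have intaf := integrable_continuousM ca intf.
have intnf : mu.-integrable unitI (fun x => `|f x|%:E) by exact: integrable_norm.
have I0 : 0 <= \int[mu]_(u in unitI) `|f u| by exact: Rintegral_ge0.
set I1 := \int[mu]_(u in unitI) `|f u| in I0.
pose eta := e / (I1 + 1).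
have eta0 : 0 < eta by rewrite divr_gt0// ltr_wpDl.
have [r r0 ar] := compact_uniform_continuity (@segment_compact R 0 1) ca eta0.
exists (Num.bound r^-1) => // m /= rm.
have mr : m.+1%:R^-1 < r.
  rewrite invf_plt ?posrE//; apply: (lt_le_trans (archi_boundP _)).
    by rewrite invr_ge0 ltW.
  by rewrite ler_nat leqW.
have sub01 i : (i <= m.+1)%N -> `[0, grid m i] `<=` (unitI : set R).
  move=> im x; rewrite /unitI/= !in_itv/= => /andP[-> /le_trans]; apply.
  exact: grid_le1.
have piece (h : R -> R) i : (i < m.+1)%N -> mu.-integrable unitI (fun x => (h x)%:E) ->
    \int[mu]_(u in `[0, grid m i.+1]) h u =
    \int[mu]_(u in `[0, grid m i]) h u + \int[mu]_(u in `]grid m i, grid m i.+1]) h u.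
  move=> im inth; rewrite -(@Rintegral_itvB _ h (BLeft 0) (BRight (grid m i.+1)) (grid m i)).
  - by rewrite addrC subrK.
  - by apply: integrableS inth => //; [exact: measurable_unitI|exact: sub01].
  - by rewrite bnd_simp grid_ge0.
  - by rewrite bnd_simp grid_le.
pose F t := \int[mu]_(u in `[0, t]) f u.
have claim i : (i <= m.+1)%N ->
    `|\int[mu]_(u in `[0, grid m i]) (a u * f u) -
      \sum_(0 <= j < i) a (xi m j) * (F (grid m j.+1) - F (grid m j))| <=
    eta * \int[mu]_(u in `[0, grid m i]) `|f u|.
  elim: i => [_|i IHi im].
    by rewrite grid0 big_geq// set_itv1 !Rintegral_set1 subr0 normr0 mulr0.
  have Jsub : `]grid m i, grid m i.+1] `<=` (unitI : set R).
    move=> x; rewrite /unitI/= !in_itv/= => /andP[/ltW ix xi1].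
    by rewrite (le_trans (grid_ge0 m i) ix) (le_trans xi1 (grid_le1 im)).
  have intJ (h : R -> R) : mu.-integrable unitI (fun x => (h x)%:E) ->
      mu.-integrable `]grid m i, grid m i.+1] (fun x => (h x)%:E).
    by apply: integrableS => //; exact: measurable_unitI.
  rewrite big_nat_recr//= !piece// [in leRHS]mulrDr.
  have -> : F (grid m i.+1) - F (grid m i) =
      \int[mu]_(u in `]grid m i, grid m i.+1]) f u.
    by rewrite /F piece// addrAC subrr add0r.
  rewrite opprD addrACA; apply: (le_trans (ler_normD _ _)); apply: lerD.
    by apply: IHi; exact: ltnW.
  rewrite -RintegralZl//; last exact: intJ.
  rewrite -RintegralB//; last 2 first.
  - exact: intJ.
  - exact: integrableZl (intJ _ intf).
  apply: (le_trans (le_normr_Rintegral _ _)) => //.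
    exact: integrableB (intJ _ intaf) (integrableZl _ _ (intJ _ intf)).
  rewrite -RintegralZl//; last exact: intJ.
  apply: le_Rintegral => //.
  - apply: integrable_norm => //.
    exact: integrableB (intJ _ intaf) (integrableZl _ _ (intJ _ intf)).
  - exact: integrableZl (intJ _ intnf).
  move=> x xJ; rewrite -mulrBl normrM ler_wpM2r//.
  have /andP[xi0 xi1] := txi m i im.
  move: (xJ); rewrite /= in_itv/= => /andP[/ltW x0 x1].
  apply/ltW/ar; first exact: Jsub.
    by rewrite /unitI/= in_itv/= (le_trans (grid_ge0 m i) xi0) (le_trans xi1 (grid_le1 im)).
  apply: le_lt_trans mr; rewrite -(gridS m i) ler_norml opprB.
  by apply/andP; split; apply: lerD => //; rewrite lerN2.
have := claim m.+1 (leqnn _); rewrite grid1 big_mkord => /le_trans; apply.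
by rewrite /eta mulrAC ler_pdivrMr ?ltr_wpDl// ler_pM2l// -/I1 lerDl.
Qed.

End RiemannSums.

Section WienerIntegral.
Context {R : realType}.
Local Notation mu := (@lebesgue_measure R).
Implicit Types (a b f g : R -> R).

Definition continuously_differentiable g :=
  (forall x, derivable g x 1) /\ continuous (derive1 g).

Lemma C1_continuous g : continuously_differentiable g -> continuous g.
Proof.
by move=> [dg _] x; apply/differentiable_continuous/derivable1_diffP.
Qed.

Lemma continuous_within g : continuous g -> {within unitI, continuous g}.
Proof. exact: continuous_subspaceT. Qed.

Lemma integral_derive1 g t : continuously_differentiable g -> 0 <= t ->
  \int[mu]_(u in `[0, t]) derive1 g u = g t - g 0.
Proof.
move=> gC1; rewrite le_eqVlt => /predU1P[<-|t0].
  by rewrite set_itv1 Rintegral_set1 subrr.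
have gc := C1_continuous gC1; have [dg dgc] := gC1.
rewrite /Rintegral (@continuous_FTC2 _ _ g)//.
- exact: continuous_subspaceT.
- by split => //; [exact/cvg_at_right_filter/gc|exact/cvg_at_left_filter/gc].
Qed.

Definition left_sum g b : nat -> R := riemann_sum (fun m i => g (grid m i)) b.

Lemma left_tagging : tagging (@grid R).
Proof. by move=> m i _; rewrite lexx grid_le. Qed.

Lemma right_tagging : tagging (fun m i => @grid R m i.+1).
Proof. by move=> m i _; rewrite lexx grid_le. Qed.

Lemma left_sum_affine g b b' (c : R) m :
  left_sum g (fun t => b t + c * b' t) m = left_sum g b m + c * left_sum g b' m.
Proof.
rewrite /left_sum /riemann_sum mulr_sumr -big_split/=; apply: eq_bigr => i _; ring.
Qed.

Lemma summation_by_parts g b m : left_sum g b m =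
  g 1 * b 1 - g 0 * b 0 - riemann_sum (fun m i => b (grid m i.+1)) g m.
Proof.
rewrite -(grid1 m) -(grid0 m); apply/eqP; rewrite -subr_eq opprK; apply/eqP.
rewrite /left_sum /riemann_sum -big_split/=.
rewrite -(telescope_sumr (fun i => g (grid m i) * b (grid m i)) (leq0n m.+1)).
rewrite big_mkord; apply: eq_bigr => i _; ring.
Qed.

(** Brownian paths have unbounded variation, so the increments are moved from [b] to [g] by
    summation by parts. Those of [g] are integrals of its derivative, and the sums converge to an
    ordinary integral of [b] times that derivative. *)
Lemma left_sum_cvg g b : continuously_differentiable g ->
  {within unitI, continuous b} -> cvgn (left_sum g b).
Proof.
move=> gC1 bc; rewrite (_ : left_sum g b = fun m => g 1 * b 1 - g 0 * b 0
    - riemann_sum (fun m i => b (grid m i.+1))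
        (fun t => \int[mu]_(u in `[0, t]) derive1 g u) m); last first.
  apply/funext => m; rewrite summation_by_parts; congr (_ - _).
  rewrite /riemann_sum; apply: eq_bigr => i _; congr (_ * _).
  by rewrite !integral_derive1 ?grid_ge0//; ring.
apply: is_cvgB; first exact: is_cvg_cst.
apply/cvg_ex; exists (\int[mu]_(u in unitI) (b u * derive1 g u)).
apply: (riemann_sum_cvg bc _ right_tagging).
apply: continuous_compact_integrable; first exact: segment_compact.
exact/continuous_subspaceT/gC1.2.
Qed.

(* The limit superior is defined, and measurable, for all paths; for a continuous
   path and a continuously differentiable g it is a limit. *)
Definition wiener_integral g (y : R -> R) : R :=
  fine (limn_esup (fun m => (left_sum g y m)%:E)).

Lemma wiener_integral_lim g y z : left_sum g y @ \oo --> z -> wiener_integral g y = z.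
Proof.
move=> yz; have ez : (left_sum g y m)%:E @[m --> \oo] --> z%:E.
  by apply: cvg_EFin => //; apply: nearW.
rewrite /wiener_integral is_cvg_limn_esupE; last exact: cvgP ez.
by rewrite (cvg_lim _ ez).
Qed.

(** Left sums are linear in the path; against the primitive of [f] they are Riemann sums with limit
    the inner product of [f] and [g]. *)
Lemma wiener_integral_signal g f b c : continuously_differentiable g ->
  mu.-integrable unitI (fun x => (f x)%:E) -> {within unitI, continuous b} ->
  wiener_integral g (fun t => \int[mu]_(u in `[0, t]) f u + c * b t) =
  inner unitI f g + c * wiener_integral g b.
Proof.
move=> gC1 intf bc.
have /cvg_ex[z bz] := left_sum_cvg gC1 bc.
rewrite (wiener_integral_lim bz); apply: wiener_integral_lim.
have -> : left_sum g (fun t => \int[mu]_(u in `[0, t]) f u + c * b t) =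
    fun m => left_sum g (fun t => \int[mu]_(u in `[0, t]) f u) m + c * left_sum g b m.
  by apply/funext => m; exact: left_sum_affine.
apply: cvgD; last exact: cvgMr.
have -> : inner unitI f g = \int[mu]_(u in unitI) (g u * f u).
  by apply: eq_Rintegral => u _; rewrite mulrC.
apply: riemann_sum_cvg => //; last exact: left_tagging.
exact/continuous_within/C1_continuous.
Qed.

(** The left-hand side is the variance of the left sums against Brownian motion. It is a Riemann sum
    of the square of [g] against the primitive of the constant 1. *)
Lemma left_sum_sqr_cvg g : continuous g ->
  (fun m => \sum_(i < m.+1) g (grid m i) ^+ 2 / m.+1%:R) @ \oo --> inner unitI g g.
Proof.
move=> gc.
have g2 : {within unitI, continuous (fun x => g x ^+ 2)}.
  rewrite (_ : (fun x => _) = fun x => g x * g x).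
    by apply: continuous_within => x; apply: cvgM; exact: gc.
  by apply/funext => x; rewrite expr2.
have -> : inner unitI g g = \int[mu]_(u in unitI) (g u ^+ 2 * (cst 1 u)).
  by apply: eq_Rintegral => u _; rewrite mulr1 expr2.
rewrite (_ : (fun m => _) = riemann_sum (fun m i => g (grid m i) ^+ 2)
    (fun t => \int[mu]_(u in `[0, t]) (cst 1 u))); last first.
  apply/funext => m; rewrite /riemann_sum; apply: eq_bigr => i _; congr (_ * _).
  have len t : 0 <= t -> fine (mu `[0, t]) = t.
    rewrite lebesgue_measure_itv/= lte_fin le_eqVlt => /predU1P[<-|t0].
      by rewrite ltxx.
    by rewrite t0 oppr0 adde0.
  by rewrite !Rintegral_cst ?mul1r//= !len ?grid_ge0// gridS.
apply: riemann_sum_cvg => //; last exact: left_tagging.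
apply: continuous_compact_integrable; first exact: segment_compact.
by apply: continuous_subspaceT => x; exact: cvg_cst.
Qed.

Lemma measurable_evaluation t : unitI t ->
  measurable_fun [set: data_path R] (fun y : data_path R => y t).
Proof.
move=> tI _ A mA; rewrite setTI; apply: sub_sigma_algebra.
by exists t, A; split.
Qed.

Lemma measurable_wiener_integral g :
  measurable_fun [set: data_path R] (wiener_integral g).
Proof.
apply: measurableT_comp => //; apply: measurable_fun_limn_esup => m.
apply/measurable_EFinP; apply: measurable_sum => i.
apply: measurable_funM => //; apply: measurable_funB.
  by apply: measurable_evaluation; exact: unitI_grid.
by apply: measurable_evaluation; apply: unitI_grid; rewrite ltnW// ltnS.
Qed.

Lemma measurable_into_paths d (T : measurableType d) (X : T -> data_path R) :
  (forall t, unitI t -> measurable_fun [set: T] (fun w => X w t)) ->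
  measurable_fun [set: T] X.
Proof.
move=> mX; apply: (@measurability _ _ T (data_path R) setT X (@cylinders R)) => //.
move=> C [A [t [D [tI mD ->]]] <-].
by rewrite setTI; have := mX t tI measurableT D mD; rewrite setTI.
Qed.

End WienerIntegral.

(** * Gaussian tails of the Wiener integral *)

Section WeightedPushforward.
Local Open Scope ereal_scope.
Context d d' (X : measurableType d) (Y : measurableType d') (R : realType).
Variables (mu : {measure set X -> \bar R}) (nu : {measure set Y -> \bar R}).
Variables (p : X -> Y) (Z : X -> R).
Hypotheses (mp : measurable_fun setT p) (mZ : measurable_fun setT Z).
Hypothesis Z0 : forall x, (0 <= Z x)%R.
Hypothesis ZE : forall A, measurable A ->
  \int[mu]_x (Z x * \1_A (p x))%:E = nu A.

Import HBNNSimple.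

(** From indicators to simple functions by linearity, then by monotone convergence. It is used with
    a density as the weight, and with a product of independent factors as the weight. *)
Lemma ge0_integral_weighted_pushforward (h : Y -> \bar R) :
  measurable_fun setT h -> (forall y, 0 <= h y) ->
  \int[mu]_x ((Z x)%:E * h (p x)) = \int[nu]_y h y.
Proof.
move=> mh h0; pose h_ := nnsfun_approx measurableT mh.
have mhp n : measurable_fun setT (fun x => h_ n (p x)).
  exact: (measurableT_comp (measurable_funP (h_ n)) mp).
transitivity (limn (fun n => \int[mu]_x ((Z x)%:E * (h_ n (p x))%:E))).
  rewrite -monotone_convergence//.
  - apply: eq_integral => x _; apply/esym/cvg_lim => //.
    by apply: cvgeZl => //; exact: cvg_nnsfun_approx.
  - by move=> n; apply: emeasurable_funM; exact/measurable_EFinP.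
  - by move=> n x _; rewrite mule_ge0// lee_fin.
  - move=> x _ a b ab; rewrite lee_wpmul2l ?lee_fin//.
    by exact/lefP/nd_nnsfun_approx.
transitivity (limn (fun n => \int[nu]_y (h_ n y)%:E)); last first.
  rewrite -monotone_convergence//.
  - by apply: eq_integral => y _; apply/cvg_lim => //; exact: cvg_nnsfun_approx.
  - by move=> n; exact/measurable_EFinP/measurable_funP.
  - by move=> n y _; rewrite lee_fin.
  - by move=> y _ a b ab; rewrite lee_fin; exact/lefP/nd_nnsfun_approx.
congr (limn _); apply/funext => n.
have mA r : measurable (h_ n @^-1` [set r]) by [].
transitivity (\sum_(r \in range (h_ n))
    \int[mu]_x (r%:E * (Z x * \1_(h_ n @^-1` [set r]) (p x))%:E)).
  rewrite -ge0_integral_fsum//.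
  - apply: eq_integral => x _; rewrite fsumEFin// -EFinM; congr EFin.
    rewrite [in LHS](fimfunE (h_ n) (p x)) mulr_fsumr.
    by apply: eq_fsbigr => r _; rewrite mulrCA.
  - move=> r; apply/measurable_EFinP; apply: measurable_funM => //.
    apply: measurable_funM => //.
    exact: (measurableT_comp (measurable_indic _) mp).
  - move=> r x _; rewrite -EFinM lee_fin.
    rewrite mulrCA mulr_ge0//; have := nnfun_muleindic_ge0 (h_ n) r (p x).
    by rewrite -EFinM lee_fin.
transitivity (\sum_(r \in range (h_ n)) (r%:E * nu (h_ n @^-1` [set r]))).
  apply: eq_fsbigr => r; rewrite inE => -[y _ <-].
  rewrite ge0_integralZl ?lee_fin// ?ZE//.
  - apply/measurable_EFinP; apply: measurable_funM => //.
    exact: (measurableT_comp (measurable_indic _) mp).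
  - by move=> x _; rewrite lee_fin mulr_ge0.
transitivity (\int[nu]_y (\sum_(r \in range (h_ n)) (r * \1_(h_ n @^-1` [set r]) y)%:E)).
  rewrite ge0_integral_fsum//.
  - apply: eq_fsbigr => r _; rewrite -[in LHS](setIT (_ @^-1` _)) -integral_indic//.
    by rewrite integralZl_indic_nnsfun.
  - by move=> r; apply/measurable_EFinP; apply: measurable_funM.
  - by move=> r y _; exact: nnfun_muleindic_ge0.
by apply: eq_integral => y _; rewrite fsumEFin// -fimfunE.
Qed.

End WeightedPushforward.

(** * Expectation of a product of independent factors *)

Section IndependentProduct.
Local Open Scope ereal_scope.
Context d (T : measurableType d) (R : realType) (P : probability T R).
Variables (m : nat) (X : nat -> {RV P >-> R}).
Hypothesis X_indep : forall A : nat -> set R,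
  (forall i, (i < m)%N -> measurable (A i)) ->
  P (\bigcap_(i in [set i | (i < m)%N]) (X i @^-1` A i)) =
  \prod_(i < m) P (X i @^-1` A i).

(* One factor at a time, an indicator function is replaced with a general
   nonnegative function. *)
Lemma integral_prod_independent (h : nat -> R -> R) (e : nat -> R) :
  (forall i, measurable_fun setT (h i)) -> (forall i x, 0 <= h i x)%R ->
  (forall i, \int[P]_w (h i (X i w))%:E = (e i)%:E) ->
  \int[P]_w (\prod_(i < m) h i (X i w))%:E = (\prod_(i < m) e i)%:E.
Proof.
move=> mh h0 he.
have indE E : measurable E -> \int[P]_w (\1_E w)%:E = P E.
  by move=> mE; rewrite integral_indic// setIT.
(* The factors of index at least [k] are taken to be indicators: [k = 0] is the independence
   hypothesis itself, and [k = m] is the goal. *)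
suff claim (k : nat) : forall (h : nat -> R -> R) (e : nat -> R),
    (forall i, measurable_fun setT (h i)) ->
    (forall i x, 0 <= h i x)%R ->
    (forall i, \int[P]_w (h i (X i w))%:E = (e i)%:E) ->
    (forall i, (k <= i < m)%N -> exists2 A, measurable A & h i = \1_A) ->
    \int[P]_w (\prod_(i < m) h i (X i w))%:E = (\prod_(i < m) e i)%:E.
  by apply: (claim m) => // i /andP[mi im]; move: (leq_ltn_trans mi im); rewrite ltnn.
elim: k => {h e mh h0 he} [|k IHk] h e mh h0 he hA.
  have /choice[A AP] : forall i, exists A, (i < m)%N -> measurable A /\ h i = \1_A.
    move=> i; have [im|im] := boolP (i < m)%N; last by exists set0.
    by have [A mA hiA] := hA i im; exists A.
  have mA i : (i < m)%N -> measurable (A i) by move=> /AP[].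
  have mXA i : (i < m)%N -> measurable (X i @^-1` A i).
    by move=> im; apply: measurable_funPTI; exact: (mA i im).
  have eP i : (i < m)%N -> (e i)%:E = P (X i @^-1` A i).
    move=> im; rewrite -he; have [_ ->] := AP i im.
    by rewrite -indE//; exact: mXA.
  transitivity (P (\bigcap_(i in [set i | (i < m)%N]) (X i @^-1` A i))).
    have mcap : measurable (\bigcap_(i in [set i | (i < m)%N]) (X i @^-1` A i)).
      by apply: bigcap_measurableType => i im; exact: mXA.
    rewrite -indE//; apply: eq_integral => w _; congr EFin.
    rewrite indicE; apply/esym; have [/set_mem wA|wA] := boolP (_ \in _).
      rewrite big1// => i _; have [_ ->] := AP i (ltn_ord i).
      by rewrite indicE mem_set//; exact: (wA i (ltn_ord i)).
    have [i im wi] : exists2 i, (i < m)%N & ~ A i (X i w).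
      apply: contrapT => nwA; move/negP: wA; apply; apply/mem_set => i im /=.
      by apply: contrapT => Ai; apply: nwA; exists i.
    rewrite (bigD1 (Ordinal im))//=; have [_ ->] := AP i im.
    by rewrite indicE memNset// mul0r.
  rewrite X_indep// -prodEFin; apply: eq_bigr => i _.
  by rewrite eP.
have [km|mk] := ltnP k m; last first.
  by apply: IHk => // i /andP[ki im]; apply: hA; rewrite im andbT (leq_trans _ ki)//;
    move: (leq_trans im (leq_trans mk ki)); rewrite ltnn.
pose k' := Ordinal km.
have neqk (i : 'I_m) : i != k' -> (i == k :> nat) = false.
  by move=> /negbTE; rewrite -val_eqE.
pose Z w := (\prod_(i < m | i != k') h i (X i w))%R.
pose c := (\prod_(i < m | i != k') e i)%R.
have e0 i : (0 <= e i)%R.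
  by rewrite -lee_fin -he; apply: integral_ge0 => w _; rewrite lee_fin.
have c0 : (0 <= c)%R by exact: prodr_ge0.
have mZ : measurable_fun setT Z.
  rewrite (_ : Z = fun w => \prod_(i <- [seq i <- index_enum 'I_m | i != k']) h i (X i w))%R.
    by apply: measurable_prod => i _; exact: measurableT_comp.
  by apply/funext => w; rewrite big_filter.
have Z0 w : (0 <= Z w)%R by exact: prodr_ge0.
(* Weighting by the product [Z] of the other factors only multiplies the law of [X k] by a constant.
   This is the induction hypothesis with an indicator as the factor of index [k]. *)
have ZE A : measurable A ->
    \int[P]_w (Z w * \1_A (X k w))%:E = mscale (NngNum c0) (distribution P (X k)) A.
  move=> mA; pose h' i := if i == k then \1_A : R -> R else h i.
  pose e' i := if i == k then fine (P (X k @^-1` A)) else e i.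
  have e'c : (\prod_(i < m) e' i = fine (P (X k @^-1` A)) * c)%R.
    rewrite (bigD1 k')//= {1}/e' eqxx; congr (_ * _)%R.
    by apply: eq_bigr => i ik; rewrite /e' neqk.
  have := IHk h' e'; rewrite e'c => H.
  rewrite [RHS](_ : _ = c%:E * P (X k @^-1` A))// muleC.
  rewrite -[P _]fineK ?fin_num_measure//; last first.
    by exact/measurable_funPTI.
  rewrite -EFinM -H.
  - apply: eq_integral => w _; congr EFin; rewrite [RHS](bigD1 k')//= {1}/h' eqxx mulrC.
    congr (_ * _)%R; apply: eq_bigr => i ik.
    by rewrite /h' neqk.
  - by move=> i; rewrite /h'; case: ifP.
  - by move=> i x; rewrite /h'; case: ifP => // _; rewrite indicE.
  - move=> i; rewrite /h' /e'; have [->|//] := eqVneq i k.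
    have mXA : measurable (X k @^-1` A).
      by exact/measurable_funPTI.
    by rewrite fineK ?fin_num_measure// -indE.
  - move=> i /andP[ki im]; rewrite /h'; case: eqVneq => [_|ik]; first by exists A.
    by apply: hA; rewrite im andbT ltn_neqAle eq_sym ik.
have := ge0_integral_weighted_pushforward (measurable_funPT (X k)) mZ Z0 ZE
  (h := EFin \o h k).
rewrite ge0_integral_mscale//=; last 2 first.
- exact/measurable_EFinP.
- by move=> x _; rewrite lee_fin.
rewrite ge0_integral_distribution//=; last 2 first.
- exact/measurable_EFinP.
- by move=> y; rewrite lee_fin.
rewrite he -EFinM => H.
rewrite [in RHS](bigD1 k')//= mulrC -H//; last 2 first.
- exact/measurable_EFinP.
- by move=> y; rewrite lee_fin.
by apply: eq_integral => w _; rewrite -EFinM; congr EFin; rewrite (bigD1 k')//= mulrC.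
Qed.

End IndependentProduct.

(** * Moment generating function and tail of the Wiener integral *)

Section GaussianTail.
Context {R : realType}.
Local Notation mu := (@lebesgue_measure R).

(** Completing the square: exp (a x) times the centred density is exp (a^2 sigma^2 / 2) times the
    density with mean a sigma^2. *)
Lemma normal_mgf (nu : {measure set R -> \bar R}) (a sigma : R) : sigma != 0 ->
  (forall A : set R, measurable A -> nu A = normal_prob 0 sigma A) ->
  (\int[nu]_x (expR (a * x))%:E = (expR (a ^+ 2 * sigma ^+ 2 / 2))%:E)%E.
Proof.
move=> s0 nuE; have s20 : sigma ^+ 2 != 0 by rewrite expf_neq0.
have ZE (A : set R) : measurable A ->
    (\int[mu]_x (normal_pdf 0 sigma x * \1_A x)%:E = nu A)%E.
  move=> mA; rewrite nuE// /normal_prob [RHS]integral_mkcond; apply: eq_integral => x _.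
  rewrite /patch; case: ifPn => [xA|xA]; first by rewrite indicE xA mulr1.
  by rewrite indicE (negbTE xA) mulr0.
rewrite -(@ge0_integral_weighted_pushforward _ _ _ _ _ mu nu idfun (normal_pdf 0 sigma))//=.
- under eq_integral => x _.
    rewrite -EFinM (_ : normal_pdf 0 sigma x * expR (a * x) =
      expR (a ^+ 2 * sigma ^+ 2 / 2) * normal_pdf (a * sigma ^+ 2) sigma x).
      rewrite EFinM; over.
    rewrite /normal_pdf (negbTE s0) [RHS]mulrCA -[LHS]mulrA; congr (_ * _).
    rewrite /normal_fun -!expRD; congr expR; rewrite -(mulr_natr (sigma ^+ 2)) subr0.
    by field.
  rewrite ge0_integralZl//=.
  + by rewrite integral_normal_pdf mule1.
  + by apply/measurable_EFinP; exact: measurable_normal_pdf.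
  + by move=> x _; rewrite lee_fin normal_pdf_ge0.
- exact: measurable_id.
- exact: measurable_normal_pdf.
- by move=> x; exact: normal_pdf_ge0.
- by apply/measurable_EFinP; apply: measurableT_comp => //; exact: mulrl_measurable.
Qed.

Context d (T : measurableType d) (P : probability T R) (B : R -> {RV P >-> R}).
Hypothesis BM : brownian_motion B.

Definition increment (m i : nat) : {RV P >-> R} := B (grid m i.+1) - B (grid m i).

Lemma increment_mgf m i (a : R) : (i <= m)%N ->
  (\int[P]_w (expR (a * increment m i w))%:E = (expR (a ^+ 2 / m.+1%:R / 2))%:E)%E.
Proof.
move=> im; have [_ _ Bn _] := BM.
pose s : R := Num.sqrt (grid m i.+1 - grid m i).
have s2 : s ^+ 2 = m.+1%:R^-1 by rewrite sqr_sqrtr gridS// invr_ge0.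
have s0 : s != 0 by rewrite gt_eqF// sqrtr_gt0 gridS invr_gt0.
rewrite -s2 -(@normal_mgf (distribution P (increment m i)))//.
  rewrite ge0_integral_distribution//.
  by apply/measurable_EFinP; apply: measurableT_comp => //; exact: mulrl_measurable.
move=> A mA; rewrite -Bn//; [exact: grid_ge0|exact: grid_lt|exact: grid_le1].
Qed.

Lemma left_sum_mgf (g : R -> R) m (a : R) :
  (\int[P]_w (expR (a * left_sum g (B ^~ w) m))%:E =
   (expR (a ^+ 2 * (\sum_(i < m.+1) g (grid m i) ^+ 2 / m.+1%:R) / 2))%:E)%E.
Proof.
have [_ _ _ Bi] := BM.
(* The factors are set to 1 beyond the grid because the hypotheses on them range over all
   indices. *)
pose h i x := if (i <= m)%N then expR (a * g (grid m i) * x) else 1.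
pose e i := if (i <= m)%N then expR ((a * g (grid m i)) ^+ 2 / m.+1%:R / 2) else 1.
have := @integral_prod_independent _ T R P m.+1 (increment m) _ h e.
move=> H; transitivity (\int[P]_w (\prod_(i < m.+1) h i (increment m i w))%:E)%E.
  apply: eq_integral => w _; congr EFin.
  rewrite /left_sum /riemann_sum mulr_sumr expR_sum; apply: eq_bigr => i _.
  by rewrite /h -ltnS ltn_ord mulrA.
rewrite H.
- congr EFin; rewrite mulr_sumr mulr_suml expR_sum; apply: eq_bigr => i _.
  by rewrite /e -ltnS ltn_ord; congr expR; ring.
- move=> A mA; have := Bi m.+1 (grid m) A; apply => //.
  + by move=> i im; exact: unitI_grid.
  + by move=> i im; exact: grid_lt.
- move=> i; rewrite /h; case: (i <= m)%N; last exact: measurable_cst.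
  by apply: measurableT_comp => //; exact: mulrl_measurable.
- by move=> i x; rewrite /h; case: ifP => // _; exact: expR_ge0.
- move=> i; rewrite /h /e; case: ifP => [im|_]; first exact: increment_mgf.
  by rewrite integral_cst// mul1e; exact: probability_setT.
Qed.

Lemma measurable_brownian_path :
  measurable_fun setT (fun w => (fun t => B t w) : data_path R).
Proof. by apply: measurable_into_paths => t _; exact: measurable_funPT. Qed.

Lemma measurable_wiener_brownian g :
  measurable_fun setT (fun w => wiener_integral g (B ^~ w)).
Proof.
exact: (measurableT_comp (measurable_wiener_integral g) measurable_brownian_path).
Qed.

(** The left sums converge along each path, and their exponential moments converge as well; Fatou's
    lemma gives an inequality, which is the direction that a tail bound calls for. *)
Lemma wiener_mgf g (a : R) : continuously_differentiable g ->
  (\int[P]_w (expR (a * wiener_integral g (B ^~ w)))%:E <=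
   (expR (a ^+ 2 * inner unitI g g / 2))%:E)%E.
Proof.
move=> gC1; have [_ Bc _ _] := BM.
have mS m : measurable_fun setT (fun w => (expR (a * left_sum g (B ^~ w) m))%:E).
  apply/measurable_EFinP; apply: measurableT_comp => //; apply: measurable_funM => //.
  apply: measurable_sum => i; apply: measurable_funM => //.
  by apply: measurable_funB; exact: measurable_funPT.
have := @fatou _ T R P setT measurableT _ mS _ => H.
have E : (\int[P]_w (expR (a * wiener_integral g (B ^~ w)))%:E =
    \int[P]_w limn_einf (fun m => (expR (a * left_sum g (B ^~ w) m))%:E))%E.
  apply: eq_integral => w _.
  have /cvg_ex[z zlim] := left_sum_cvg gC1 (Bc w).
  have lim : (expR (a * left_sum g (B ^~ w) m))%:E @[m --> \oo] -->
      (expR (a * wiener_integral g (B ^~ w)))%:E.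
    rewrite (wiener_integral_lim zlim).
    apply: cvg_EFin; first by apply: nearW.
    have az : a * left_sum g (B ^~ w) m @[m --> \oo] --> a * z by exact: cvgMl_tmp.
    exact: (cvg_comp _ _ az (@continuous_expR R _)).
  rewrite is_cvg_limn_einfE; last exact: cvgP lim.
  by rewrite (cvg_lim _ lim).
rewrite E; apply: (le_trans (H _)); first by move=> m w _; rewrite lee_fin expR_ge0.
have lim : (\int[P]_w (expR (a * left_sum g (B ^~ w) m))%:E)%E @[m --> \oo] -->
    (expR (a ^+ 2 * inner unitI g g / 2))%:E.
  under eq_fun do rewrite left_sum_mgf.
  apply: cvg_EFin; first by apply: nearW.
  have gg : a ^+ 2 * (\sum_(i < m.+1) g (grid m i) ^+ 2 / m.+1%:R) / 2 @[m --> \oo]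
      --> a ^+ 2 * inner unitI g g / 2.
    by apply: cvgMr_tmp; apply: cvgMl_tmp; exact/left_sum_sqr_cvg/C1_continuous.
  exact: (cvg_comp _ _ gg (@continuous_expR R _)).
rewrite is_cvg_limn_einfE; last exact: cvgP lim.
by rewrite (cvg_lim _ lim).
Qed.

(** Chernoff's bound with parameters x and -x: exp (x^2) times the probability of x^2 <= a Z is at
    most exp (x^2 / 2), for a = x and a = -x. *)
Lemma wiener_tail g (x : R) : continuously_differentiable g -> inner unitI g g = 1 ->
  0 <= x ->
  (P [set w | (x < `|wiener_integral g (B ^~ w)|)%R] <= (2 * expR (- x ^+ 2 / 2))%:E)%E.
Proof.
move=> gC1 g1 x0; set Z := fun w => wiener_integral g (B ^~ w).
have mZ : measurable_fun setT Z by exact: measurable_wiener_brownian.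
have half (a : R) : a ^+ 2 = x ^+ 2 ->
    (P [set w | (x ^+ 2 <= a * Z w)%R] <= (expR (- x ^+ 2 / 2))%:E)%E.
  move=> a2; set E := [set w | _].
  have mE : measurable E.
    rewrite -[E]setTI; apply: measurable_fun_le => //; exact: measurable_funM.
  have : ((expR (x ^+ 2))%:E * P E <= (expR (x ^+ 2 / 2))%:E)%E.
    have := wiener_mgf a gC1; rewrite g1 mulr1 a2; apply: le_trans.
    have <- : (\int[P]_(w in E) (expR (x ^+ 2))%:E = (expR (x ^+ 2))%:E * P E)%E.
      by rewrite integral_cst.
    rewrite integral_mkcond.
    apply: ge0_le_integral => //.
    - by move=> w _; rewrite /patch; case: ifP => // _; rewrite lee_fin expR_ge0.
    - by apply/(measurable_restrictT _ mE); exact: measurable_cst.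
    - apply/measurable_EFinP; apply: measurableT_comp => //; exact: measurable_funM.
    - move=> w _; rewrite /patch; case: ifPn => [|_]; last by rewrite lee_fin expR_ge0.
      by rewrite inE => Ew; rewrite lee_fin ler_expR.
  rewrite muleC -lee_pdivlMr ?expR_gt0// -EFinM -expRN -expRD => /le_trans; apply.
  by rewrite lee_fin ler_expR; lra.
have mlow (a : R) : measurable [set w | x ^+ 2 <= a * Z w].
  by rewrite -[X in measurable X]setTI; apply: measurable_fun_le => //; exact: measurable_funM.
have := measureU2 P (mlow x) (mlow (- x)).
rewrite mulr_natl mulr2n EFinD => HU.
apply: (le_trans _ (le_trans HU (leeD (half x erefl) (half (- x) (sqrrN _))))).
apply: le_measure; rewrite ?inE.
- rewrite (_ : [set w | _] = ~` (setT `&` [set w | `|Z w| <= x])).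
    apply: measurableC; apply: measurable_fun_le => //; exact: measurableT_comp.
  by rewrite setTI; apply/seteqP; split => w /=; rewrite ltNge => /negP.
- exact: measurableU.
move=> w /= xZ; have [Z0|Z0] := leP 0 (Z w); [left|right].
  by move: xZ; rewrite ger0_norm// expr2 => /ltW; exact: ler_wpM2l.
by move: xZ; rewrite ltr0_norm// mulNr -mulrN expr2 => /ltW; exact: ler_wpM2l.
Qed.

End GaussianTail.

(** * A continuously differentiable version of the wavelet basis *)

Section AeZero.
Context {R : realType}.
Local Notation mu := (@lebesgue_measure R).

Lemma L2_small_ae0 (D : set (measurableTypeR R)) (h : R -> R) : measurable D -> L2 D h ->
  (forall eta : R, 0 < eta -> \int[mu]_(x in D) h x ^+ 2 <= eta) ->
  {ae mu, forall x, D x -> h x = 0}.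
Proof.
move=> mD /(L2P mD)[mh ih] small.
have int0 : (\int[mu]_(x in D) `|(h x ^+ 2)%:E| = 0)%E.
  under eq_integral do rewrite /= ger0_norm ?sqr_ge0//.
  rewrite -[LHS]fineK; last exact: integrable_fin_num.
  congr EFin; apply/eqP; rewrite eq_le; apply/andP; split.
    by apply/ler_addgt0Pl => eta eta0; rewrite addr0; exact: small.
  by apply: Rintegral_ge0 => x _; rewrite sqr_ge0.
have mh2 : measurable_fun D (fun x => (h x ^+ 2)%:E) by case/integrableP: ih.
have := (ae_eq_integral_abs mu mD mh2).1 int0.
apply: filterS => x H Dx; have /= [/eqP] := H Dx.
by rewrite sqrf_eq0 => /eqP.
Qed.

(** Indices outside [s] have zero coefficient, so adding them leaves the projection unchanged while
    making it arbitrarily close to [f]; the distance is therefore zero. *)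
Lemma closed_span_ae (D : set (measurableTypeR R)) (I : eqType) (e : I -> R -> R)
    (f : R -> R) (s : seq I) : measurable D -> orthonormal D e ->
  closed_span D e f -> uniq s -> (forall i, i \notin s -> inner D f (e i) = 0) ->
  {ae mu, forall x, D x -> f x = \sum_(i <- s) inner D f (e i) * e i x}.
Proof.
move=> mD eo fspan us f0.
have fL := fspan.1.
have hL : L2 D (fun x => f x - \sum_(i <- s) inner D f (e i) * e i x).
  by apply: L2B => //; apply: L2_sum => // i; apply: L2Z => //; exact: eo.1.
suff : {ae mu, forall x, D x -> f x - \sum_(i <- s) inner D f (e i) * e i x = 0}.
  by apply: filterS => x H /H/eqP; rewrite subr_eq0 => /eqP.
apply: L2_small_ae0 => // eta eta0.
have [s0 H] := closed_span_approx mD eo fspan eta0.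
have E x : \sum_(i <- s) inner D f (e i) * e i x =
    \sum_(i <- undup (s ++ s0)) inner D f (e i) * e i x.
  rewrite [RHS](bigID [in s])/= [X in _ = _ + X]big1 ?addr0; last first.
    by move=> i /f0 ->; rewrite mul0r.
  rewrite -[RHS]big_filter; apply: perm_big; apply: uniq_perm => //.
    by rewrite filter_uniq// undup_uniq.
  by move=> i; rewrite mem_filter mem_undup mem_cat; case: (i \in s).
under eq_Rintegral do rewrite E.
apply/ltW/H; first exact: undup_uniq.
by move=> i; rewrite mem_undup mem_cat orbC => ->.
Qed.

End AeZero.

Section Regular.
Context {R : realType}.
Implicit Types g h : R -> R.

Definition regular g :=
  continuously_differentiable g /\ exists C : R, forall x, `|g x| <= C.

Lemma C1P g : continuously_differentiable g <->
  exists2 g' : R -> R, continuous g' & forall x : R, is_derive x 1 g (g' x).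
Proof.
split=> [[dg cg]|[g' cg' dg]].
  by exists (derive1 g) => // x; rewrite derive1E; exact: derivableP.
have E : derive1 g = g' by apply/funext => x; rewrite derive1E; exact: derive_val.
by split => [x|]; [exact: (@ex_derive _ _ _ _ _ _ _ (dg x))|rewrite E].
Qed.

Lemma C1_affine g (a b : R) : continuously_differentiable g ->
  continuously_differentiable (fun x => g (a * x + b)).
Proof.
move=> /C1P[g' cg' dg]; apply/C1P; exists (fun x => g' (a * x + b) * a).
  move=> x; apply: cvgM; last exact: cvg_cst.
  apply: (continuous_comp (f := fun x => a * x + b)); last exact: cg'.
  by apply: cvgD; [apply: cvgMl_tmp; exact: cvg_id|exact: cvg_cst].
move=> x; have da : is_derive x 1 (fun x : R => a * x + b) a.
  have -> : (fun x : R => a * x + b) = (a \*: id) + cst b by [].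
  by apply: is_derive_eq; rewrite addr0 scaler1.
exact: (@is_derive1_comp _ g (fun x => a * x + b)).
Qed.

Lemma C1D g h : continuously_differentiable g -> continuously_differentiable h ->
  continuously_differentiable (fun x => g x + h x).
Proof.
move=> /C1P[g' cg' dg] /C1P[h' ch' dh]; apply/C1P; exists (fun x => g' x + h' x).
  by move=> x; apply: cvgD; [exact: cg'|exact: ch'].
by move=> x; exact: is_deriveD.
Qed.

Lemma C1Z c g : continuously_differentiable g ->
  continuously_differentiable (fun x => c * g x).
Proof.
move=> /C1P[g' cg' dg]; apply/C1P; exists (fun x => c * g' x).
  by move=> x; apply: cvgMl_tmp; exact: cg'.
by move=> x; exact: is_deriveZ.
Qed.

Lemma C1_cst c : continuously_differentiable (fun=> c : R).
Proof.
apply/C1P; exists (fun=> 0); first by move=> x; exact: cvg_cst.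
by move=> x; exact: is_derive_cst.
Qed.

Lemma regular_affine g (a b : R) : regular g -> regular (fun x => g (a * x + b)).
Proof.
move=> [cg [C gC]]; split; first exact: C1_affine.
by exists C => x; exact: gC.
Qed.

Lemma regularD g h : regular g -> regular h -> regular (fun x => g x + h x).
Proof.
move=> [cg [C gC]] [ch [C' hC]]; split; first exact: C1D.
by exists (C + C') => x; exact: le_trans (ler_normD _ _) (lerD (gC x) (hC x)).
Qed.

Lemma regularZ c g : regular g -> regular (fun x => c * g x).
Proof.
move=> [cg [C gC]]; split; first exact: C1Z.
by exists (`|c| * C) => x; rewrite normrM ler_wpM2l.
Qed.

Lemma regular0 : regular (fun=> 0 : R).
Proof. by split; [exact: C1_cst|exists 0 => x; rewrite normr0]. Qed.

Lemma regular_sum (I : Type) (s : seq I) (F : I -> R -> R) :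
  (forall i, regular (F i)) -> regular (fun x => \sum_(i <- s) F i x).
Proof.
move=> rF; elim: s => [|i s IHs].
  by have := regular0; congr regular; apply/funext => x; rewrite big_nil.
by have := regularD (rF i) IHs; congr regular; apply/funext => x; rewrite big_cons.
Qed.

Lemma regular_dilate (j k : int) g : regular g -> regular (dilate j (translate k g)).
Proof.
move=> rg; have := regularZ (Num.sqrt (2 ^ j)) (regular_affine (2 ^ j) (- k%:~R) rg).
by [].
Qed.

Lemma regular_dilate0 (j : int) g : regular g -> regular (dilate j g).
Proof.
move=> rg; have := regularZ (Num.sqrt (2 ^ j)) (regular_affine (2 ^ j) 0 rg).
by congr regular; apply/funext => x; rewrite addr0.
Qed.

Lemma regularN g h : regular g -> regular h -> regular (fun x => g x - h x).
Proof.
move=> rg rh; have := regularD rg (regularZ (-1) rh).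
by congr regular; apply/funext => x; rewrite mulN1r.
Qed.

End Regular.

Section Edge.
Context {R : realType}.
Variables (K N : nat).

Lemma orthonormalisation_regular (D : set R) (g e : nat -> R -> R) :
  orthonormalisation N D g e -> (forall k, (k < N)%N -> exists2 h, regular h &
    forall x, D x -> g k x = h x) ->
  exists2 h : nat -> R -> R, (forall k, regular (h k)) &
    forall k x, (k < N)%N -> D x -> e k x = h k x.
Proof.
move=> [_ [A eA]] gh.
have /choice[h hP] : forall l : 'I_N, exists h, regular h /\ forall x, D x -> g l x = h x.
  by move=> l; have [h] := gh l (ltn_ord l); exists h.
exists (fun k x => if insub k is Some i then \sum_(l < N) A (i : 'I_N) l * h l x else 0).
  move=> k; case: insubP => [i _ _|_]; last exact: regular0.
  by apply: regular_sum => l; apply: regularZ; exact: (hP l).1.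
move=> k x kN Dx; rewrite insubT/= (eA (Ordinal kN))//; apply: eq_bigr => l _.
by rewrite (hP l).2.
Qed.

(** The edge functions are prescribed only on the half-line, where they are finite combinations of
    regular functions; the same combinations extend them regularly to the whole line. *)
Lemma cdv_edge_regular phi (phiL psiL : nat -> R -> R) : regular phi ->
  cdv_edge K N phi phiL psiL ->
  exists gL hL : nat -> R -> R, [/\ forall k, regular (gL k), forall k, regular (hL k),
    forall k x, (k < N)%N -> 0 <= x -> phiL k x = gL k x &
    forall k x, (k < N)%N -> 0 <= x -> psiL k x = hL k x].
Proof.
move=> rphi [ophi opsi].
have half (x : R) : 0 <= x -> halfline x by rewrite /halfline/= in_itv/= andbT.
have [] := orthonormalisation_regular ophi.
  move=> k kN; exists (edge_scaling K N phi k) => //.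
  apply: regular_sum => n; apply: regularZ.
  have := regular_affine 1 (n%:R - N%:R + 1) rphi.
  by congr regular; apply/funext => x; rewrite mul1r !addrA.
move=> gL rgL gLE; have [] := orthonormalisation_regular opsi.
  move=> k kN; exists (fun x => dilate 1 (gL k) x
      - \sum_(l < N) inner halfline (dilate 1 (phiL k)) (phiL l) * gL l x
      - \sum_(N <= m < N + K.*2)
          inner halfline (dilate 1 (phiL k)) (translate m phi) * translate m phi x).
    apply: regularN; first apply: regularN.
    - exact: regular_dilate0.
    - by apply: regular_sum => l; exact: regularZ.
    - apply: regular_sum => m; apply: regularZ.
      have := regular_affine 1 (- (m : int)%:~R) rphi.
      by congr regular; apply/funext => x; rewrite mul1r.
  move=> x; rewrite /halfline/= in_itv/= andbT => x0; rewrite /edge_wavelet.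
  congr (_ - _ - _).
    rewrite /dilate gLE//; apply: half; rewrite mulr_ge0//.
  by apply: eq_bigr => l _; rewrite gLE//; exact: half.
move=> hL rhL hLE; exists gL, hL; split => //.
  by move=> k x kN /half x0; exact: gLE.
by move=> k x kN /half x0; exact: hLE.
Qed.

End Edge.

(** * Compact supports and the mother wavelet *)

Section CompactSupport.
Context {R : realType}.
Local Notation mu := (@lebesgue_measure R).
Implicit Types (g h : R -> R) (A : R).

Definition supported A g := forall x, A < `|x| -> g x = 0.

Lemma supportedE A g : supported A g -> g \_ `[- A, A] = g.
Proof.
move=> gA; apply/funext => x; rewrite patchE; case: ifPn => // xA.
apply/esym/gA; rewrite ltNge; apply: contraNN xA; rewrite ler_norml => H.
by rewrite inE/= in_itv.
Qed.

Lemma integral_supported A g : supported A g ->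
  \int[mu]_x g x = \int[mu]_(x in `[- A, A]) g x.
Proof. by move=> gA; rewrite [RHS]Rintegral_mkcond (supportedE gA). Qed.

Lemma integrable_supported A g : continuous g -> supported A g ->
  mu.-integrable setT (fun x => (g x)%:E).
Proof.
move=> cg gA.
have ig := @continuous_compact_integrable R g `[- A, A] (@segment_compact _ _ _)
  (continuous_subspaceT cg).
have mA : measurable (`[- A, A] : set (measurableTypeR R)) by exact: measurable_itv.
have := (integrable_mkcond _ mA).1 ig.
by rewrite restrict_EFin (supportedE gA).
Qed.

Lemma L2_supported A g : continuous g -> supported A g -> L2 setT g.
Proof.
move=> cg gA; apply/L2P => //; split; first exact: continuous_measurable_fun.
apply: (@integrable_supported A).
  move=> x; rewrite [X in continuous_at _ X](_ : _ = fun x => g x * g x).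
    by apply: cvgM; exact: cg.
  by apply/funext => y; rewrite expr2.
by move=> x /gA ->; rewrite expr0n.
Qed.

Lemma integral_double A g : 0 <= A -> continuous g -> supported A g ->
  \int[mu]_x (2 * g (2 * x)) = \int[mu]_x g x.
Proof.
move=> A0 cg gA.
have g2A : supported (2 * A) g.
  by move=> x Ax; apply: gA; apply: le_lt_trans Ax; rewrite ler_peMl// ler1n.
have hA : supported A (fun x => 2 * g (2 * x)).
  move=> x Ax; rewrite gA ?mulr0// normrM gtr0_norm//.
  by apply: (lt_le_trans Ax); rewrite ler_peMl// ler1n.
rewrite (integral_supported hA) (integral_supported g2A) -mulrN.
pose F (x : R) := 2 * x.
have dF (x : R) : is_derive x 1 F 2.
  have -> : F = 2 \*: id by [].
  by apply: is_derive_eq; rewrite scaler1.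
have F'E : F^`()%classic = cst 2.
  by apply/funext => x; rewrite derive1E; exact: derive_val.
have cF : continuous F by move=> x; apply: cvgMl_tmp; exact: cvg_id.
have := @integration_by_substitution_increasing R F g (- A) A.
rewrite F'E => H; congr fine; apply/esym.
transitivity (\int[mu]_(x in `[(- A)%R, A]) (((g \o F) * cst 2) x)%:E)%E; last first.
  by apply: eq_integral => x _; rewrite /= mulrC.
apply: H.
- by rewrite (le_trans _ A0)// oppr_le0.
- by move=> x y _ _ xy; rewrite ltr_pM2l.
- by move=> x _; exact: cvg_cst.
- exact: is_cvg_cst.
- exact: is_cvg_cst.
- split; first by move=> x _; exact: ex_derive.
    exact/cvg_at_right_filter/cF.
  exact/cvg_at_left_filter/cF.
- exact: continuous_subspaceT.
Qed.

End CompactSupport.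

Section MotherWavelet.
Context {R : realType}.
Local Notation mu := (@lebesgue_measure R).
Variables (phi psi : R -> R) (K : nat).
Hypotheses (phiC : continuous phi) (phi_reg : regular phi).
Hypothesis phi_orth : orthonormal setT (fun k : int => translate k phi).
Hypothesis phiK : supported K%:R phi.
Hypothesis psiK : supported K%:R psi.
Hypothesis psiW : wavelet_of phi psi.

Let phi1 (k : int) := dilate 1 (translate k phi).

Lemma dilate1E (k : int) x : phi1 k x = Num.sqrt 2 * phi (2 * x - k%:~R).
Proof. by rewrite /phi1 /dilate /translate expr1z. Qed.

Lemma orthonormal_dilate1 : orthonormal setT phi1.
Proof.
have supp1 k : supported (K%:R + `|k%:~R|) (phi1 k).
  move=> x xK; rewrite dilate1E phiK ?mulr0//.
  have := lerB_dist (2 * x) k%:~R; rewrite normrM gtr0_norm//.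
  have := normr_ge0 x; lra.
split=> [k|k l].
  apply: L2_supported (supp1 k).
  by have [/C1_continuous + _] := regular_dilate 1 k phi_reg.
rewrite -phi_orth.2.
pose g (y : R) : R := phi (y - k%:~R) * phi (y - l%:~R).
rewrite [RHS](_ : _ = \int[mu]_x g x)//.
rewrite -(@integral_double _ (K%:R + `|k%:~R|) g).
- apply: eq_Rintegral => x _; rewrite !dilate1E /g mulrACA -expr2 sqr_sqrtr//.
- by rewrite addr_ge0.
- have cs (i : int) : continuous (fun y : R => phi (y - i%:~R)).
    move=> y; apply: (continuous_comp (f := fun y : R => y - i%:~R)); last exact: phiC.
    by apply: cvgB; [exact: cvg_id|exact: cvg_cst].
  by move=> y; apply: cvgM; exact: cs.
- move=> y yK; rewrite /g phiK ?mul0r//.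
  have := lerB_dist y k%:~R; lra.
Qed.

(* psi, known only almost everywhere, lies in V_1, and only finitely many of the
   functions spanning V_1 overlap its support. *)
Lemma wavelet_regular : exists psit : R -> R,
  [/\ regular psit, supported (2 * K)%:R psit &
      {ae mu, forall x, psit x = psi x}].
Proof.
have [psi_orth psi_span] := psiW.
have psi0 : translate 0 psi = psi by apply/funext => x; rewrite /translate subr0.
have psiL : L2 setT psi by rewrite -psi0; exact: psi_orth.1.
have psiV : mraV phi 1 psi.
  suff : mraW0 phi psi by case.
  rewrite -psi_span; split => // eta eta0; exists [:: 0%Z], (fun=> 1).
  apply: le_lt_trans eta0; rewrite le_eqVlt; apply/orP; left; apply/eqP.
  rewrite -[RHS](Rintegral_set0 mu (fun=> 0)).
  under eq_Rintegral do rewrite big_seq1 mul1r psi0 subrr expr0n/=.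
  by rewrite Rintegral_cst// mul0r Rintegral_set0.
(* If |x| <= K and |2 x - k| <= K then |k| <= 3 K, so [s] holds all shifts that meet the support of
   [psi]. Conversely |k| <= 3 K confines the sum to |x| <= 2 K. *)
pose s := [seq i%:Z - (3 * K)%:Z | i <- iota 0 (6 * K).+1].
have us : uniq s by rewrite map_inj_uniq ?iota_uniq// => a b /addIr[].
have out k : k \notin s -> (3 * K < `|k|)%N.
  move=> ks; rewrite ltnNge; apply: contraNN ks => kK; apply/mapP.
  exists (`|(k + (3 * K)%:Z)%R|)%N; last by lia.
  by rewrite mem_iota; lia.
have inner0 k : k \notin s -> inner setT psi (phi1 k) = 0.
  move=> /out kK; rewrite /inner -[RHS](Rintegral_set0 mu (fun=> 0)).
  have E x : psi x * phi1 k x = 0.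
    have [xK|xK] := leP `|x| K%:R; last by rewrite psiK// mul0r.
    rewrite dilate1E phiK ?mulr0//.
    have kR : (3 * K)%:R < `|k%:~R : R|.
      by rewrite -intr_norm -[X in X < _]/((3 * K)%:Z%:~R) ltr_int; lia.
    have := lerB_dist k%:~R (2 * x); rewrite normrM gtr0_norm// distrC.
    move: kR; rewrite natrM; lra.
  under eq_Rintegral do rewrite E.
  by rewrite Rintegral_cst// mul0r Rintegral_set0.
exists (fun x => \sum_(k <- s) inner setT psi (phi1 k) * phi1 k x); split.
- by apply: regular_sum => k; apply: regularZ; exact: regular_dilate.
- move=> x xK; rewrite big_seq big1// => _ /mapP[i + ->].
  rewrite mem_iota => iK; rewrite dilate1E phiK ?mulr0//.
  have iR : `|(i%:Z - (3 * K)%:Z)%:~R : R| <= (3 * K)%:R.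
    by rewrite -intr_norm -[X in _ <= X]/((3 * K)%:Z%:~R) ler_int; lia.
  have := lerB_dist (2 * x) (i%:Z - (3 * K)%:Z)%:~R; rewrite normrM gtr0_norm//.
  move: iR xK; rewrite !natrM; lra.
- have := closed_span_ae measurableT orthonormal_dilate1 psiV us inner0.
  by apply: filterS => x H; rewrite H.
Qed.

End MotherWavelet.

Section AffineAe.
Context {R : realType}.
Local Notation mu := (@lebesgue_measure R).

(** By uniqueness of Lebesgue measure, it is enough to compare both sides on half-open intervals. *)
Lemma lebesgue_measure_affine (a b : R) (A : set (measurableTypeR R)) : 0 < a ->
  measurable A -> (a%:E * mu ((fun x => (a * x + b)%R) @^-1` A) = mu A)%E.
Proof.
move=> a0 mA.
pose F (x : measurableTypeR R) : measurableTypeR R := a * x + b.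
have mF : measurable_fun setT F.
  apply: continuous_measurable_fun => x.
  by apply: cvgD; [apply: cvgMl_tmp; exact: cvg_id|exact: cvg_cst].
pose nu := mscale (NngNum (ltW a0)) (pushforward mu F).
rewrite -[LHS]/(nu mF A); apply/esym/(lebesgue_measure_unique (mu := nu mF)) => //= _ [[u v]] _ <-.
rewrite /nu /mscale/= /pushforward.
have -> : (F @^-1` `]u, v])%classic = `](u - b) / a, (v - b) / a]%classic.
  apply/seteqP; split => x /=; rewrite /F !in_itv/= ltr_pdivrMr// ler_pdivlMr//;
    by rewrite ltrBlDr lerBrDr mulrC.
rewrite !lebesgue_measure_itv/= !lte_fin ltr_pM2r ?invr_gt0// ltrD2r.
case: ifP => _; last by rewrite mule0.
by rewrite -EFinB -EFinM; congr EFin; field; exact: lt0r_neq0.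
Qed.

Lemma ae_affine (a b : R) (Q : R -> Prop) : 0 < a ->
  {ae mu, forall x, Q x} -> {ae mu, forall x, Q (a * x + b)}.
Proof.
move=> a0 [A [mA A0 QA]]; exists ((fun x => a * x + b) @^-1` A); split.
- rewrite -[X in measurable X]setTI.
  have : measurable_fun (setT : set (measurableTypeR R))
      (fun x : R => a * x + b : measurableTypeR R).
    apply: continuous_measurable_fun => x.
    by apply: cvgD; [apply: cvgMl_tmp; exact: cvg_id|exact: cvg_cst].
  by move=> /(_ measurableT A mA).
- have /eqP := lebesgue_measure_affine b a0 mA.
  by rewrite A0 mule_eq0 eqe gt_eqF//= => /eqP.
- by move=> x /= nQ; exact: QA.
Qed.

End AffineAe.

Section IntervalFunctions.
Context {R : realType} (W : wavelet_data R).
Local Notation N := (momN W).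

Lemma interval_fun_regular (g : R -> R) (gL gR : nat -> R -> R) j k :
  regular g -> (forall k, regular (gL k)) -> (forall k, regular (gR k)) ->
  regular (interval_fun W g gL gR j k).
Proof.
move=> rg rL rR; rewrite /interval_fun.
have [_|_] := ltnP k N; first exact: regular_dilate0.
have [_|_] := ltnP k (2 ^ j - N); first exact: regular_dilate.
have := regular_affine (-1) 1 (regular_dilate0 j (rR (2 ^ j - k.+1)%N)).
by congr regular; apply/funext => x; rewrite mulN1r addrC.
Qed.

Lemma uniform_bound (m : nat) (gL : nat -> R -> R) : (forall k, regular (gL k)) ->
  exists2 C : R, 0 <= C & forall k x, (k < m)%N -> `|gL k x| <= C.
Proof.
move=> rL; elim: m => [|m [C C0 IH]]; first by exists 0.
have [_ [C' C'm]] := rL m; exists (C + `|C'|); first by rewrite addr_ge0.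
move=> k x; rewrite ltnS leq_eqVlt => /predU1P[->|km].
  by rewrite (le_trans (C'm x))// (le_trans (ler_norm _))// lerDr.
by rewrite (le_trans (IH k x km))// lerDl.
Qed.

Lemma sum_supported (A : nat) (C : R) (g : R -> R) : 0 <= C -> supported A%:R g ->
  (forall x, `|g x| <= C) -> forall (m : nat) (y : R),
  \sum_(0 <= k < m) `|g (y - k%:R)| <= (A.*2.+1)%:R * C.
Proof.
move=> C0 gA gC m y.
have [[p pA]|none] := pselect (exists p : nat, `|y - p%:R| <= A%:R); last first.
  rewrite big1 ?mulr_ge0// => k _; rewrite gA ?normr0// ltNge.
  by apply/negP => kA; apply: none; exists k.
have ex : exists p : nat, `|y - p%:R| <= A%:R by exists p.
move: {p pA} (ex_minnP ex) => [p pA pmin].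
have zero k : (k < p)%N || (p + A.*2 < k)%N -> `|g (y - k%:R)| = 0.
  move=> kp; rewrite gA ?normr0// ltNge; apply/negP => kA.
  case/orP: kp => [kp|pk]; first by have := pmin k kA; rewrite leqNgt kp.
  have : k%:R - p%:R <= A.*2%:R :> R.
    rewrite -muln2 natrM; move: kA pA; rewrite !ler_norml => /andP[? ?] /andP[? ?]; lra.
  by rewrite -natrB ?ler_nat; lia.
have [mp|pm] := leqP m p.
  rewrite big_nat big1 ?mulr_ge0// => k km; apply: zero.
  by move/andP: km => [_ km]; rewrite (leq_trans km mp).
rewrite (big_cat_nat (n := p))//=; last exact: ltnW.
rewrite big_nat big1 ?add0r; last by move=> k /= kp; rewrite zero// kp.
pose q := (p + A.*2.+1)%N.
apply: (@le_trans _ _ (\sum_(p <= k < q) `|g (y - k%:R)|)).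
  have [mq|qm] := leqP m q.
    rewrite [leRHS](big_cat_nat (n := m))//=; last exact: ltnW.
    by rewrite lerDl sumr_ge0.
  rewrite (big_cat_nat (n := q))//=; [|exact: leq_addr|exact: ltnW].
  rewrite [X in _ + X]big_nat [X in _ + X]big1 ?addr0// => k /andP[qk _].
  by apply: zero; apply/orP; right; move: qk; rewrite /q addnS.
apply: (@le_trans _ _ (\sum_(p <= k < q) C)); first exact: ler_sum.
by rewrite big_const_nat iter_addr_0 /q addKn mulr_natl.
Qed.

Lemma sum_ltn (m n : nat) : (\sum_(k < m) (k < n) <= n)%N.
Proof.
suff -> : (\sum_(k < m) (k < n) = minn m n)%N by exact: geq_minr.
elim: m => [|m IH]; first by rewrite big_ord0 min0n.
by rewrite big_ord_recr/= IH; lia.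
Qed.

(** At each point at most N left edge functions, N right edge functions and [A.*2.+1] interior ones
    contribute, each bounded by a constant times 2^(j / 2). This is what converts coefficient errors
    into uniform errors. *)
Lemma interval_fun_sum (A : nat) (g : R -> R) (gL gR : nat -> R -> R) :
  regular g -> supported A%:R g ->
  (forall k, regular (gL k)) -> (forall k, regular (gR k)) ->
  exists2 D : R, 0 < D & forall j (x : R),
    \sum_(k < 2 ^ j) `|interval_fun W g gL gR j k x| <= D * 2 `^ (j%:R / 2).
Proof.
move=> [_ [C gC]] gA /(uniform_bound N)[CL CL0 HL] /(uniform_bound N)[CR CR0 HR].
have C0 : 0 <= C by apply: le_trans (gC 0).
exists (N%:R * CL + (A.*2.+1)%:R * C + N%:R * CR + 1).
  by rewrite ltr_wpDl// !addr_ge0// mulr_ge0.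
move=> j x; set r := 2 `^ (j%:R / 2).
have rE : Num.sqrt (2 ^ j%:Z) = r :> R.
  by rewrite -powR12_sqrt ?exprz_ge0// /r powRrM -exprnP powR_mulrn.
have r0 : 0 <= r by exact: powR_ge0.
apply: (@le_trans _ _ (\sum_(k < 2 ^ j) ((k < N)%:R * CL + `|g (2 ^ j%:Z * x - k%:R)|
    + (2 ^ j - N <= k)%:R * CR) * r)).
  apply: ler_sum => k _; rewrite /interval_fun.
  have [kN|Nk] := ltnP k N.
    rewrite /dilate rE normrM ger0_norm// mulrC ler_wpM2r// mul1r -addrA.
    by rewrite (le_trans (HL _ _ kN))// lerDl addr_ge0// mulr_ge0.
  have [kN'|Nk'] := ltnP k (2 ^ j - N).
    rewrite /dilate rE normrM ger0_norm// mulrC ler_wpM2r// mul0r add0r.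
    by rewrite /translate lerDl mulr_ge0.
  rewrite /dilate rE normrM ger0_norm// mulrC ler_wpM2r// mul0r add0r mul1r.
  have kN : (2 ^ j - k.+1 < N)%N by have := ltn_ord k; lia.
  by rewrite (le_trans (HR _ _ kN))// lerDr.
rewrite -mulr_suml ler_wpM2r// !big_split/=.
apply: (@le_trans _ _ (N%:R * CL + (A.*2.+1)%:R * C + N%:R * CR)); last by rewrite lerDl.
apply: lerD; first apply: lerD.
- by rewrite -mulr_suml ler_wpM2r// -natr_sum ler_nat sum_ltn.
- by rewrite -(big_mkord xpredT (fun k => `|g (2 ^ j%:Z * x - k%:R)|)); exact: sum_supported.
- rewrite -mulr_suml ler_wpM2r// -natr_sum ler_nat.
  apply: leq_trans (sum_ltn (2 ^ j) N); rewrite (reindex_inj rev_ord_inj)/=.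
  by apply: leq_sum => k _; have := ltn_ord k; lia.
Qed.

End IntervalFunctions.

(** * Coefficients and continuous versions of Hölder functions *)

Section LevelIndexing.
Context {R : realType} (W : wavelet_data R).
Local Notation N := (momN W).
Local Notation j0 := (coarse W).
Hypothesis hW : cdv_basis W.

(* Level 0, which is below the coarsest one, is used for the scaling functions. *)
Definition level_size (l : nat) : nat :=
  if l == 0%N then (2 ^ j0)%N else if (j0 <= l)%N then (2 ^ l)%N else 0%N.

Definition level_fun (l k : nat) : R -> R :=
  if l == 0%N then phi_jk W j0 k else psi_jk W l k.

Definition level_coef (f : R -> R) (l k : nat) : R := inner unitI f (level_fun l k).

Definition level_index (u : basis_index W) : nat * nat :=
  match u with
  | inl k => (0%N, k : nat)
  | inr (existT i k) => ((j0 + i)%N, k : nat)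
  end.

Definition indices_below (J : nat) : seq (basis_index W) :=
  [seq inl k | k <- enum 'I_(2 ^ j0)] ++
  [seq inr (existT (fun i => 'I_(2 ^ (j0 + i))) i k) | i <- iota 0 (J - j0),
     k <- enum 'I_(2 ^ (j0 + i))].

Let j0_gt0 : (0 < j0)%N := coarse_gt0 hW.

Lemma level_size0 : level_size 0 = (2 ^ j0)%N. Proof. by []. Qed.

Lemma level_size_ge l : (j0 <= l)%N -> level_size l = (2 ^ l)%N.
Proof.
by move=> j0l; rewrite /level_size j0l gtn_eqF// (leq_trans j0_gt0).
Qed.

Lemma level_size_lt l : (0 < l < j0)%N -> level_size l = 0%N.
Proof. by case/andP => l0 lj; rewrite /level_size gtn_eqF// leqNgt lj. Qed.

Lemma level_size_le l : (level_size l <= 2 ^ j0 * 2 ^ l)%N.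
Proof.
rewrite /level_size; case: eqP => [->|_]; first by rewrite expn0 muln1.
by case: ifP => // _; rewrite leq_pmull// expn_gt0.
Qed.

Lemma basis_funE u : basis_fun u = level_fun (level_index u).1 (level_index u).2.
Proof.
case: u => [k|[i k]] //=; rewrite /level_fun/= gtn_eqF//.
by rewrite (leq_trans j0_gt0)// leq_addr.
Qed.

Lemma level_index_size u : ((level_index u).2 < level_size (level_index u).1)%N.
Proof.
case: u => [k|[i k]] /=; first by rewrite level_size0 ltn_ord.
by rewrite level_size_ge ?leq_addr// ltn_ord.
Qed.

Lemma level_indexP l k : (k < level_size l)%N -> exists u, level_index u = (l, k).
Proof.
have [->|l0] := posnP l; first by move=> kl; exists (inl (Ordinal kl)).
have [j0l|lj0] := leqP j0 l; last by rewrite level_size_lt ?l0.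
rewrite level_size_ge// => kl.
have kl' : (k < 2 ^ (j0 + (l - j0)))%N by rewrite subnKC.
by exists (inr (existT _ (l - j0)%N (Ordinal kl'))); rewrite /= subnKC.
Qed.

Lemma indices_below_uniq J : uniq (indices_below J).
Proof.
rewrite cat_uniq; apply/and3P; split.
- by rewrite map_inj_uniq ?enum_uniq// => a b [].
- by apply/hasPn => u /allpairsPdep[i [k [_ _ ->]]]; apply/mapP => -[].
- apply: allpairs_uniq_dep; first exact: iota_uniq.
    by move=> i _; exact: enum_uniq.
  by move=> [i k] [i' k'] _ _ /= [].
Qed.

Lemma mem_indices_below J u : ((level_index u).1 < J)%N -> u \in indices_below J.
Proof.
rewrite mem_cat; case: u => [k|[i k]] /= lJ.
  by apply/orP; left; apply: map_f; rewrite mem_enum.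
apply/orP; right; apply/allpairsPdep; exists i, k; split => //.
  by rewrite mem_iota; lia.
by rewrite mem_enum.
Qed.

Lemma sum_indices_below (F : nat -> nat -> R) J : (j0 <= J)%N ->
  \sum_(u <- indices_below J) F (level_index u).1 (level_index u).2 =
  \sum_(0 <= l < J) \sum_(0 <= k < level_size l) F l k.
Proof.
move=> j0J; rewrite big_cat big_map big_allpairs_dep/=.
rewrite (big_ltn (leq_trans j0_gt0 j0J)) big_enum/= level_size0 big_mkord; congr (_ + _).
rewrite [RHS](big_cat_nat (n := j0))//=.
rewrite [X in _ = X + _]big_nat [X in _ = X + _]big1 ?add0r; last first.
  by move=> l lj; rewrite level_size_lt// big_geq.
rewrite -[X in _ = \sum_(X <= i < J) _]add0n big_addn/= /index_iota subn0.
rewrite [LHS]big_seq [RHS]big_seq; apply: eq_bigr => i _.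
by rewrite big_enum/= level_size_ge ?leq_addl// big_mkord addnC.
Qed.

Lemma level_fun_L2 l k : (k < level_size l)%N -> L2 unitI (level_fun l k).
Proof.
move=> /level_indexP[u ul]; have := (interval_basis hW).1.1 u.
by rewrite basis_funE ul.
Qed.

Lemma level_fun_inner_self l k : (k < level_size l)%N ->
  inner unitI (level_fun l k) (level_fun l k) = 1.
Proof.
move=> /level_indexP[u ul]; have := (interval_basis hW).1.2 u u.
by rewrite basis_funE ul eqxx.
Qed.

Lemma betaE f l k : (j0 <= l)%N -> beta W f l k = level_coef f l k.
Proof. by move=> jl; rewrite /level_coef /level_fun gtn_eqF// (leq_trans j0_gt0). Qed.

Lemma Cs_norm_le s (C : R) f : (Cs_norm W s f <= C%:E)%E <->
  forall l k, (k < level_size l)%N -> `|level_coef f l k| <= envelope s C l.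
Proof.
have wE (l : nat) (x : R) : (2 `^ (l%:R * (s + 2^-1)) * x <= C) = (x <= envelope s C l).
  rewrite /envelope powRN ler_pdivlMr ?pow2_gt0//; first by rewrite mulrC.
split=> [|H].
  rewrite /Cs_norm ge_max => /andP[Ha Hb] l k kl.
  have [l0|l0] := posnP l.
    move: kl; rewrite l0 /envelope mul0r oppr0 powRr0 mulr1 => kl.
    rewrite -lee_fin; apply: le_trans Ha; apply: ereal_sup_ubound.
    by exists k.
  have [j0l|lj0] := leqP j0 l; last by move: kl; rewrite level_size_lt ?l0.
  rewrite -wE -lee_fin; apply: le_trans Hb; apply: ereal_sup_ubound.
  exists (l, k) => /=; first by rewrite j0l -level_size_ge.
  by rewrite betaE.
rewrite /Cs_norm ge_max; apply/andP; split; apply: ge_ereal_sup.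
  move=> _ [k kj0 <-]; rewrite lee_fin.
  by have := H 0%N k kj0; rewrite /envelope mul0r oppr0 powRr0 mulr1.
move=> _ [[l k] /= /andP[j0l kl] <-]; rewrite lee_fin wE betaE//.
by apply: H; rewrite level_size_ge.
Qed.

Lemma detail_coef i j f l k : (j0 <= i)%N -> (i <= j.+1)%N -> (k < level_size l)%N ->
  level_coef (detail W i j f) l k =
  if ((l == 0%N) && (i == j0)) || (i <= l <= j)%N then level_coef f l k else 0.
Proof.
move=> j0i ij kl; have [u ul] := level_indexP kl.
pose incl l := ((l == 0%N) && (i == j0)) || (i <= l)%N.
pose s := [seq v <- indices_below j.+1 | incl (level_index v).1].
pose c v := level_coef f (level_index v).1 (level_index v).2.
have E : detail W i j f = fun x => \sum_(v <- s) c v * basis_fun v x.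
  apply/funext => x; rewrite big_filter big_mkcond/=.
  rewrite /c; under eq_bigr do rewrite basis_funE.
  rewrite (@sum_indices_below (fun l k =>
    if incl l then level_coef f l k * level_fun l k x else 0)) ?(leq_trans j0i)//.
  rewrite /detail [RHS]big_ltn//; congr (_ + _).
    rewrite level_size0 big_mkord /incl/= leqNgt (leq_trans j0_gt0 j0i) orbF.
    by case: eqP => //; rewrite big1.
  rewrite [RHS](big_cat_nat (n := i))//=; last by rewrite (leq_trans j0_gt0).
  rewrite [X in _ = X + _]big_nat [X in _ = X + _]big1 ?add0r; last first.
    move=> l' /andP[l'0 l'i]; rewrite big1// => k' _.
    by rewrite /incl gtn_eqF//= leqNgt l'i.
  rewrite big_nat [RHS]big_nat; apply: eq_bigr => l' /andP[il' _].
  have j0l' := leq_trans j0i il'.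
  rewrite level_size_ge// big_mkord; apply: eq_bigr => k' _.
  by rewrite /incl il' orbT betaE// /level_fun gtn_eqF// (leq_trans j0_gt0).
have -> : level_coef (detail W i j f) l k = inner unitI (detail W i j f) (basis_fun u).
  by rewrite basis_funE ul.
rewrite E.
rewrite (inner_comb measurable_unitI (interval_basis hW).1) ?filter_uniq ?indices_below_uniq//.
rewrite mem_filter /c ul /incl/=.
have [lj|jl] := ltnP l j.+1.
  by rewrite mem_indices_below ?ul// andbT -(ltnS l j) lj andbT.
have -> : (u \in indices_below j.+1) = false.
  apply/negbTE; rewrite mem_cat negb_or; apply/andP; split.
    apply/mapP => -[k' _ E']; move: ul; rewrite E'/= => -[l0 _].
    by move: jl; rewrite -l0.
  apply/allpairsPdep => -[i' [k' [+ _ E']]]; move: ul; rewrite E'/= => -[l0 _].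
  by rewrite mem_iota => /andP[_]; move: jl; rewrite -l0; lia.
rewrite andbF; have -> : (l <= j)%N = false by rewrite leqNgt jl.
rewrite andbF orbF; case: eqP jl => // ->; by rewrite ltn0.
Qed.

(** If all coefficients in range were below eps / 2 times the envelope, the norm would be at most
    eps / 2 times M, strictly less than eps M. At [j = j0] the range starts at level 0 because the
    scaling part belongs to that block. *)
Lemma self_similar_large smax (eps : R) rho s M f j : 0 < eps -> 0 < M -> (0 < rho)%N ->
  self_similar W smax eps rho s M f -> (j0 <= j)%N -> (s < smax \/ j = j0) ->
  large_coefficient level_size (level_coef f) 0 (eps / 2) s M
    (if j == j0 then 0%N else j) (rho * j).
Proof.
move=> eps0 M0 rho0 [_ /(_ j)] H j0j /(H j0j) {}H.
have rj : (j <= rho * j)%N by rewrite leq_pmull.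
apply: contrapT => nlarge.
suff : (Cs_norm W s (detail W j (rho * j) f) <= (eps / 2 * M)%:E)%E.
  move=> /(le_trans H); rewrite lee_fin ler_pM2r// => e2.
  by move: eps0; rewrite ltNge => /negP; apply; move: e2; lra.
apply/Cs_norm_le => l k kl; rewrite detail_coef// ?leqW//.
have eE : envelope s (eps / 2 * M) l = eps / 2 * envelope s M l by rewrite /envelope mulrA.
case: ifPn => [incl|_]; last first.
  by rewrite normr0 eE mulr_ge0 ?ltW ?envelope_gt0// divr_gt0.
rewrite eE leNgt; apply/negP => large; apply: nlarge; exists l, k; split => //.
  case/orP: incl => [/andP[/eqP -> /eqP ->]|/andP[jl lr]]; first by rewrite eqxx.
  by rewrite lr andbT; case: ifP.
by rewrite addr0 ltW.
Qed.

End LevelIndexing.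

Section SmoothBasis.
Context {R : realType} (W : wavelet_data R).
Local Notation mu := (@lebesgue_measure R).
Local Notation N := (momN W).
Local Notation K := (suppK W).
Local Notation j0 := (coarse W).
Hypothesis hW : cdv_basis W.

Let supp_of (g : R -> R) : (forall x, g x != 0 -> 1 - K%:R <= x <= K%:R) ->
  supported K%:R g.
Proof.
move=> gK x xK; apply/eqP; apply: contraTT xK => /gK/andP[x1 x2].
by rewrite -leNgt ler_norml x2 andbT (le_trans _ x1)// lerDr.
Qed.

Lemma supported_bounded (A : R) (g : R -> R) : continuous g -> supported A g ->
  exists C : R, forall x, `|g x| <= C.
Proof.
move=> cg gA.
have cwg : {within `[- A, A], continuous g} by exact: continuous_subspaceT.
have /compact_bounded[C [_ gC]] := continuous_compact cwg (@segment_compact R (- A) A).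
exists (`|C| + 1) => x; have [xA|xA] := leP `|x| A; last first.
  by rewrite gA// normr0 addr_ge0.
apply: gC; first by rewrite ltr_pwDr// ler_norm.
by exists x => //=; rewrite in_itv/= -ler_norml.
Qed.

Lemma scaling_regular : regular (phi W).
Proof.
have [d1 d2 _] := phi_C2 hW.
have C1phi : continuously_differentiable (phi W).
  by split => // x; apply/differentiable_continuous/derivable1_diffP.
split => //; apply: (@supported_bounded K%:R); first exact: C1_continuous.
exact/supp_of/(phi_supp hW).
Qed.

Lemma interval_fun_agree (g g' : R -> R) (gL gL' gR gR' : nat -> R -> R) j k x :
  (forall k x, (k < N)%N -> 0 <= x -> gL k x = gL' k x) ->
  (forall k x, (k < N)%N -> 0 <= x -> gR k x = gR' k x) ->
  (k < 2 ^ j)%N -> unitI x -> g (2 ^ j%:Z * x - k%:Z%:~R) = g' (2 ^ j%:Z * x - k%:Z%:~R) ->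
  interval_fun W g gL gR j k x = interval_fun W g' gL' gR' j k x.
Proof.
move=> LE RE kj; rewrite /unitI/= in_itv/= => /andP[x0 x1] gE.
have pow0 : 0 <= (2 : R) ^ j%:Z by exact: exprz_ge0.
rewrite /interval_fun; have [kN|Nk] := ltnP k N.
  by rewrite /dilate LE// mulr_ge0.
have [kj'|kj'] := ltnP k (2 ^ j - N); first by rewrite /dilate /translate gE.
rewrite /dilate RE//; first by lia.
by rewrite mulr_ge0// subr_ge0.
Qed.

(** [phi] is itself smooth and the edge functions have regular extensions, so only the interior
    wavelets are changed, on a null set. The right edge is treated as a left edge for the mirrored
    [phi]. *)
Lemma smooth_basis : exists (e : nat -> nat -> R -> R) (D : R),
  [/\ 0 < D, forall l k, regular (e l k),
    forall l k, (k < level_size W l)%N ->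
      {ae mu, forall x, unitI x -> e l k x = level_fun W l k x} &
    forall l x, \sum_(0 <= k < level_size W l) `|e l k x| <= D * 2 `^ (l%:R / 2)].
Proof.
have rphi := scaling_regular.
have phiK := supp_of (phi_supp hW); have psiK := supp_of (psi_supp hW).
have [phi_orth _ _ _] := phi_scaling hW.
have [psit [rpsi psitK psiE]] := wavelet_regular (C1_continuous rphi.1) rphi phi_orth
  phiK psiK (psi_wavelet hW).
have [pL [qL [rpL rqL pLE qLE]]] := cdv_edge_regular rphi (left_edge hW).
have rmphi : regular (mirror (phi W)).
  have := regular_affine (-1) 1 rphi.
  by congr regular; apply/funext => x; rewrite mulN1r addrC.
have [pR [qR [rpR rqR pRE qRE]]] := cdv_edge_regular rmphi (right_edge hW).
have [D1 D10 HD1] := interval_fun_sum W rphi phiK rpL rpR.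
have [D2 D20 HD2] := interval_fun_sum W rpsi psitK rqL rqR.
pose e l k := if l == 0%N then interval_fun W (phi W) pL pR j0 k
              else interval_fun W psit qL qR l k.
(* Level 0 carries scaling functions of scale [j0] while its allowance is 2^0 = 1; their factor
   2^(j0 / 2) goes into the constant. *)
exists e, (D1 * 2 `^ (j0%:R / 2) + D2); split.
- by rewrite addr_gt0// mulr_gt0// pow2_gt0.
- by move=> l k; rewrite /e; case: eqP => _; exact: interval_fun_regular.
- move=> l k; rewrite /e /level_fun.
  have [->|l0] := eqVneq l 0%N.
    move=> kj; apply: aeW => x ux.
    by rewrite /phi_jk; apply/esym/interval_fun_agree.
  have [j0l|lj0] := leqP j0 l; last first.
    by rewrite level_size_lt// lt0n l0.
  rewrite level_size_ge// => kl.
  have pow_gt0 : 0 < (2 : R) ^ l%:Z by exact: exprz_gt0.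
  have := ae_affine (- k%:Z%:~R) pow_gt0 psiE.
  apply: (@filterS _ _ (ae_filter_ringOfSetsType mu)) => x Ex ux.
  by rewrite /psi_jk; apply/esym/interval_fun_agree.
- move=> l x; rewrite /e; have [->|l0] := eqVneq l 0%N.
    rewrite level_size0 big_mkord mul0r powRr0 mulr1.
    by rewrite (le_trans (HD1 j0 x))// lerDl ltW.
  have [j0l|lj0] := leqP j0 l; last first.
    rewrite level_size_lt ?lt0n ?l0// big_geq// mulr_ge0 ?pow2_ge0//.
    by rewrite addr_ge0 ?mulr_ge0 ?pow2_ge0 ?ltW.
  rewrite level_size_ge// big_mkord (le_trans (HD2 l x))// ler_wpM2r ?pow2_ge0//.
  by rewrite lerDr mulr_ge0 ?pow2_ge0 ?ltW.
Qed.

End SmoothBasis.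

(** * Series with coefficients below an envelope *)

Section Expansion.
Context {R : realType} (W : wavelet_data R).
Local Notation mu := (@lebesgue_measure R).
Local Notation j0 := (coarse W).
Hypothesis hW : cdv_basis W.
Variables (e : nat -> nat -> R -> R) (D : R).
Hypotheses (D_gt0 : 0 < D) (e_reg : forall l k, regular (e l k)).
Hypothesis e_ae : forall l k, (k < level_size W l)%N ->
  {ae mu, forall x, unitI x -> e l k x = level_fun W l k x}.
Hypothesis e_sum : forall l x,
  \sum_(0 <= k < level_size W l) `|e l k x| <= D * 2 `^ (l%:R / 2).

Lemma ae_eq_Rintegral (E : set (measurableTypeR R)) (f g : R -> R) : measurable E ->
  measurable_fun E f -> measurable_fun E g -> {ae mu, forall x, E x -> f x = g x} ->
  \int[mu]_(x in E) f x = \int[mu]_(x in E) g x.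
Proof.
move=> mE mf mg fg; congr fine; apply: ae_eq_integral => //; try exact/measurable_EFinP.
by move: fg; apply: (@filterS _ _ (ae_filter_ringOfSetsType mu)) => x H Ex; congr EFin; exact: H.
Qed.

Lemma L2_continuous_unitI (f : R -> R) : continuous f -> L2 unitI f.
Proof.
move=> cf; apply/(L2P measurable_unitI); split.
  by apply: continuous_unitI_measurable; exact: continuous_within.
apply: (@continuous_compact_integrable R (fun x => f x ^+ 2)); first exact: segment_compact.
apply: continuous_within; rewrite (_ : (fun x => _) = fun x => f x * f x).
  by move=> x; apply: cvgM; exact: cf.
by apply/funext => x; rewrite expr2.
Qed.

Let e_cont l k : continuous (e l k) := C1_continuous (e_reg l k).1.

Lemma smooth_coef f l k : L2 unitI f -> (k < level_size W l)%N ->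
  inner unitI f (e l k) = level_coef W f l k.
Proof.
move=> fL kl; have mf := L2_measurable measurable_unitI fL.
apply: ae_eq_Rintegral => //; first exact: measurable_unitI.
- apply: measurable_funM => //.
  exact: (L2_measurable measurable_unitI (L2_continuous_unitI (@e_cont l k))).
- apply: measurable_funM => //.
  exact: (L2_measurable measurable_unitI (level_fun_L2 hW kl)).
- have := e_ae kl; apply: (@filterS _ _ (ae_filter_ringOfSetsType mu)) => x H ux.
  by rewrite H.
Qed.

Lemma smooth_norm l k : (k < level_size W l)%N -> inner unitI (e l k) (e l k) = 1.
Proof.
move=> kl; rewrite (smooth_coef (L2_continuous_unitI (@e_cont l k)) kl).
rewrite /level_coef innerC (smooth_coef (level_fun_L2 hW kl) kl).
exact: (level_fun_inner_self hW).
Qed.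

Section Series.
Variables (c : nat -> nat -> R) (s M : R).
Hypotheses (s_gt0 : 0 < s) (M_gt0 : 0 < M).
Hypothesis c_le : forall l k, (k < level_size W l)%N -> `|c l k| <= envelope s M l.

Let T l x := \sum_(0 <= k < level_size W l) c l k * e l k x.
Let q : R := 2 `^ (- s).

Let q_gt0 : 0 < q. Proof. exact: pow2_gt0. Qed.
Let q_lt1 : q < 1.
Proof. by rewrite /q powRN invf_lt1 ?pow2_gt0// pow2_gt1. Qed.

(** The envelope carries 2^(-l (s + 1/2)) and the sum of the basis functions 2^(l / 2); what is left
    is geometric of ratio q = 2^(-s). *)
Lemma level_term_le l x : `|T l x| <= D * M * q ^+ l.
Proof.
apply: (le_trans (ler_norm_sum _ _ _)).
apply: (@le_trans _ _ (\sum_(0 <= k < level_size W l) envelope s M l * `|e l k x|)).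
  rewrite big_nat [leRHS]big_nat; apply: ler_sum => k /andP[_ kl].
  by rewrite normrM ler_wpM2r// c_le.
rewrite -mulr_sumr.
apply: (le_trans (ler_wpM2l (ltW (envelope_gt0 s l M_gt0)) (e_sum l x))).
rewrite /envelope /q -powR_mulrn ?pow2_ge0// -powRrM le_eqVlt; apply/orP; left; apply/eqP.
rewrite mulrACA mulrA [M * D]mulrC -[LHS]mulrA -pow2D; congr (_ * _ `^ _).
by ring.
Qed.

Let P J x := \sum_(0 <= l < J) T l x.

Lemma partial_sum_dist J J' x : (J <= J')%N ->
  `|P J' x - P J x| <= D * M * q ^+ J / (1 - q).
Proof.
move=> JJ'; have q1 : 0 < 1 - q by rewrite subr_gt0.
rewrite /P (big_cat_nat (n := J) (p := J'))//= addrAC subrr add0r.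
have geo : \sum_(J <= l < J') D * M * q ^+ l = D * M * (q ^+ J - q ^+ J') / (1 - q).
  rewrite -mulr_sumr -[RHS]mulrA; congr (_ * _).
  apply: (mulIf (lt0r_neq0 q1)); rewrite divfK ?lt0r_neq0// mulr_suml.
  under eq_bigr do rewrite mulrBr mulr1 -exprSr.
  by rewrite -opprB -telescope_sumr// -sumrN; apply: eq_bigr => i _; rewrite opprB.
apply: (le_trans (ler_norm_sum _ _ _)).
apply: (@le_trans _ _ (\sum_(J <= l < J') D * M * q ^+ l)).
  by apply: ler_sum => l _; exact: level_term_le.
rewrite geo ler_pM2r ?invr_gt0// ler_pM2l ?mulr_gt0//.
by rewrite gerBl exprn_ge0// ltW.
Qed.

Let bound J := D * (M * 2 `^ (- (J%:R * s))) / (2 `^ s - 1).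

(** q / (1 - q) = 1 / (2^s - 1), which is the origin of the denominator in the theorem. *)
Lemma bound_geometric J : D * M * q ^+ J.+1 / (1 - q) = bound J.
Proof.
have s1 : 2 `^ s - 1 != 0 :> R by rewrite subr_eq0 gt_eqF// pow2_gt1.
have p0 : 2 `^ s != 0 :> R by rewrite gt_eqF ?pow2_gt0.
rewrite /bound exprSr.
have -> : q ^+ J = 2 `^ (- (J%:R * s)).
  by rewrite /q -powR_mulrn ?pow2_ge0// -powRrM; congr (_ `^ _); ring.
rewrite /q (powRN _ s); move: (2 `^ (- _)) => r; field.
by rewrite s1 p0.
Qed.

Lemma bound_cvg0 : bound J @[J --> \oo] --> 0.
Proof.
rewrite (_ : bound = fun J => D * M * q / (1 - q) * q ^+ J).
  rewrite -[X in _ --> X](mulr0 (D * M * q / (1 - q))).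
  by apply: cvgMl_tmp; apply: cvg_expr; rewrite ger0_norm// ltW.
by apply/funext => J; rewrite -bound_geometric exprS; ring.
Qed.

Lemma level_sum_limit : exists2 g : R -> R, continuous g &
  forall J x, `|g x - P J.+1 x| <= bound J.
Proof.
have cv x : cvgn (P ^~ x).
  have -> : P ^~ x = series (T ^~ x) by apply/funext => J; rewrite seriesEnat.
  apply: normed_cvg; apply: (@series_le_cvg _ _ (geometric (D * M) q)) => //.
  - by move=> l /=.
  - by move=> l; rewrite /geometric/= mulr_ge0 ?mulr_ge0 ?exprn_ge0 ?(ltW D_gt0)
      ?(ltW M_gt0) ?(ltW q_gt0).
  - by move=> l; exact: level_term_le.
  - by apply: is_cvg_geometric_series; rewrite ger0_norm// ltW.
have gP J x : `|limn (P ^~ x) - P J.+1 x| <= bound J.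
  apply/ler_addgt0Pl => eta eta0.
  have /cvgrPdist_le/(_ _ eta0)[J' _ HJ'] := cv x.
  rewrite -bound_geometric.
  have JJ : (J' <= maxn J' J.+1)%N by exact: leq_maxl.
  have := partial_sum_dist x (leq_maxr J' J.+1); have := HJ' _ JJ.
  set u := limn _; set v := P (maxn _ _) x; move=> H1 H2.
  by rewrite (le_trans (ler_distD v _ _))// lerD.
exists (fun x => limn (P ^~ x)) => // x.
apply/cvgrPdist_le => eta eta0.
have eta3 : 0 < eta / 3 by exact: divr_gt0.
have /cvgrPdist_le/(_ _ eta3)[J _ /(_ J (leqnn _))] := bound_cvg0.
rewrite sub0r normrN => /(le_trans (ler_norm _)) bJ.
have cP : continuous (P J.+1).
  apply: C1_continuous; have [] : regular (P J.+1) => //.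
  by apply: regular_sum => l; apply: regular_sum => k; exact: regularZ.
have /cvgrPdist_le/(_ _ eta3) := cP x.
apply: filterS => y H; have := gP J x; have := gP J y.
set u := limn _; set v := limn _ => Hy Hx.
rewrite [eta](_ : _ = eta / 3 + (eta / 3 + eta / 3)); last by field.
rewrite (le_trans (ler_distD (P J.+1 x) _ _))// lerD ?(le_trans Hx)//.
rewrite (le_trans (ler_distD (P J.+1 y) _ _))// lerD// distrC (le_trans Hy)//.
Qed.

Let PL J : L2 unitI (P J).
Proof.
apply: L2_continuous_unitI; apply: C1_continuous.
have [] : regular (P J) => //.
by apply: regular_sum => l; apply: regular_sum => k; exact: regularZ.
Qed.

Lemma partial_sum_ae J : (j0 <= J)%N -> {ae mu, forall x, unitI x ->
  P J x = \sum_(u <- indices_below W J)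
    c (level_index u).1 (level_index u).2 * basis_fun u x}.
Proof.
move=> j0J.
have ae_all : {ae mu, forall x, forall l k, (k < level_size W l)%N -> unitI x ->
    e l k x = level_fun W l k x}.
  apply: ae_foralln => l; apply: ae_foralln => k.
  have [kl|kl] := boolP (k < level_size W l)%N; last first.
    by apply: aeW => x.
  by have := e_ae kl; apply: (@filterS _ _ (ae_filter_ringOfSetsType mu)) => x H1 _.
move: ae_all; apply: (@filterS _ _ (ae_filter_ringOfSetsType mu)) => x H1 ux.
under eq_bigr do rewrite (basis_funE hW).
rewrite (sum_indices_below hW (fun l k => c l k * level_fun W l k x))//.
apply: eq_bigr => l _; apply: eq_big_nat => k /andP[_ kl].
by rewrite H1.
Qed.

Let combL J : L2 unitI (fun x => \sum_(u <- indices_below W J)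
  c (level_index u).1 (level_index u).2 * basis_fun u x).
Proof.
apply: L2_sum; first exact: measurable_unitI.
by move=> u; apply: L2Z; [exact: measurable_unitI|exact: (interval_basis hW).1.1].
Qed.

(** Partial sums beyond level [l] have exactly the coefficient [c l k]; uniform convergence and
    integrability of the basis function pass this to the limit. *)
Lemma level_sum_coef (g : R -> R) : continuous g ->
  (forall J x, `|g x - P J.+1 x| <= bound J) ->
  forall l k, (k < level_size W l)%N -> level_coef W g l k = c l k.
Proof.
move=> gc gP l k kl; have gL := L2_continuous_unitI gc.
have [u ul] := level_indexP hW kl.
have bL : L2 unitI (basis_fun u) by exact: (interval_basis hW).1.1.
have -> : level_coef W g l k = inner unitI g (basis_fun u) by rewrite (basis_funE hW) ul.
have PJu J : (maxn j0 l < J)%N -> inner unitI (P J) (basis_fun u) = c l k.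
  rewrite gtn_max => /andP[j0J lJ].
  have := inner_comb measurable_unitI (interval_basis hW).1
    (fun v => c (level_index v).1 (level_index v).2) u (indices_below_uniq W J).
  rewrite (mem_indices_below hW) ul//= => <-; apply: ae_eq_Rintegral.
  - exact: measurable_unitI.
  - apply: measurable_funM; [exact: (L2_measurable measurable_unitI (PL J))|].
    exact: (L2_measurable measurable_unitI bL).
  - apply: measurable_funM; [exact: (L2_measurable measurable_unitI (combL J))|].
    exact: (L2_measurable measurable_unitI bL).
  - have := partial_sum_ae (ltnW j0J).
    by apply: (@filterS _ _ (ae_filter_ringOfSetsType mu)) => x H ux; rewrite H.
have int1 (h : R -> R) : L2 unitI h -> mu.-integrable unitI (fun x => (h x)%:E).
  move=> hL; have L1 : L2 unitI (fun=> 1 : R).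
    by apply: L2_continuous_unitI => x; exact: cvg_cst.
  have := L2_integrableM measurable_unitI hL L1.
  by apply: eq_integrable => [|x _]; [exact: measurable_unitI|rewrite mulr1].
pose I1 := \int[mu]_(x in unitI) `|basis_fun u x|.
have I10 : 0 <= I1 by exact: Rintegral_ge0.
apply/eqP; rewrite -subr_eq0 -normr_le0; apply/ler_addgt0Pl => eta eta0; rewrite addr0.
have ei : 0 < eta / (I1 + 1) by rewrite divr_gt0// ltr_wpDl.
have /cvgrPdist_le/(_ _ ei)[J1 _ HJ1] := bound_cvg0.
pose J := maxn J1 (maxn j0 l).+1.
have bJ : bound J <= eta / (I1 + 1).
  have := HJ1 J (leq_maxl _ _); rewrite sub0r normrN; apply: le_trans; exact: ler_norm.
rewrite -(PJu J.+1); last by rewrite leqW// leq_maxr.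
have -> : inner unitI g (basis_fun u) - inner unitI (P J.+1) (basis_fun u) =
    \int[mu]_(x in unitI) (g x * basis_fun u x - P J.+1 x * basis_fun u x).
  by rewrite RintegralB//; [exact: measurable_unitI|exact: (L2_integrableM measurable_unitI)|
    exact: (L2_integrableM measurable_unitI)].
have intd := integrableB measurable_unitI (L2_integrableM measurable_unitI gL bL)
  (L2_integrableM measurable_unitI (PL J.+1) bL).
apply: (le_trans (le_normr_Rintegral measurable_unitI intd)).
apply: (@le_trans _ _ (\int[mu]_(x in unitI) (bound J * `|basis_fun u x|))).
  apply: le_Rintegral.
  - exact: measurable_unitI.
  - exact: (integrable_norm intd).
  - exact: (integrableZl measurable_unitI (bound J) (integrable_norm (int1 _ bL))).
  - by move=> x _; rewrite -mulrBl normrM ler_wpM2r.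
rewrite RintegralZl; [|exact: measurable_unitI|exact: (integrable_norm (int1 _ bL))].
apply: (@le_trans _ _ (eta / (I1 + 1) * I1)); first by rewrite ler_wpM2r.
by rewrite mulrAC ler_pdivrMr ?ltr_wpDl// ler_pM2l// lerDl.
Qed.

Lemma level_sum_realization : exists2 g : R -> R, L2 unitI g &
  forall l k, (k < level_size W l)%N -> level_coef W g l k = c l k.
Proof.
have [g gc gP] := level_sum_limit; exists g; first exact: L2_continuous_unitI.
exact: level_sum_coef.
Qed.

(** The continuous limit [g] and [f] have the same coefficients, so by completeness g - f is almost
    everywhere an empty sum. *)
Lemma level_sum_expansion (f : R -> R) : L2 unitI f ->
  (forall l k, (k < level_size W l)%N -> level_coef W f l k = c l k) ->
  exists g : R -> R, [/\ continuous g,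
  {ae mu, forall x, unitI x -> g x = f x} &
  forall J x, `|g x - \sum_(0 <= l < J.+1) \sum_(0 <= k < level_size W l)
     c l k * e l k x| <= D * (M * 2 `^ (- (J%:R * s))) / (2 `^ s - 1)].
Proof.
move=> fL fc; have [g gc gP] := level_sum_limit; exists g; split => //.
have gL := L2_continuous_unitI gc.
suff : {ae mu, forall x, unitI x -> g x - f x = 0}.
  apply: (@filterS _ _ (ae_filter_ringOfSetsType mu)) => x H /H/eqP.
  by rewrite subr_eq0 => /eqP.
have hL := L2B measurable_unitI gL fL.
have hspan : closed_span unitI (@basis_fun R W) (fun x => g x - f x).
  by rewrite (interval_basis hW).2.
have := closed_span_ae measurable_unitI (interval_basis hW).1 hspan (isT : uniq [::]).
move=> /(_ _)[u _|A [mA A0 HA]].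
  have gu := level_sum_coef gc gP (level_index_size hW u).
  have fu := fc _ _ (level_index_size hW u).
  have bL : L2 unitI (basis_fun u) by exact: (interval_basis hW).1.1.
  have -> : inner unitI (fun x => g x - f x) (basis_fun u) =
      inner unitI g (basis_fun u) - inner unitI f (basis_fun u).
    rewrite -RintegralB; [|exact: measurable_unitI|exact: (L2_integrableM measurable_unitI)|
      exact: (L2_integrableM measurable_unitI)].
    by apply: eq_Rintegral => x _; rewrite mulrBl.
  by move: gu fu; rewrite /level_coef -(basis_funE hW) => -> ->; rewrite subrr.
exists A; split => // x /= H; apply: HA => /= H'; apply: H => ux.
by rewrite H'// big_nil.
Qed.

End Series.

Lemma expansion (f : R -> R) (s M : R) : 0 < s -> 0 < M -> Cs_ball W s M f ->
  exists g : R -> R, [/\ continuous g,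
  {ae mu, forall x, unitI x -> g x = f x} &
  forall J x, `|g x - \sum_(0 <= l < J.+1) \sum_(0 <= k < level_size W l)
     level_coef W f l k * e l k x| <= D * (M * 2 `^ (- (J%:R * s))) / (2 `^ s - 1)].
Proof.
move=> s0 M0 [fL /(Cs_norm_le hW) fc].
exact: (level_sum_expansion s0 M0 fc fL).
Qed.

(* Over an empty class the supremum of probabilities would be -oo, not 0. *)
Lemma self_similar_nonempty (smax eps : R) (rho : nat) (s M : R) :
  0 < s -> 0 < M -> 0 < eps < 1 -> (0 < rho)%N ->
  exists f, self_similar W smax eps rho s M f.
Proof.
move=> s0 M0 /andP[eps0 eps1] rho0.
(* One coefficient per level sits exactly on the envelope, so every block has norm at least M > eps
   M. *)
pose c (l k : nat) := if (k == 0%N) && (j0 <= l)%N then envelope s M l else 0.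
have cle l k : (k < level_size W l)%N -> `|c l k| <= envelope s M l.
  move=> _; rewrite /c; case: ifP => _; first by rewrite gtr0_norm// envelope_gt0.
  by rewrite normr0 ltW// envelope_gt0.
have [f fL fc] := level_sum_realization s0 M0 cle.
exists f; split.
  by split => //; apply/(Cs_norm_le hW) => l k kl; rewrite fc// cle.
move=> j j0j _; rewrite leNgt; apply/negP => /ltW/(Cs_norm_le hW)/(_ j 0%N).
have jr : (j <= rho * j)%N by rewrite leq_pmull.
rewrite level_size_ge// expn_gt0 => /(_ isT).
rewrite (detail_coef hW) ?leqW// ?level_size_ge// ?expn_gt0// leqnn jr orbT.
rewrite fc ?level_size_ge// ?expn_gt0// /c eqxx j0j/= gtr0_norm ?envelope_gt0//.
have -> : envelope s (eps * M) j = eps * envelope s M j by rewrite /envelope mulrA.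
by rewrite leNgt gtr_pMl ?envelope_gt0// eps1.
Qed.

End Expansion.

(** * Thresholding and the band *)

Section Thresholding.
Context {R : realType}.

Definition threshold (tau b : R) : R := if 2 * tau < `|b| then b else 0.

(** A kept coefficient has |a| > 2 tau, so |c| > tau bounds its error; a discarded one has error |c|
    <= 3 tau. The first bound is used at coarse levels, the second at fine ones. *)
Lemma threshold_error (tau a c : R) : `|a - c| <= tau ->
  `|c - threshold tau a| <= 3 * tau /\ `|c - threshold tau a| <= `|c|.
Proof.
move=> ac; rewrite /threshold.
have t0 : 0 <= tau by apply: le_trans ac.
have H1 := ler_normB a (a - c); have H2 := ler_normD (a - c) c.
rewrite subrK in H2; rewrite opprB addrCA subrr addr0 in H1.
case: ifPn => [ta|]; last by rewrite -leNgt subr0 => ta; split => //; lra.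
by rewrite distrC; split; lra.
Qed.

Lemma sum_pow2_half (j : nat) : \sum_(0 <= l < j.+1) 2 `^ (l%:R / 2) <= 4 * 2 `^ (j%:R / 2) :> R.
Proof.
elim: j => [|j IH]; first by rewrite big_nat1 mul0r powRr0 mulr1 ler1n.
rewrite big_nat_recr//= -[j.+1%:R]natr1 mulrDl pow2D mul1r.
set r := 2 `^ (2^-1) : R; set p := 2 `^ (j%:R / 2) : R in IH *.
have p0 : 0 < p by exact: pow2_gt0.
have r2 : r * r = 2 by rewrite -pow2D (_ : 2^-1 + 2^-1 = 1) ?powRr1//; field.
have r0 : 0 < r by exact: pow2_gt0.
(* The induction step, 4 p + r p <= 4 r p, amounts to r >= 4 / 3. *)
have r43 : 4 / 3 <= r by nra.
apply: le_trans (lerD IH (lexx _)) _; nra.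
Qed.

Lemma geometric_tail (s : R) (j J : nat) : 0 < s -> (j <= J)%N ->
  \sum_(j.+1 <= l < J.+1) 2 `^ (- (l%:R * s)) + 2 `^ (- (J%:R * s)) / (2 `^ s - 1) =
  2 `^ (- (j%:R * s)) / (2 `^ s - 1).
Proof.
move=> s0; have s1 : 2 `^ s - 1 != 0 :> R by rewrite subr_eq0 gt_eqF// pow2_gt1.
elim: J => [|J IH]; first by rewrite leqn0 => /eqP ->; rewrite big_geq// add0r.
rewrite leq_eqVlt => /predU1P[->|jJ]; first by rewrite big_geq// add0r.
rewrite -IH//; rewrite big_nat_recr//= -addrA; congr (_ + _).
have -> : - (J%:R * s) = - (J.+1%:R * s) + s by rewrite -[J.+1%:R]natr1; ring.
by rewrite pow2D; field.
Qed.

Lemma error_bound_le (D tau s M s' M' : R) j : 0 < D -> 0 < s' -> s' <= s ->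
  0 < M -> M <= M' -> error_bound D tau s M j <= error_bound D tau s' M' j.
Proof.
move=> D0 s'0 ss M0 MM; rewrite /error_bound lerD2l.
have s'1 : 0 < 2 `^ s' - 1 :> R by rewrite subr_gt0 pow2_gt1.
have s1 : 0 < 2 `^ s - 1 :> R by rewrite subr_gt0 pow2_gt1// (lt_le_trans s'0).
apply: ler_pM.
- by rewrite !mulr_ge0 ?pow2_ge0// ltW.
- by rewrite invr_ge0 ltW.
- rewrite ler_pM2l//; apply: ler_pM => //; first exact: ltW.
  by rewrite ler_pow2 lerN2 ler_wpM2l.
- by rewrite lef_pV2 ?posrE// lerD2r ler_pow2.
Qed.

Lemma error_bound_ge0 (D tau s M : R) j : 0 < D -> 0 <= tau -> 0 < s -> 0 < M ->
  0 <= error_bound D tau s M j.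
Proof.
move=> D0 tau0 s0 M0.
have s1 : 0 < 2 `^ s - 1 :> R by rewrite subr_gt0 pow2_gt1.
apply: addr_ge0; first by rewrite !mulr_ge0 ?pow2_ge0// ltW.
by rewrite !mulr_ge0 ?invr_ge0 ?pow2_ge0 ?(ltW D0) ?(ltW M0) ?(ltW s1).
Qed.

(** The index [j] is free: thresholding does not know it. Up to [j] each error is at most 3 tau;
    between [j] and [J] it is at most the envelope; beyond [J] the series is truncated. The last two
    contributions add up to the geometric tail after [j]. *)
Lemma thresholding_bound (cnt : nat -> nat) (e : nat -> nat -> R -> R) (D : R)
    (c a : nat -> nat -> R) (tau s M x gx : R) (J j : nat) :
  0 < D -> 0 < s -> 0 < M -> 0 <= tau -> (j <= J)%N ->
  (forall l, \sum_(0 <= k < cnt l) `|e l k x| <= D * 2 `^ (l%:R / 2)) ->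
  (forall l k, (k < cnt l)%N -> `|c l k| <= envelope s M l) ->
  (forall l k, (l <= J)%N -> (k < cnt l)%N -> `|a l k - c l k| <= tau) ->
  `|gx - \sum_(0 <= l < J.+1) \sum_(0 <= k < cnt l) c l k * e l k x| <=
    D * (M * 2 `^ (- (J%:R * s))) / (2 `^ s - 1) ->
  `|gx - \sum_(0 <= l < J.+1) \sum_(0 <= k < cnt l) threshold tau (a l k) * e l k x|
    <= error_bound D tau s M j.
Proof.
move=> D0 s0 M0 tau0 jJ e_le c_le ac gE.
set S := \sum_(0 <= l < J.+1) _ in gE *; set A := \sum_(0 <= l < J.+1) _.
pose d l := \sum_(0 <= k < cnt l) (c l k - threshold tau (a l k)) * e l k x.
have SA : S - A = \sum_(0 <= l < j.+1) d l + \sum_(j.+1 <= l < J.+1) d l.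
  rewrite -big_cat_nat//= -sumrB; apply: eq_bigr => l _.
  by rewrite -sumrB; apply: eq_bigr => k _; rewrite mulrBl.
have d_le (l : nat) (B : R) : 0 <= B ->
    (forall k, (k < cnt l)%N -> `|c l k - threshold tau (a l k)| <= B) ->
    `|d l| <= B * (D * 2 `^ (l%:R / 2)).
  move=> B0 HB; apply: (le_trans (ler_norm_sum _ _ _)).
  apply: (@le_trans _ _ (B * \sum_(0 <= k < cnt l) `|e l k x|)); last exact: ler_wpM2l.
  rewrite mulr_sumr big_nat [leRHS]big_nat; apply: ler_sum => k /andP[_ kl].
  by rewrite normrM ler_wpM2r// HB.
(* 12 is 3 for a single thresholding error times 4 for the geometric sum of 2^(l / 2). *)
have low : `|\sum_(0 <= l < j.+1) d l| <= 12 * D * tau * 2 `^ (j%:R / 2).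
  apply: (le_trans (ler_norm_sum _ _ _)).
  apply: (@le_trans _ _ (\sum_(0 <= l < j.+1) 3 * tau * D * 2 `^ (l%:R / 2))).
    rewrite big_nat [leRHS]big_nat; apply: ler_sum => l /andP[_ lj].
    rewrite -mulrA; apply: d_le; first by rewrite mulr_ge0.
    move=> k kl; have [] // := threshold_error (ac l k _ kl).
    by apply: leq_trans jJ; rewrite -ltnS.
  rewrite -mulr_sumr.
  have -> : 12 * D * tau * 2 `^ (j%:R / 2) = 3 * tau * D * (4 * 2 `^ (j%:R / 2)) by ring.
  by rewrite ler_wpM2l ?sum_pow2_half// mulr_ge0 ?(ltW D0)// mulr_ge0.
have high : `|\sum_(j.+1 <= l < J.+1) d l| <=
    D * M * \sum_(j.+1 <= l < J.+1) 2 `^ (- (l%:R * s)).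
  apply: (le_trans (ler_norm_sum _ _ _)); rewrite mulr_sumr.
  rewrite big_nat [leRHS]big_nat; apply: ler_sum => l /andP[_ lJ].
  have -> : D * M * 2 `^ (- (l%:R * s)) = envelope s M l * (D * 2 `^ (l%:R / 2)).
    rewrite /envelope mulrACA -pow2D [M * D]mulrC; congr (_ * _ `^ _); ring.
  apply: d_le; first exact/ltW/envelope_gt0.
  move=> k kl; apply: le_trans (c_le l k kl).
  by have [] := threshold_error (ac l k lJ kl).
have -> : gx - A = (gx - S) + (S - A) by rewrite addrA subrK.
rewrite (le_trans (ler_normD _ _))// SA.
rewrite (le_trans (lerD gE (ler_normD _ _)))//.
rewrite (le_trans (lerD (lexx _) (lerD low high)))//.
rewrite /error_bound addrCA lerD2l.
have -> : D * (M * 2 `^ (- (j%:R * s))) / (2 `^ s - 1) =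
    D * M * (2 `^ (- (j%:R * s)) / (2 `^ s - 1)) by ring.
rewrite -(geometric_tail s0 jJ) mulrDr addrC.
by rewrite (_ : D * (M * _) / _ = D * M * (2 `^ (- (J%:R * s)) / (2 `^ s - 1)))//; ring.
Qed.

End Thresholding.

(** * A countable grid of parameters *)

Section ParameterGrid.
Context {R : realType} (smax : R).
Hypothesis smax_gt0 : 0 < smax.

(** The minimum places [smax] itself on the grid; the definition of self-similarity changes there,
    so this value must be matched exactly. *)
Definition grid_s (a b : nat) : R := Num.min smax (a.+1%:R / b.+1%:R).
Definition grid_M (a b : nat) : R := a.+1%:R / b.+1%:R.

Lemma grid_s_gt0 a b : 0 < grid_s a b.
Proof. by rewrite /grid_s lt_min smax_gt0 divr_gt0. Qed.

Lemma grid_M_gt0 a b : 0 < grid_M a b.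
Proof. by rewrite divr_gt0. Qed.

(** The precision needed, J (s - s') <= 1, increases with the number of levels; all positive
    fractions are available, so the denominator can follow [J]. *)
Lemma grid_s_near (s : R) (J : nat) : 0 < s <= smax -> exists a b,
  [/\ grid_s a b <= s, 2 `^ (J%:R * (s - grid_s a b)) <= 2 &
      grid_s a b < smax -> s < smax].
Proof.
case/andP => s0; rewrite le_eqVlt => /predU1P[->|ss].
  exists (Num.bound smax), 0%N; have -> : grid_s (Num.bound smax) 0 = smax.
    rewrite /grid_s divr1; apply/min_idPl/ltW.
    by apply: (lt_le_trans (archi_boundP (ltW smax_gt0))); rewrite ler_nat.
  by rewrite lexx subrr mulr0 powRr0 ler1n ltxx.
(* The summand [J] gives the precision 1 / J, and the bound on 1 / s keeps the numerator
   positive. *)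
pose b := (Num.bound (s^-1) + J)%N.
have b0 : (0 : R) < b.+1%:R by [].
have sb1 : 1 <= s * b.+1%:R.
  rewrite -ler_pdivrMl// mulr1; apply/ltW/(lt_le_trans (archi_boundP _)).
    by rewrite invr_ge0 ltW.
  by rewrite ler_nat leqW// leq_addr.
have sb0 : 0 <= s * b.+1%:R by rewrite mulr_ge0// ltW.
have /andP[tl tu] := truncn_itv sb0.
have t0 : (0 < Num.truncn (s * b.+1%:R))%N by rewrite truncn_gt0.
exists (Num.truncn (s * b.+1%:R)).-1, b; rewrite /grid_s prednK//.
set t := _ / b.+1%:R.
have ts : t <= s by rewrite ler_pdivrMr.
have st : s - t <= b.+1%:R^-1.
  rewrite lerBlDr -[X in X + _]mul1r -mulrDl ler_pdivlMr//.
  by rewrite addrC natr1 ltW.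
have -> : Num.min smax t = t by apply/min_idPr; rewrite (le_trans ts)// ltW.
split => //; rewrite -[leRHS]powRr1// ler_pow2.
apply: (@le_trans _ _ (J%:R * b.+1%:R^-1)); first exact: ler_wpM2l.
by rewrite ler_pdivrMr// mul1r ler_nat leqW// leq_addl.
Qed.

Lemma grid_M_near (M : R) : 0 < M -> exists a b, M <= grid_M a b <= 2 * M.
Proof.
move=> M0; pose b := Num.bound (M^-1).
have b0 : (0 : R) < b.+1%:R by [].
have Mb : 1 <= M * b.+1%:R.
  rewrite -ler_pdivrMl// mulr1; apply/ltW/(lt_le_trans (archi_boundP _)).
    by rewrite invr_ge0 ltW.
  by rewrite ler_nat.
have /andP[tl tu] := truncn_itv (le_trans ler01 Mb).
exists (Num.truncn (M * b.+1%:R)), b; rewrite /grid_M ler_pdivlMr// ler_pdivrMr//.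
by rewrite (ltW tu)/= -[X in X <= _]natr1 -mulrA mulr_natl mulr2n lerD.
Qed.

End ParameterGrid.

(** * Bands, continuous versions and measurability *)

Section Bands.
Context {R : realType}.
Local Notation mu := (@lebesgue_measure R).
Implicit Types (f g h c : R -> R).

Lemma within_continuousB g h : {within unitI, continuous g} ->
  {within unitI, continuous h} -> {within unitI, continuous (fun x => g x - h x)}.
Proof. by move=> cg ch x; apply: cvgB; [exact: cg|exact: ch]. Qed.

Lemma within_continuous_near h (x : R) (eta : R) : {within unitI, continuous h} ->
  unitI x -> 0 < eta ->
  exists2 r : R, 0 < r & forall y, unitI y -> `|x - y| < r -> `|h x - h y| < eta.
Proof.
move=> ch ux eta0.
have [r r0 H] := compact_uniform_continuity (@segment_compact R 0 1) ch eta0.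
by exists r => // y uy xy; exact: H.
Qed.

(** A discrepancy at one point persists, by continuity, on a nondegenerate interval, which is not a
    null set. *)
Lemma continuous_ae_unique g h : {within unitI, continuous g} ->
  {within unitI, continuous h} -> {ae mu, forall x, unitI x -> g x = h x} ->
  forall x, unitI x -> g x = h x.
Proof.
move=> cg ch [A [mA A0 gA]] x ux; apply/eqP; apply: contraT => gh.
have d0 : 0 < `|g x - h x| by rewrite normr_gt0 subr_eq0.
have [r r0 rP] := within_continuous_near (within_continuousB cg ch) ux d0.
have neq y : unitI y -> `|x - y| < r -> g y != h y.
  move=> uy /(rP y uy); apply: contraTneq => ->.
  by rewrite subrr subr0 ltxx.
move: (ux); rewrite /unitI/= in_itv/= => /andP[x0 x1].
pose u := Num.max 0 (x - r / 2); pose v := Num.min 1 (x + r / 2).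
have r2 : 0 < r / 2 by exact: divr_gt0.
have uv : u < v.
  rewrite /u /v gt_max !lt_min ltr01 /=; apply/and3P; split.
  - by rewrite ltr_wpDl.
  - by rewrite ltrBlDr (le_lt_trans x1)// ltrDl.
  - by rewrite ltrBlDr -addrA ltrDl addr_gt0.
have uvA : `[u, v] `<=` A.
  move=> y; rewrite /= in_itv/= /u /v ge_max le_min.
  move=> /andP[/andP[y0 xy] /andP[y1 yx]].
  apply: gA => /= H; have uy : unitI y by rewrite /unitI/= in_itv/= y0 y1.
  have : `|x - y| < r.
    rewrite (@le_lt_trans _ _ (r / 2))//; last by rewrite ltr_pdivrMr// ltr_pMr// ltr1n.
    by rewrite ler_norml; lra.
  by move=> /(neq y uy)/eqP; apply; exact: H.
have : (mu `[u, v] <= mu A)%E.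
  by apply: le_measure => //; rewrite inE//; exact: measurable_itv.
by rewrite A0 lebesgue_measure_itv/= lte_fin uv -EFinB lee_fin subr_le0 leNgt uv.
Qed.

Lemma grid_dense (x r : R) : unitI x -> 0 < r ->
  exists m i, (i <= m.+1)%N /\ `|x - grid m i| < r.
Proof.
rewrite /unitI/= in_itv/= => /andP[x0 x1] r0.
pose m := Num.bound r^-1; have m0 : (0 : R) < m.+1%:R by [].
have mr : m.+1%:R^-1 < r.
  rewrite invf_plt ?posrE//; apply: (lt_le_trans (archi_boundP _)).
    by rewrite invr_ge0 ltW.
  by rewrite ler_nat.
have xm0 : 0 <= x * m.+1%:R by rewrite mulr_ge0.
have /andP[tl tu] := truncn_itv xm0.
exists m, (Num.truncn (x * m.+1%:R)); split.
  by rewrite -(ler_nat R) (le_trans tl)// ler_piMl.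
apply: le_lt_trans mr; rewrite /grid ger0_norm; last by rewrite subr_ge0 ler_pdivrMr.
rewrite lerBlDr -[X in X + _]mul1r -mulrDl ler_pdivlMr//.
by rewrite addrC natr1 ltW.
Qed.

Lemma sup_norm_grid h (r : \bar R) : {within unitI, continuous h} ->
  (sup_norm h <= r)%E <->
  forall m i, (i <= m.+1)%N -> (`|h (grid m i)|%:E <= r)%E.
Proof.
move=> ch; split=> [hr m i im|H].
  apply: le_trans hr; apply: ereal_sup_ubound; exists (grid m i) => //.
  exact: unitI_grid.
apply: ge_ereal_sup => _ [x ux <-].
apply/lee_addgt0Pr => eta eta0.
have [d d0 dP] := within_continuous_near ch ux eta0.
have [m [i [im xi]]] := grid_dense ux d0.
have := dP _ (unitI_grid im) xi => /ltW hd.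
apply: (@le_trans _ _ (`|h (grid m i)|%:E + eta%:E)%E); last first.
  by rewrite leeD2r// H.
rewrite -EFinD lee_fin -lerBlDl (le_trans (lerB_dist _ _))//.
Qed.

(** Coverage is reduced to countably many inequalities at rational points, from which the
    measurability of the non-coverage event follows. *)
Lemma in_bandP f g c (r : \bar R) : continuous g ->
  {ae mu, forall x, unitI x -> g x = f x} -> {within unitI, continuous c} ->
  in_band f (band c r) <->
  forall m i, (i <= m.+1)%N -> (`|g (grid m i) - c (grid m i)|%:E <= r)%E.
Proof.
move=> gc gf cc; have gw := continuous_within gc.
split=> [[g' [[g'c g'r] g'f]]|H].
  have gg' : forall x, unitI x -> g x = g' x.
    apply: continuous_ae_unique => //.
    have := @filterI _ _ (ae_filter_ringOfSetsType mu) _ _ gf g'f.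
    apply: (@filterS _ _ (ae_filter_ringOfSetsType mu)) => x [H1 H2] ux.
    by rewrite H1// H2.
  move=> m i im; rewrite gg'; last exact: unitI_grid.
  by have /sup_norm_grid := g'r; apply => //; exact: within_continuousB.
exists g; split => //; split => //.
by apply/sup_norm_grid => //; exact: within_continuousB.
Qed.

Lemma in_band_le f g c (r : \bar R) : continuous g ->
  {ae mu, forall x, unitI x -> g x = f x} ->
  (forall x, unitI x -> (`|g x - c x|%:E <= r)%E) -> in_band f (band c r).
Proof.
move=> gc gf H; exists g; split => //; split; first exact: continuous_within.
by apply: ge_ereal_sup => _ [x ux <-]; exact: H.
Qed.

Lemma measurable_noncoverage d (T : measurableType d) (c : T -> R -> R)
    (r : T -> \bar R) f g : continuous g ->
  {ae mu, forall x, unitI x -> g x = f x} ->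
  (forall w, {within unitI, continuous (c w)}) ->
  (forall x, unitI x -> measurable_fun setT (fun w => c w x)) ->
  measurable_fun setT r ->
  measurable [set w | ~ in_band f (band (c w) (r w))].
Proof.
move=> gc gf cc mc mr.
rewrite (_ : [set w | _] = ~` \bigcap_m \bigcap_(i in [set i | (i <= m.+1)%N])
    (setT `&` [set w | (`|g (grid m i) - c w (grid m i)|%:E <= r w)%E])); last first.
  apply/seteqP; split => w /=.
    move=> nb H; apply: nb; apply/(in_bandP _ gc gf (cc w)) => m i im.
    by have [] := H m I i im.
  move=> nH b; apply: nH => m _ i im; split => //=.
  exact: ((in_bandP _ gc gf (cc w)).1 b).
apply: measurableC; apply: bigcap_measurableType => m _.
apply: bigcap_measurableType => i im; apply: measurable_lee => //.
apply/measurable_EFinP; apply: measurableT_comp => //; apply: measurable_funB => //.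
by apply: mc; exact: unitI_grid.
Qed.

End Bands.

(** * The centre and the radius as functions of the data *)

Section Statistics.
Context {R : realType} (W : wavelet_data R).
Local Notation j0 := (coarse W).
Local Notation size := (level_size W).
Variables (e : nat -> nat -> R -> R) (D smax eps : R) (rho : nat).
Hypothesis e_reg : forall l k, regular (e l k).
Hypotheses (D_gt0 : 0 < D) (smax_gt0 : 0 < smax).

Definition empirical_coef (y : R -> R) (l k : nat) : R := wiener_integral (e l k) y.

Definition band_center (n : nat) (y : R -> R) (x : R) : R :=
  \sum_(0 <= l < (trunc_log 2 n).+1) \sum_(0 <= k < size l)
    threshold (noise_level n) (empirical_coef y l k) * e l k x.

(* Numbers that code no quadruple stand for (0, 0, 0, 0). *)
Definition grid_param (i : nat) : nat * nat * nat * nat :=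
  odflt (0, 0, 0, 0)%N (unpickle i).

Definition param_s (i : nat) : R :=
  let: (a, b, _, _) := grid_param i in grid_s smax a b.

Definition param_M (i : nat) : R :=
  let: (_, _, a, b) := grid_param i in grid_M a b.

(** The starting value of the minimum is the term [j = 0], which belongs to the range anyway. *)
Definition oracle_radius (n : nat) (s M : R) : R :=
  \big[Num.min/error_bound D (noise_level n) s M 0]_(j < (trunc_log 2 n).+1)
    error_bound D (noise_level n) s M j.

Definition consistent_set (n i : nat) : set (data_path R) :=
  [set y | consistent size smax rho j0 (empirical_coef y) (noise_level n) (eps / 8)
    (trunc_log 2 n) (param_s i) (param_M i)].

(** [esups] at 0 is the supremum over all indices. The indicator lets an excluded pair contribute 0,
    so that a data-dependent index set becomes a countable supremum of measurable functions. *)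
Definition band_radius (n : nat) (y : data_path R) : \bar R :=
  esups (fun i => (oracle_radius n (param_s i) (param_M i) *
                   \1_(consistent_set n i) y)%:E) 0%N.

Lemma param_s_gt0 i : 0 < param_s i.
Proof. by rewrite /param_s; case: grid_param => [[[a b] c] d]; exact: grid_s_gt0. Qed.

Lemma param_M_gt0 i : 0 < param_M i.
Proof. by rewrite /param_M; case: grid_param => [[[a b] c] d]; exact: grid_M_gt0. Qed.

Lemma noise_level_ge0 n : 0 <= noise_level n :> R.
Proof. by rewrite mulr_ge0// sqrtr_ge0. Qed.

Lemma oracle_radius_ge0 n s M : 0 < s -> 0 < M -> 0 <= oracle_radius n s M.
Proof.
move=> s0 M0; apply/bigmin_geP; split => [|j _];
  by apply: error_bound_ge0 => //; exact: noise_level_ge0.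
Qed.

Lemma band_radius_ge n i y : consistent_set n i y ->
  ((oracle_radius n (param_s i) (param_M i))%:E <= band_radius n y)%E.
Proof.
move=> ci; apply: ereal_sup_ubound; exists i => //=.
by rewrite indicE mem_set// mulr1.
Qed.

Lemma band_radius_le n y (B : R) : 0 <= B ->
  (forall i, consistent_set n i y -> oracle_radius n (param_s i) (param_M i) <= B) ->
  (band_radius n y <= B%:E)%E.
Proof.
move=> B0 H; apply: ge_ereal_sup => _ [i _ <-]; rewrite lee_fin indicE.
have [/set_mem ci|_] := boolP (y \in _); last by rewrite mulr0.
by rewrite mulr1 H.
Qed.

Lemma band_center_continuous n y : continuous (band_center n y).
Proof.
apply: C1_continuous; have [] : regular (band_center n y) => //.
by apply: regular_sum => l; apply: regular_sum => k; exact: regularZ.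
Qed.

Lemma measurable_empirical_coef l k :
  measurable_fun [set: data_path R] (fun y : data_path R => empirical_coef y l k).
Proof. exact: measurable_wiener_integral. Qed.

Lemma measurable_threshold (tau : R) : measurable_fun setT (threshold tau).
Proof.
rewrite (_ : threshold tau = fun b => b * \1_(~` (setT `&` [set b : R | `|b| <= 2 * tau])) b).
  apply: measurable_funM => //; apply: measurable_indic; apply: measurableC.
  by apply: measurable_fun_le => //; exact: measurableT_comp.
apply/funext => b; rewrite setTI indicE /threshold ltNge.
have [bt|bt] := boolP (`|b| <= 2 * tau).
  by rewrite memNset ?mulr0//= => /(_ bt).
by rewrite mem_set ?mulr1//=; exact/negP.
Qed.

Lemma measurable_band_center n x :
  measurable_fun [set: data_path R] (fun y : data_path R => band_center n y x).
Proof.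
apply: measurable_sum => l; apply: measurable_sum => k; apply: measurable_funM => //.
exact: (measurableT_comp (measurable_threshold _) (measurable_empirical_coef l k)).
Qed.

Lemma measurable_large_coefficient tau q s M p p' :
  measurable [set y : data_path R |
    large_coefficient size (empirical_coef y) tau q s M p p'].
Proof.
rewrite (_ : [set y | _] = \bigcup_l \bigcup_(k in [set k | (p <= l <= p')%N /\ (k < size l)%N])
    (setT `&` [set y | q * envelope s M l <= `|empirical_coef y l k| + tau])).
  apply: bigcup_measurable => l _; apply: bigcup_measurable => k _.
  apply: measurable_fun_le => //; apply: measurable_funD => //.
  by apply: measurableT_comp => //; exact: measurable_empirical_coef.
apply/seteqP; split => y /=.
  by move=> [l [k [pl kl H]]]; exists l => //; exists k.
by move=> [l _ [k [pl kl] [_ H]]]; exists l, k.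
Qed.

Lemma measurable_consistent_set n i : measurable (consistent_set n i).
Proof.
rewrite /consistent_set; set s := param_s i; set M := param_M i.
set J := trunc_log 2 n; set tau := noise_level n.
pose A := \bigcap_(l in [set l | (l <= J)%N]) \bigcap_(k in [set k | (k < size l)%N])
  (setT `&` [set y : data_path R | `|empirical_coef y l k| <= envelope s M l + tau]).
pose C := \bigcap_(j in [set j | [/\ s < smax, (j0 < j)%N & (rho * j <= J)%N]])
  [set y : data_path R | large_coefficient size (empirical_coef y) tau (eps / 8) s M j (rho * j)].
rewrite (_ : [set y | _] = A `&` [set y : data_path R |
    large_coefficient size (empirical_coef y) tau (eps / 8) s M 0 (rho * j0)] `&` C).
  apply: measurableI; last first.
    by apply: bigcap_measurableType => j _; exact: measurable_large_coefficient.
  apply: measurableI; last exact: measurable_large_coefficient.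
  apply: bigcap_measurableType => l _; apply: bigcap_measurableType => k _.
  apply: measurable_fun_le => //.
  by apply: measurableT_comp => //; exact: measurable_empirical_coef.
apply/seteqP; split => y /=.
  move=> [H1 H2 H3]; split; first split => //.
    by move=> l /= lJ k /= kl; split => //; exact: H1.
  by move=> j /= [? ? ?]; exact: H3.
move=> [[H1 H2] H3]; split => //.
  by move=> l k lJ kl; have [_] := H1 l lJ k kl.
by move=> ss j j0j rj; exact: H3.
Qed.

Lemma band_statistic_center_radius n :
  band_statistic (band_center n : data_path R -> R -> R) (band_radius n).
Proof.
split.
- by move=> y; apply: continuous_within; exact: band_center_continuous.
- by move=> x _; exact: measurable_band_center.
- move=> y; apply: le_trans (ereal_sup_ubound _); last by exists 0%N.
  by rewrite lee_fin mulr_ge0// oracle_radius_ge0 ?param_s_gt0 ?param_M_gt0.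
- apply: measurable_fun_esups => i; apply/measurable_EFinP; apply: measurable_funM => //.
  by apply: measurable_indic; exact: measurable_consistent_set.
Qed.

End Statistics.

(** * Coverage and radius *)

Section NoiseEvent.
Context {R : realType} (W : wavelet_data R).
Local Notation j0 := (coarse W).
Local Notation size_ := (level_size W).
Variables (e : nat -> nat -> R -> R).
Hypothesis e_reg : forall l k, regular (e l k).
Hypothesis e_norm : forall l k, (k < size_ l)%N -> inner unitI (e l k) (e l k) = 1.
Context d (T : measurableType d) (P : probability T R) (B : R -> {RV P >-> R}).
Hypothesis BM : brownian_motion B.

Definition level_pairs (J : nat) : seq (nat * nat) :=
  [seq (l, k) | l <- iota 0 J.+1, k <- iota 0 (size_ l)].

Definition exceedance (n : nat) (p : nat * nat) : set T :=
  [set w | 2 * Num.sqrt (ln n%:R) < `|wiener_integral (e p.1 p.2) (B ^~ w)|].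

Definition noise_event (n : nat) : set T :=
  \big[setU/set0]_(p <- level_pairs (trunc_log 2 n)) exceedance n p.

Lemma measure_bigsetU_le (I : Type) (s : seq I) (A : I -> set T) :
  (forall i, measurable (A i)) ->
  (P (\big[setU/set0]_(i <- s) A i) <= \sum_(i <- s) P (A i))%E.
Proof.
move=> mA; elim: s => [|i s IH]; first by rewrite !big_nil measure0.
rewrite !big_cons; apply: (le_trans (measureU2 P (mA i) _)).
  by apply: bigsetU_measurable => j _; exact: mA.
by rewrite leeD2l.
Qed.

Lemma measurable_exceedance n p : measurable (exceedance n p).
Proof.
have mZ : measurable_fun setT (fun w => wiener_integral (e p.1 p.2) (B ^~ w)).
  exact: measurable_wiener_brownian.
rewrite (_ : exceedance n p = ~` (setT `&`
    [set w | `|wiener_integral (e p.1 p.2) (B ^~ w)| <= 2 * Num.sqrt (ln n%:R)])).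
  by apply: measurableC; apply: measurable_fun_le => //; exact: measurableT_comp.
by rewrite setTI; apply/seteqP; split => w; rewrite /exceedance/= ltNge => /negP.
Qed.

Lemma measurable_noise_event n : measurable (noise_event n).
Proof. by apply: bigsetU_measurable => p _; exact: measurable_exceedance. Qed.

Lemma size_level_pairs J : (size (level_pairs J) <= 2 ^ j0 * 2 ^ J.+1)%N.
Proof.
rewrite /level_pairs size_allpairs_dep sumnE big_map.
apply: (@leq_trans (\sum_(l <- iota 0 J.+1) 2 ^ j0 * 2 ^ l)%N).
  by apply: leq_sum => l _; rewrite size_iota level_size_le.
rewrite -big_distrr leq_mul2l; apply/orP; right.
rewrite -[iota _ _]/(index_iota 0 J.+1); elim: J => [|J IH]; first by rewrite big_nat1.
by rewrite big_nat_recr//= [leqRHS]expnS mul2n -addnn leq_add.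
Qed.

(** At most 2^(j0 + 1) n coefficients, each with tail 2 / n^2, give 2^(j0 + 2) / n, and 1 / n <= 2 /
    (n + 1) yields the stated multiple of [harmonic n]. *)
Lemma noise_event_prob n : (2 <= n)%N ->
  (P (noise_event n) <= (2 ^+ (j0 + 3) * harmonic n)%:E)%E.
Proof.
move=> n2; have nR : (0 : R) < n%:R by rewrite ltr0n (leq_trans _ n2).
apply: (le_trans (measure_bigsetU_le _ (measurable_exceedance n))).
pose t : R := 2 * expR (- (2 * Num.sqrt (ln n%:R)) ^+ 2 / 2).
apply: (@le_trans _ _ (\sum_(p <- level_pairs (trunc_log 2 n)) t%:E)%E).
  rewrite big_seq [leRHS]big_seq; apply: lee_sum => p.
  move=> /allpairsPdep[l [k [_ + ->]]]; rewrite mem_iota/= add0n => kl.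
  apply: wiener_tail => //; first exact: (e_reg l k).1.
    exact: e_norm.
rewrite sumEFin lee_fin big_const_seq count_predT iter_addr_0.
have tE : t = 2 / n%:R ^+ 2.
  rewrite /t exprMn sqr_sqrtr ?ln_ge0 ?ler1n ?(ltn_trans _ n2)//.
  rewrite (_ : - (2 ^+ 2 * ln n%:R) / 2 = - (2%:R * ln n%:R)); last by field.
  by rewrite expRN expRM_natl lnK.
rewrite tE -[_ *+ size _]mulr_natl.
apply: (@le_trans _ _ ((2 ^ j0 * 2 ^ (trunc_log 2 n).+1)%:R * (2 / n%:R ^+ 2))).
  by rewrite ler_wpM2r ?divr_ge0 ?exprn_ge0// ler_nat size_level_pairs.
have tn : (2 ^ trunc_log 2 n <= n)%N.
  by apply: trunc_logP => //; exact: leq_trans n2.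
apply: (@le_trans _ _ ((2 ^ j0 * (2 * n))%:R * (2 / n%:R ^+ 2))).
  rewrite ler_wpM2r ?divr_ge0 ?exprn_ge0// ler_nat leq_mul2l expnS.
  by rewrite leq_mul2l tn !orbT.
rewrite !natrM natrX exprD /harmonic/=.
have -> : 2 ^+ j0 * (2 * n%:R) * (2 / n%:R ^+ 2) = 2 ^+ j0 * (4 / n%:R) :> R.
  by field; exact: lt0r_neq0.
rewrite -[leRHS]mulrA ler_pM2l ?exprn_gt0// ler_pdivrMr// mulrAC ler_pdivlMr//.
have : n.+1%:R <= 2 * n%:R :> R by rewrite -natrM ler_nat; lia.
lra.
Qed.

Lemma noise_eventN n w : ~ noise_event n w ->
  forall l k, (l <= trunc_log 2 n)%N -> (k < size_ l)%N ->
    `|wiener_integral (e l k) (B ^~ w)| <= 2 * Num.sqrt (ln n%:R).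
Proof.
move=> nw l k lJ kl; rewrite leNgt; apply/negP => H; apply: nw.
rewrite /noise_event -bigcup_seq; exists (l, k) => //=.
by apply/allpairsPdep; exists l, k; rewrite !mem_iota.
Qed.

Lemma empirical_coef_near f n w : L2 unitI f -> (2 <= n)%N -> ~ noise_event n w ->
  (forall l k, (k < size_ l)%N -> inner unitI f (e l k) = level_coef W f l k) ->
  forall l k, (l <= trunc_log 2 n)%N -> (k < size_ l)%N ->
  `|empirical_coef e (white_noise B n f w) l k - level_coef W f l k| <= noise_level n.
Proof.
move=> fL n2 nw fe l k lJ kl; have [_ Bc _ _] := BM.
have intf : (@lebesgue_measure R).-integrable unitI (fun x => (f x)%:E).
  have L1 : L2 unitI (fun=> 1 : R) by apply: L2_continuous_unitI => x; exact: cvg_cst.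
  have := L2_integrableM measurable_unitI fL L1.
  by apply: eq_integrable => [|x _]; [exact: measurable_unitI|rewrite mulr1].
rewrite /empirical_coef /white_noise.
rewrite (wiener_integral_signal _ (e_reg l k).1 intf (Bc w)) fe// addrAC subrr add0r.
rewrite normrM ger0_norm ?invr_ge0 ?sqrtr_ge0//.
apply: (le_trans (ler_wpM2l _ (noise_eventN nw lJ kl))).
  by rewrite invr_ge0 sqrtr_ge0.
rewrite mulrCA /noise_level ler_pM2l// mulrC sqrtrM; last first.
  by rewrite ln_ge0// ler1n (ltn_trans _ n2).
by rewrite sqrtrV.
Qed.

End NoiseEvent.

Section Coverage.
Context {R : realType} (W : wavelet_data R).
Local Notation j0 := (coarse W).
Local Notation size_ := (level_size W).
Local Notation mu := (@lebesgue_measure R).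
Hypothesis hW : cdv_basis W.
Variables (e : nat -> nat -> R -> R) (D smax eps : R) (rho : nat).
Hypotheses (D_gt0 : 0 < D) (e_reg : forall l k, regular (e l k)).
Hypothesis e_ae : forall l k, (k < level_size W l)%N ->
  {ae mu, forall x, unitI x -> e l k x = level_fun W l k x}.
Hypothesis e_sum : forall l x,
  \sum_(0 <= k < level_size W l) `|e l k x| <= D * 2 `^ (l%:R / 2).
Hypotheses (smax_gt0 : 0 < smax) (eps01 : 0 < eps < 1) (rho_gt0 : (0 < rho)%N).

(** The grid pair near (s, M) has s' <= s and M' >= M, so it is consistent and its error bounds
    dominate the true ones at every resolution. The radius is at least their minimum, hence at least
    the actual error. *)
Lemma self_similar_covered n (s M : R) f (y : data_path R) :
  (rho * j0 <= trunc_log 2 n)%N -> 0 < s <= smax -> 0 < M ->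
  self_similar W smax eps rho s M f ->
  (forall l k, (l <= trunc_log 2 n)%N -> (k < size_ l)%N ->
    `|empirical_coef e y l k - level_coef W f l k| <= noise_level n) ->
  in_band f (band (band_center W e n y) (band_radius W e D smax eps rho n y)).
Proof.
move=> rj s0s M0 sf near; have eps0 : 0 < eps by case/andP: eps01.
have s0 : 0 < s by case/andP: s0s.
have [g [gc gf gP]] := expansion hW D_gt0 e_reg e_ae e_sum s0 M0 sf.1.
set J := trunc_log 2 n in rj near *.
have cle := (Cs_norm_le hW s M f).1 sf.1.2.
have [a [b [ss' Js sm]]] := grid_s_near smax_gt0 J s0s.
have [c [d MM']] := grid_M_near M0.
pose i := pickle (a, b, c, d).
have si : param_s smax i = grid_s smax a b by rewrite /param_s /grid_param /i pickleK.
have Mi : param_M i = grid_M c d :> R by rewrite /param_M /grid_param /i pickleK.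
have cons : consistent_set W e smax eps rho n i y.
  rewrite /consistent_set/= si Mi.
  apply: (consistent_near M0 eps01 cle _ near) => //.
    have := self_similar_large hW eps0 M0 rho_gt0 sf (leqnn j0) (or_intror erefl).
    by rewrite eqxx.
  move=> slt j j0j.
  have := self_similar_large hW eps0 M0 rho_gt0 sf (ltnW j0j) (or_introl slt).
  by rewrite gtn_eqF.
apply: (in_band_le gc gf) => x _.
apply: le_trans (band_radius_ge _ cons); rewrite lee_fin si Mi.
have H j : (j <= J)%N ->
    `|g x - band_center W e n y x| <=
    error_bound D (noise_level n) (grid_s smax a b) (grid_M c d) j.
  move=> jJ; apply: (@le_trans _ _ (error_bound D (noise_level n) s M j)).
    apply: (thresholding_bound D_gt0 s0 M0 (noise_level_ge0 _) jJ _ cle near) => //.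
  apply: error_bound_le => //; first exact: grid_s_gt0.
  by case/andP: MM'.
apply/bigmin_geP; split; first exact: H.
by move=> [j jJ] _; apply: H.
Qed.

(** For each consistent pair the minimum over resolutions is at most the bound at the resolution
    optimal for the true pair. The rank [n0] depends on s and M, but not on f. *)
Lemma self_similar_radius (s M : R) : 0 < s <= smax -> 0 < M ->
  exists n0, forall n, (n0 <= n)%N -> forall f (y : data_path R),
  self_similar W smax eps rho s M f ->
  (forall l k, (l <= trunc_log 2 n)%N -> (k < size_ l)%N ->
    `|empirical_coef e y l k - level_coef W f l k| <= noise_level n) ->
  (band_radius W e D smax eps rho n y <=
   (rate_constant smax eps (eps / 8) D rho * M `^ (1 / (2 * s + 1)) / (2 `^ s - 1)
     * rate n s)%:E)%E.
Proof.
move=> s0s M0; have /andP[eps0 eps1] := eps01.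
have e8 : 0 < eps / 8 < 1 by apply/andP; split; lra.
have [n0 H] := error_bound_consistent size_ j0 eps01 e8 rho_gt0 D_gt0 s0s M0.
exists n0 => n nn0 f y sf near.
have cle := (Cs_norm_le hW s M f).1 sf.1.2.
have large := self_similar_large hW eps0 M0 rho_gt0 sf (leqnn j0) (or_intror erefl).
rewrite eqxx in large.
apply: band_radius_le => //.
  have s0 : 0 < s by case/andP: s0s.
  rewrite mulr_ge0 ?powR_ge0// !mulr_ge0 ?invr_ge0 ?powR_ge0//.
    exact/ltW/rate_constant_gt0.
  by rewrite subr_ge0 ltW// pow2_gt1.
move=> i cons.
have [j jJ] := H n nn0 _ _ cle large near _ _ (param_s_gt0 smax_gt0 i) (param_M_gt0 i) cons.
by apply: le_trans; exact: (bigmin_le _ (Ordinal (jJ : (j < (trunc_log 2 n).+1)%N))).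
Qed.

End Coverage.

Lemma limn_esup_le (R : realType) (u : (\bar R)^nat) (c : \bar R) (n0 : nat) :
  (forall n, (n0 <= n)%N -> (u n <= c)%E) -> (limn_esup u <= c)%E.
Proof.
move=> H; rewrite limn_esup_lim; apply: lime_le; first exact: is_cvg_esups.
exists n0 => // n /= nn0; apply: ge_ereal_sup => _ [m /= nm <-].
by apply: H; exact: leq_trans nm.
Qed.

Section BandProbabilities.
Context {R : realType} (W : wavelet_data R).
Local Notation j0 := (coarse W).
Local Notation size_ := (level_size W).
Local Notation mu := (@lebesgue_measure R).
Hypothesis hW : cdv_basis W.
Variables (e : nat -> nat -> R -> R) (D smax eps : R) (rho : nat).
Hypotheses (D_gt0 : 0 < D) (e_reg : forall l k, regular (e l k)).
Hypothesis e_ae : forall l k, (k < level_size W l)%N ->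
  {ae mu, forall x, unitI x -> e l k x = level_fun W l k x}.
Hypothesis e_sum : forall l x,
  \sum_(0 <= k < level_size W l) `|e l k x| <= D * 2 `^ (l%:R / 2).
Hypotheses (smax_gt0 : 0 < smax) (eps01 : 0 < eps < 1) (rho_gt0 : (0 < rho)%N).
Context d (T : measurableType d) (P : probability T R) (B : R -> {RV P >-> R}).
Hypothesis BM : brownian_motion B.

Local Notation center n f w := (band_center W e n (white_noise B n f w)).
Local Notation radius n f w := (band_radius W e D smax eps rho n (white_noise B n f w)).

Lemma measurable_white_noise n f : measurable_fun setT (white_noise B n f).
Proof.
apply: measurable_into_paths => t _; apply: measurable_funD => //.
by apply: measurable_funM => //; exact: measurable_funPT.
Qed.

Lemma Cs_ball_near f s M n w : Cs_ball W s M f -> (2 <= n)%N ->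
  ~ noise_event W e B n w ->
  forall l k, (l <= trunc_log 2 n)%N -> (k < size_ l)%N ->
  `|empirical_coef e (white_noise B n f w) l k - level_coef W f l k| <= noise_level n.
Proof.
move=> [fL _] n2 nw; apply: (empirical_coef_near e_reg BM) => // l k.
exact: (smooth_coef hW e_reg e_ae).
Qed.

Lemma prob_subset_noise_event n (A : set T) : (2 <= n)%N -> measurable A ->
  A `<=` noise_event W e B n ->
  (P A <= (2 ^+ (j0 + 3) * harmonic n)%:E)%E.
Proof.
move=> n2 mA AN; apply: le_trans (noise_event_prob e_reg _ BM n2); last first.
  by move=> l k kl; exact: (smooth_norm hW e_reg e_ae).
by apply: le_measure => //; rewrite inE//; exact: measurable_noise_event.
Qed.

(** The conditions on n involve neither s, M nor f: the levels up to [rho * j0] must be observed and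
    n must be at least 2. The bound is thus uniform over the union of all classes. *)
Lemma noncoverage_prob n f : (2 ^ (rho * j0) <= n)%N -> (2 <= n)%N ->
  self_similar_union W smax eps rho f ->
  (P [set w | ~ in_band f (band (center n f w) (radius n f w))] <=
   (2 ^+ (j0 + 3) * harmonic n)%:E)%E.
Proof.
move=> nj n2 [s [M [s0s M0 sf]]]; have s0 : 0 < s by case/andP: s0s.
have mY := measurable_white_noise n f.
have [_ mc _ mr] := band_statistic_center_radius W eps rho e_reg D_gt0 smax_gt0 n.
have [g [gc gf _]] := expansion hW D_gt0 e_reg e_ae e_sum s0 M0 sf.1.
apply: prob_subset_noise_event => //.
  apply: (measurable_noncoverage gc gf).
  - by move=> w; apply: continuous_within; exact: band_center_continuous.
  - by move=> x ux; exact: (measurableT_comp (mc x ux) mY).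
  - exact: (measurableT_comp mr mY).
move=> w; apply: contra_notP => nw.
apply: (self_similar_covered hW D_gt0 e_reg e_ae e_sum smax_gt0 eps01 rho_gt0 _ s0s M0 sf).
  exact: trunc_log_max.
exact: (Cs_ball_near sf.1 n2 nw).
Qed.

Lemma large_radius_prob (s M : R) : 0 < s <= smax -> 0 < M ->
  exists n0, forall n, (n0 <= n)%N -> forall f, self_similar W smax eps rho s M f ->
  (P [set w | ((rate_constant smax eps (eps / 8) D rho * M `^ (1 / (2 * s + 1))
      / (2 `^ s - 1) * rate n s)%:E < radius n f w)%E] <=
   (2 ^+ (j0 + 3) * harmonic n)%:E)%E.
Proof.
move=> s0s M0.
have [n0 H] := self_similar_radius hW e D_gt0 smax_gt0 eps01 rho_gt0 s0s M0.
exists (maxn n0 2) => n; rewrite geq_max => /andP[nn0 n2] f sf.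
have [_ _ _ mr] := band_statistic_center_radius W eps rho e_reg D_gt0 smax_gt0 n.
have mrY := measurableT_comp mr (measurable_white_noise n f).
apply: prob_subset_noise_event => //.
  rewrite -[X in measurable X]setTI; exact: emeasurable_fun_o_infty.
move=> w /=; rewrite ltNge => /negP; apply: contra_notP => nw.
by apply: (H n nn0 f) => //; exact: (Cs_ball_near sf.1 n2 nw).
Qed.

End BandProbabilities.

Lemma cvg_harmonicZ (R : realType) (C : R) :
  ((C * harmonic n)%:E : \bar R) @[n --> \oo] --> 0%E.
Proof.
apply: cvg_EFin; first by near=> n.
rewrite -[X in _ --> X](mulr0 C); apply: cvgMl_tmp; exact: cvg_harmonic.
Unshelve. all: by end_near.
Qed.

Theorem theorem3p3 (R : realType) (W : wavelet_data R) (hW : cdv_basis W)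
    (smax : R) (hsmax : 0 < smax < (momN W)%:R)
    (eps : R) (heps : 0 < eps < 1)
    (rho : nat) (hrho : (0 < rho)%N)
    (gamma : R) (hgamma : 0 < gamma < 1) :
  exists (fhat : nat -> data_path R -> R -> R) (rad : nat -> data_path R -> \bar R)
         (L : R),
    [/\ forall n, band_statistic (fhat n) (rad n),
        0 < L
      & forall (d : measure_display) (T : measurableType d)
               (P : probability T R) (B : R -> {RV P >-> R}),
          brownian_motion B ->
          (limn_esup (fun n : nat =>
             ereal_sup
               [set P [set w | ~ in_band f
                                   (band (fhat n (white_noise B n f w))
                                         (rad n (white_noise B n f w)))]
               | f in self_similar_union W smax eps rho])
             <= gamma%:E)%E
          /\
          (forall s M : R, 0 < s <= smax -> 0 < M ->
             (fun n : nat =>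
                ereal_sup
                  [set P [set w |
                      ((L * M `^ (1 / (2 * s + 1)) / (2 `^ s - 1)
                          * rate n s)%R%:E
                       < rad n (white_noise B n f w))%E]
                  | f in self_similar W smax eps rho s M])
             @ \oo --> 0%E)].
Proof.
have /andP[smax0 _] := hsmax; have /andP[eps0 eps1] := heps.
have /andP[gamma0 _] := hgamma.
have [e [D [D0 e_reg e_ae e_sum]]] := smooth_basis hW.
exists (band_center W e), (band_radius W e D smax eps rho),
  (rate_constant smax eps (eps / 8) D rho); split.
- by move=> n; exact: band_statistic_center_radius.
- by apply: rate_constant_gt0 => //; apply/andP; split; lra.
move=> d T P B BM; pose C : R := 2 ^+ (coarse W + 3).
split=> [|s M s0s M0].
(* The non-coverage probability is at most a constant times 1 / (n + 1), hence eventually below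
   [gamma]. *)
- have : \forall n \near \oo, C * harmonic n < gamma.
    have /fine_cvgP[_] := cvg_harmonicZ C.
    by move=> /cvgr_lt; apply.
  move=> [n1 _ Hn1]; pose n2 := maxn n1 (maxn 2 (2 ^ (rho * coarse W))).
  apply: (@limn_esup_le _ _ _ n2) => n; rewrite !geq_max => /and3P[nn1 n2' nj].
  apply: ge_ereal_sup => _ [f sf <-].
  apply: le_trans (noncoverage_prob hW D0 e_reg e_ae e_sum smax0 heps hrho BM nj n2' sf) _.
  by rewrite lee_fin ltW// Hn1.
- have [n0 Hn0] :=
    large_radius_prob hW D0 e_reg e_ae smax0 heps hrho BM s0s M0.
  have s0 : 0 < s by case/andP: s0s.
  have [f0 sf0] := self_similar_nonempty hW D0 e_reg e_ae e_sum smax s0 M0 heps hrho.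
  apply: (@squeeze_cvge _ _ _ _ (cst 0%E) _ (fun n => (C * harmonic n)%:E)).
  + exists n0 => // n /= nn0; apply/andP; split.
      apply: (@le_trans _ _ (P [set w | _])); last by apply: ereal_sup_ubound; exists f0.
      exact: measure_ge0.
    by apply: ge_ereal_sup => _ [f sf <-]; exact: Hn0.
  + exact: cvg_cst.
  + exact: cvg_harmonicZ.
Qed.
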